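(* Let $n\ge 2$, $\alpha\in(0,1)$, $p\in(1,\infty)$, and let $q$ be the Hölder conjugate of $p$, i.e. $1/p+1/q=1$. Let $f:\mathbb B^n\to\mathbb C$ be an outer function, let $\phi:=|f|$ on $\mathbb S^n$, and suppose that for some constant $C_0>0$ one has $|\phi(t)-\phi(\mathbf 1)|\le C_0\,d(t,\mathbf 1)^{\alpha}$ for all $t\in\mathbb S^n$. Suppose also that $B_p:=\int_{\mathbb S^n}|\log\phi|^p\,d\sigma<\infty$. Then for all nonisotropic balls $Q\subseteq\mathbb S^n$ containing the point $\mathbf 1$, $$\nu(f,Q)\le C\, l(Q)^{\frac{\alpha}{n+1-\frac{n}{q}}},$$ where the constant $C$ depends only on $B_p$, $C_0$, $\alpha$ and $n$ (the exponent $p$ being fixed).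
   Context: $\mathbb B^n=\{z\in\mathbb C^n:|z|<1\}$ is the open unit ball of $\mathbb C^n$, $\mathbb S^n=\{z\in\mathbb C^n:|z|=1\}$ is its boundary unit sphere, $\langle z,w\rangle=\sum_{j=1}^n z_j\overline{w_j}$, $\sigma$ is the rotation-invariant Borel probability measure on $\mathbb S^n$, and $\mathbf 1:=(1,0,\dots,0)\in\mathbb S^n$. Cauchy kernel: $C(z,\xi)=(1-\langle z,\xi\rangle)^{-n}$ for $z\in\mathbb B^n$, $\xi\in\mathbb S^n$. Outer function: a function $f:\mathbb B^n\to\mathbb C$ is called outer if for all $z\in\mathbb B^n$ $$f(z)=\exp\Big[\int_{\mathbb S^n}(2C(z,\xi)-1)\,\mathrm{Re}(\log f(\xi))\,d\sigma(\xi)\Big],$$ where, for $\xi\in\mathbb S^n$, $f(\xi)$ denotes the boundary value $\lim_{r\to1^-}f(r\xi)$ (existing for $\sigma$-a.e. $\xi$), $\mathrm{Re}(\log f(\xi))=\log|f(\xi)|$, and $\log|f|\in L^1(\mathbb S^n,\sigma)$. On $\mathbb S^n$, $f$ and $\phi=|f|$ denote these boundary functions; $\phi:\mathbb S^n\to[0,\infty)$ is the representative of the a.e. defined boundary modulus for which the Hölder inequality at $\mathbf 1$ holds at every $t$. Nonisotropic quasimetric: $d(u,v):=|1-\langle u,v\rangle|$ for $u,v\in\mathbb S^n$. A nonisotropic ball is a set $Q=\{z\in\mathbb S^n:d(z,\xi)\le r\}$ with $\xi\in\mathbb S^n$ and radius $l(Q):=r>0$. We write $|Q|=\sigma(Q)$.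 Mean oscillation: for a summable $f:\mathbb S^n\to\mathbb C$ and a nonisotropic ball $Q$, $$\nu(f,Q):=\inf_{a\in\mathbb C}\frac1{|Q|}\int_Q|f(z)-a|\,d\sigma(z).$$ *)

(* Defs.v *)
From HB Require Import structures.
From mathcomp Require Import all_boot all_order all_algebra.
From mathcomp Require Import complex.
From mathcomp Require Import all_classical all_reals all_analysis.

Set Implicit Arguments.
Unset Strict Implicit.
Unset Printing Implicit Defensive.

Import Order.TTheory GRing.Theory Num.Theory.
Import numFieldNormedType.Exports.

Local Open Scope classical_set_scope.
Local Open Scope ring_scope.
Local Open Scope complex_scope.

(* The complex numbers over [R], packaged as a [numClosedFieldType]: the
   topology of a number field is attached to the packaged structures, not to
   the bare type [R[i]]. *)
Definition Cplx (R : realType) : numClosedFieldType := R[i].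

Definition cabs (R : realType) (z : Cplx R) : R := ComplexField.Normc.normc z.

Definition cexp (R : realType) (z : Cplx R) : Cplx R :=
  (expR (complex.Re z) * cos (complex.Im z)) +i* (expR (complex.Re z) * sin (complex.Im z)).

Definition Cn (R : realType) (n : nat) := 'rV[Cplx R]_n.

Definition BorelCn (R : realType) (n : nat) :=
  g_sigma_algebraType (@open (Cn R n)).

Section UnitBall.
Context {R : realType} {n : nat}.
Implicit Types (z w xi : Cn R n).

Definition hdot z w : Cplx R := \sum_(j < n) z 0 j * (w 0 j)^*%R.

(* The Euclidean norm; the library norm on row vectors is the sup norm. *)
Definition enorm z : R := Num.sqrt (complex.Re (hdot z z)).

Definition rscale (r : R) z : Cn R n := (r%:C : Cplx R) *: z.

Definition unit_ball : set (Cn R n) := [set z | enorm z < 1].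

Definition unit_sphere : set (Cn R n) := [set z | enorm z = 1].

Definition e1 : Cn R n := \row_(j < n) (val j == 0%N)%:R.

Definition cauchy_kernel z xi : Cplx R := (1 - hdot z xi) ^- n.

Definition ndist z w : R := cabs (1 - hdot z w).

Definition nball xi (r : R) : set (Cn R n) :=
  [set z | unit_sphere z /\ ndist z xi <= r].

(* Orthogonal transformations of C^n = R^(2n), i.e. R-linear isometries. *)
Definition rotation (T : Cn R n -> Cn R n) : Prop :=
  [/\ forall z w, T (z + w) = T z + T w,
      forall (a : R) z, T (rscale a z) = rscale a (T z)
    & forall z, enorm (T z) = enorm z].

(* The measure sigma, as a Borel measure on C^n carried by the sphere. *)
Definition rotation_invariant_sphere_measure
    (sigma : probability (BorelCn R n) R) : Prop :=
  sigma unit_sphere = 1%E /\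
  forall T : Cn R n -> Cn R n, rotation T ->
  forall A : set (BorelCn R n), measurable A -> sigma (T @^-1` A) = sigma A.

Definition radial (f : Cn R n -> Cplx R) xi : R -> Cplx R :=
  fun r => f (rscale r xi).

Definition boundary_value (f : Cn R n -> Cplx R) xi : Cplx R :=
  lim (radial f xi r @[r --> (1 : R)^'-]).

Definition Cintegral (mu : probability (BorelCn R n) R) (D : set (Cn R n))
    (g : Cn R n -> Cplx R) : Cplx R :=
  (\int[mu]_(x in D) complex.Re (g x)) +i* (\int[mu]_(x in D) complex.Im (g x)).

(* [lne 0 = -oo], so the integrability condition makes the boundary values
   nonzero almost everywhere; in the exponent, [ln] (with [ln 0 = 0]) then
   differs from [lne] on a null set only. *)
Definition outer (sigma : probability (BorelCn R n) R)
    (f : Cn R n -> Cplx R) : Prop :=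
  [/\ {ae sigma, forall xi, unit_sphere xi ->
         cvg (radial f xi r @[r --> (1 : R)^'-])},
      sigma.-integrable unit_sphere
        (fun xi => lne (cabs (boundary_value f xi))%:E)
    & forall z, unit_ball z ->
      f z = cexp (Cintegral sigma unit_sphere (fun xi =>
              (2 * cauchy_kernel z xi - 1) *
              (ln (cabs (boundary_value f xi)))%:C))].

Definition mean_oscillation (sigma : probability (BorelCn R n) R)
    (g : Cn R n -> Cplx R) (Q : set (Cn R n)) : \bar R :=
  ereal_inf [set ((fine (sigma Q))^-1%:E *
                  \int[sigma]_(z in Q) (cabs (g z - a))%:E)%E
            | a in [set: Cplx R]].

End UnitBall.

(* Main.v *)
(* Write gamma for the exponent, m = log phi(1) and G = log |f| - m on the
   sphere.  If phi(1) <= M r^gamma, then |f| itself is O(r^gamma) on Q.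
   Otherwise log |f| is Hoelder near 1: with 2 C0 rho^alpha = phi(1) one has
   |G| <= (d/rho)^alpha for d <= rho, and f = exp (m + int (2C - 1) G).  Cut G
   at distance 320 r from 1.  The near part is small in L^1(Q) because the
   Cauchy operators A_s h(z) = int C(sz, x) h(x) are L^2-contractions: they are
   self-adjoint and A_s A_t = A_(st) by Cauchy's formula, so that
   ||A_s h||^2 <= ||h|| ||A_(s^2) h||, and this can be iterated.  The far part
   is a constant c, plus a form linear in the component of z orthogonal to 1,
   plus an error of order r int d^(-n-1) |G|, where Young's inequality brings
   in B_p and yields the exponent.  The linear form need not be small a priori,
   but the real part of the logarithm tends to the small function G, and the
   rotations fixing 1 and multiplying its orthogonal complement by -1 or i
   separate c from the form and its real part from its imaginary part.
   Exponentiating, f is close to exp (m + i Im c). *)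

Require Import Defs.
From HB Require Import structures.
From mathcomp Require Import all_boot all_order all_algebra.
From mathcomp Require Import complex.
From mathcomp Require Import all_classical all_reals all_analysis.
From mathcomp Require Import measurable_realfun.
From mathcomp Require Import ring lra zify.
Import Order.TTheory GRing.Theory Num.Theory.
Import numFieldNormedType.Exports.
Local Open Scope classical_set_scope.
Local Open Scope complex_scope.
Local Open Scope ring_scope.
Set Implicit Arguments.
Unset Strict Implicit.
Unset Printing Implicit Defensive.

(** The obstacle is the imaginary part of log f: only |f| is controlled, and no radial limit of the
    logarithm itself is assumed. Hence the estimates are made in L^1 at radii s < 1, with a constant
    and a form independent of s, and Fatou's lemma is applied along a sequence s_j; at a boundary
    point only f and Re log f converge.

    The exponent comes from one balance. Here n + 1 - n/q = 1 + n/p. Beyond the distance rho, G is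
    known only through the p-th moment, which contributes r rho^-(1 + n/p) to the oscillation of the
    logarithm, while exponentiation multiplies by phi(1) = 2 C0 rho^alpha. When phi(1) exceeds M
    r^gamma one has r <= rho^(1 + n/p), precisely the range in which the product is O(r^gamma). The
    number m is unbounded when phi(1) is small, but |m| = O(rho^(-n/p)) is harmless there; an upper
    bound of phi(1) comes from B_p.

    The number 320 is 64 times 5: Q lies within distance 4 r of 1, the points s z with 1 - s <= r
    within 5 r, and the expansion of the kernel asks x to be 64 times farther. *)

Local Notation Rintegrable mu D f := (mu.-integrable D (EFin \o f)).

(** * Complex-valued integrals *)

Section ComplexBasics.
Context {R : realType}.
Implicit Types z w : Cplx R.

Lemma cReD z w : complex.Re (z + w) = complex.Re z + complex.Re w.
Proof. by case: z; case: w. Qed.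
Lemma cImD z w : complex.Im (z + w) = complex.Im z + complex.Im w.
Proof. by case: z; case: w. Qed.
Lemma cReN z : complex.Re (- z) = - complex.Re z.
Proof. by case: z. Qed.
Lemma cImN z : complex.Im (- z) = - complex.Im z.
Proof. by case: z. Qed.
Lemma cReM z w : complex.Re (z * w) =
  complex.Re z * complex.Re w - complex.Im z * complex.Im w.
Proof. by case: z; case: w. Qed.
Lemma cImM z w : complex.Im (z * w) =
  complex.Re z * complex.Im w + complex.Im z * complex.Re w.
Proof. by case: z; case: w. Qed.
Lemma cconjE z : z^* = (complex.Re z +i* - complex.Im z)%C :> Cplx R.
Proof. by case: z. Qed.
Lemma cReR (x : R) : complex.Re (x%:C : Cplx R) = x. Proof. by []. Qed.
Lemma cImR (x : R) : complex.Im (x%:C : Cplx R) = 0. Proof. by []. Qed.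
Lemma Cext z w : complex.Re z = complex.Re w -> complex.Im z = complex.Im w ->
  z = w.
Proof. by case: z; case: w => a b c d /= -> ->. Qed.

Lemma conjM z w : (z * w)^* = z^* * w^*.
Proof. exact: rmorphM. Qed.
Lemma conjD z w : (z + w)^* = z^* + w^*.
Proof. exact: rmorphD. Qed.
Lemma conjN z : (- z)^* = - z^*.
Proof. exact: rmorphN. Qed.
Lemma conj1 : (1 : Cplx R)^* = 1.
Proof. exact: rmorph1. Qed.
Lemma conj0 : (0 : Cplx R)^* = 0.
Proof. exact: rmorph0. Qed.
Lemma conjX z k : (z ^+ k)^* = z^* ^+ k.
Proof. exact: rmorphXn. Qed.
Lemma conjV z : (z^-1)^* = (z^*)^-1.
Proof. exact: fmorphV. Qed.
Lemma conjR (x : R) : (x%:C : Cplx R)^* = x%:C.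
Proof. by rewrite cconjE; apply: Cext => //=; rewrite oppr0. Qed.

Lemma cabs_ge0 z : 0 <= cabs z.
Proof. by case: z => a b; rewrite sqrtr_ge0. Qed.
Lemma cabsM z w : cabs (z * w) = cabs z * cabs w.
Proof. exact: ComplexField.Normc.normcM. Qed.
Lemma cabsD z w : cabs (z + w) <= cabs z + cabs w.
Proof. exact: le_normcD. Qed.
Lemma cabsN z : cabs (- z) = cabs z.
Proof. exact: normcN. Qed.
Lemma cabsB z w : cabs (z - w) <= cabs z + cabs w.
Proof. by rewrite -(cabsN w) cabsD. Qed.
Lemma cabsV z : cabs z^-1 = (cabs z)^-1.
Proof. exact: ComplexField.Normc.normcV. Qed.
Lemma cabs0 : cabs (0 : Cplx R) = 0. Proof. exact: ComplexField.Normc.normc0. Qed.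
Lemma cabs1 : cabs (1 : Cplx R) = 1. Proof. exact: ComplexField.Normc.normc1. Qed.
Lemma cabsX z k : cabs (z ^+ k) = cabs z ^+ k.
Proof. by elim: k => [|k IH]; rewrite ?expr0 ?cabs1// !exprS cabsM IH. Qed.
Lemma cabs_eq0 z : cabs z = 0 -> z = 0.
Proof. exact: ComplexField.Normc.eq0_normc. Qed.
Lemma cabs_sqr z : cabs z ^+ 2 = complex.Re z ^+ 2 + complex.Im z ^+ 2.
Proof. by case: z => a b; rewrite /cabs sqr_sqrtr// addr_ge0 ?sqr_ge0. Qed.
Lemma cabs_real (x : R) : cabs (x%:C : Cplx R) = `|x|.
Proof. by rewrite /cabs/= expr0n /= addr0 sqrtr_sqr. Qed.
Lemma cabs_conj z : cabs z^* = cabs z.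
Proof. by rewrite cconjE; case: z => a b; rewrite /cabs /= sqrrN. Qed.
Lemma Re_le_cabs z : `|complex.Re z| <= cabs z.
Proof.
by case: z => a b; rewrite /cabs /= -sqrtr_sqr ler_wsqrtr// lerDl sqr_ge0.
Qed.
Lemma Im_le_cabs z : `|complex.Im z| <= cabs z.
Proof.
by case: z => a b; rewrite /cabs /= -sqrtr_sqr ler_wsqrtr// lerDr sqr_ge0.
Qed.
Lemma cabs_le_ReIm z : cabs z <= `|complex.Re z| + `|complex.Im z|.
Proof.
rewrite -(ler_pXn2r (n := 2))// ?nnegrE ?cabs_ge0 ?addr_ge0//.
rewrite cabs_sqr sqrrD !real_normK ?num_real//.
by rewrite lerD2r lerDl mulrn_wge0// mulr_ge0.
Qed.
Lemma mulC_conj z : z * z^* = (cabs z ^+ 2)%:C.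
Proof.
by apply: Cext; rewrite cconjE ?cReM ?cImM /= ?cabs_sqr; ring.
Qed.
Lemma normCE z : `|z| = (cabs z)%:C.
Proof. by []. Qed.
Lemma cabs_nat (k : nat) : cabs (k%:R : Cplx R) = k%:R.
Proof.
have -> : (k%:R : Cplx R) = (k%:R : R)%:C by rewrite rmorph_nat.
by rewrite cabs_real normr_nat.
Qed.
Lemma ler_dist_cabs z w : `|cabs z - cabs w| <= cabs (z - w).
Proof.
have h (u v : Cplx R) : cabs u - cabs v <= cabs (u - v).
  by rewrite lerBlDr -[X in cabs X <= _](subrK v) cabsD.
rewrite ler_norml h andbT -subr_ge0 opprK addrC.
by have := h w z; rewrite -(cabsN (w - z)) opprB => H; lra.
Qed.
Lemma cabs_sum (I : Type) (r : seq I) (P : pred I) (F : I -> Cplx R) :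
  cabs (\sum_(i <- r | P i) F i) <= \sum_(i <- r | P i) cabs (F i).
Proof.
elim/big_rec2 : _ => [|i y1 y2 _ H]; first by rewrite cabs0.
by rewrite (le_trans (cabsD _ _))// lerD2l.
Qed.
Lemma real_complexM (x y : R) : (x * y)%:C = x%:C * y%:C :> Cplx R.
Proof. exact: rmorphM. Qed.
Lemma real_complexD (x y : R) : (x + y)%:C = x%:C + y%:C :> Cplx R.
Proof. exact: rmorphD. Qed.

Lemma real_complexV (x : R) : (x^-1)%:C = (x%:C)^-1 :> Cplx R.
Proof. exact: fmorphV. Qed.
Lemma real_complexX (x : R) k : (x ^+ k)%:C = (x%:C) ^+ k :> Cplx R.
Proof. exact: rmorphXn. Qed.

Lemma cabs_cexp z : cabs (cexp z) = expR (complex.Re z).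
Proof.
apply/eqP; rewrite -(eqrXn2 (n := 2))// ?cabs_ge0 ?expR_ge0//.
by rewrite cabs_sqr /= !exprMn -mulrDr cos2Dsin2 mulr1.
Qed.
Lemma cexpD z w : cexp (z + w) = cexp z * cexp w.
Proof.
by apply: Cext; rewrite ?cReM ?cImM /= cReD cImD expRD ?cosD ?sinD; ring.
Qed.
End ComplexBasics.

Section ComplexIntegral.
Context d (T : measurableType d) (R : realType).
Variable mu : {measure set T -> \bar R}.
Implicit Types (D : set T) (f g : T -> Cplx R).

(** The body of [Cintegral] over an arbitrary measured space. At [sigma] the two are convertible,
    which [outer_radial] relies on. *)
Definition Cint D g : Cplx R :=
  ((\int[mu]_(x in D) complex.Re (g x)) +i* (\int[mu]_(x in D) complex.Im (g x)))%C.

Definition Cmeas D g :=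
  measurable_fun D (fun x => complex.Re (g x)) /\
  measurable_fun D (fun x => complex.Im (g x)).

Definition Cintable D g :=
  Rintegrable mu D (fun x => complex.Re (g x)) /\
  Rintegrable mu D (fun x => complex.Im (g x)).

Lemma CmeasM D f g : Cmeas D f -> Cmeas D g -> Cmeas D (fun x => f x * g x).
Proof.
move=> [f1 f2] [g1 g2]; split.
  apply: (eq_measurable_fun (fun x => complex.Re (f x) * complex.Re (g x) -
    complex.Im (f x) * complex.Im (g x))) => [x _|]; first by rewrite cReM.
  by apply: measurable_funB; apply: measurable_funM.
apply: (eq_measurable_fun (fun x => complex.Re (f x) * complex.Im (g x) +
    complex.Im (f x) * complex.Re (g x))) => [x _|]; first by rewrite cImM.
by apply: measurable_funD; apply: measurable_funM.
Qed.

Lemma CmeasD D f g : Cmeas D f -> Cmeas D g -> Cmeas D (fun x => f x + g x).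
Proof.
move=> [f1 f2] [g1 g2]; split.
  apply: (eq_measurable_fun (fun x => complex.Re (f x) + complex.Re (g x)))
    => [x _|]; [by rewrite cReD|exact: measurable_funD].
apply: (eq_measurable_fun (fun x => complex.Im (f x) + complex.Im (g x)))
  => [x _|]; [by rewrite cImD|exact: measurable_funD].
Qed.

Lemma Cmeas_cst D (c : Cplx R) : Cmeas D (fun=> c).
Proof. by split; exact: measurable_cst. Qed.

Lemma Cmeas_real D (f : T -> R) : measurable_fun D f ->
  Cmeas D (fun x => (f x)%:C).
Proof. by move=> mf; split => //=; exact: measurable_cst. Qed.

Lemma Cmeas_conj D f : Cmeas D f -> Cmeas D (fun x => (f x)^*).
Proof.
move=> [f1 f2]; split.
  by apply: (eq_measurable_fun (fun x => complex.Re (f x))) => // x _;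
    rewrite cconjE.
apply: (eq_measurable_fun (fun x => - complex.Im (f x))) => [x _|].
  by rewrite cconjE.
exact: measurableT_comp.
Qed.

Lemma CmeasN D f : Cmeas D f -> Cmeas D (fun x => - f x).
Proof.
move=> [f1 f2]; split.
  apply: (eq_measurable_fun (fun x => - complex.Re (f x))) => [x _|].
    by rewrite cReN.
  exact: measurableT_comp.
apply: (eq_measurable_fun (fun x => - complex.Im (f x))) => [x _|].
  by rewrite cImN.
exact: measurableT_comp.
Qed.

Lemma CmeasB D f g : Cmeas D f -> Cmeas D g -> Cmeas D (fun x => f x - g x).
Proof. by move=> mf mg; apply: CmeasD => //; exact: CmeasN. Qed.

Lemma CmeasX D f k : Cmeas D f -> Cmeas D (fun x => f x ^+ k).
Proof.
move=> mf; elim: k => [|k IH]; first exact: Cmeas_cst.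
have -> : (fun x => f x ^+ k.+1) = (fun x => f x * f x ^+ k).
  by apply/funext => x; rewrite exprS.
exact: CmeasM.
Qed.

Lemma Cmeas_sum D (I : Type) (r : seq I) (F : I -> T -> Cplx R) :
  (forall i, Cmeas D (F i)) -> Cmeas D (fun x => \sum_(i <- r) F i x).
Proof.
move=> mF; elim: r => [|i r IH].
  have -> : (fun x => \sum_(i <- [::]) F i x) = (fun=> 0).
    by apply/funext => x; rewrite big_nil.
  exact: Cmeas_cst.
have -> : (fun x => \sum_(j <- i :: r) F j x) =
    (fun x => F i x + \sum_(j <- r) F j x).
  by apply/funext => x; rewrite big_cons.
exact: CmeasD.
Qed.

Lemma measurable_cabs D f : Cmeas D f -> measurable_fun D (fun x => cabs (f x)).
Proof.
move=> [f1 f2].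
apply: (eq_measurable_fun ((@powR R)^~ 2^-1 \o (fun x =>
  complex.Re (f x) ^+ 2 + complex.Im (f x) ^+ 2))) => [x _|].
  by rewrite /= -cabs_sqr powR12_sqrt ?sqr_ge0// sqrtr_sqr ger0_norm// cabs_ge0.
apply: (measurableT_comp (measurable_powR _)) => //.
by apply: measurable_funD; apply: measurable_funX.
Qed.

Lemma CmeasV D f : Cmeas D f -> Cmeas D (fun x => (f x)^-1).
Proof.
move=> mf.
(* Valid also where [f] vanishes, both sides being 0. *)
have e x : (f x)^-1 = (f x)^* * ((cabs (f x) ^+ 2)^-1)%:C.
  by rewrite invC_norm normCE mulrC fmorphV rmorphXn.
have -> : (fun x => (f x)^-1) =
    (fun x => (f x)^* * ((cabs (f x) ^+ 2)^-1)%:C).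
  by apply/funext => x; rewrite e.
apply: CmeasM; first exact: Cmeas_conj.
apply: Cmeas_real.
apply: (eq_measurable_fun ((@powR R)^~ (-1) \o (fun x => cabs (f x) ^+ 2)))
  => [x _|]; first by rewrite /= powR_inv1 ?sqr_ge0.
apply: (measurableT_comp (measurable_powR _)) => //.
by apply: measurable_funX; exact: measurable_cabs.
Qed.

Lemma EFin_Rintegral D (h : T -> R) : measurable D -> Rintegrable mu D h ->
  (\int[mu]_(x in D) (h x)%:E)%E = (\int[mu]_(x in D) h x)%:E.
Proof. by move=> mD Ih; rewrite /Rintegral fineK//; apply: (integrable_fin_num _ Ih). Qed.

Lemma Cintable_meas D f : Cintable D f -> Cmeas D f.
Proof. by move=> [/measurable_int/measurable_EFinP ? /measurable_int/measurable_EFinP ?]. Qed.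

Lemma Cintable_cabs D f : measurable D -> Cintable D f ->
  Rintegrable mu D (fun x => cabs (f x)).
Proof.
move=> mD If; have [I1 I2] := If.
apply: (le_integrable mD _ _ (integrableD mD (integrable_norm I1) (integrable_norm I2))).
  by apply/measurable_EFinP; apply: measurable_cabs; exact: Cintable_meas.
move=> x Dx /=; rewrite lee_fin ger0_norm ?cabs_ge0//.
by rewrite ger0_norm ?cabs_le_ReIm// addr_ge0.
Qed.

Lemma Cintable_le D f (h : T -> R) : measurable D -> Cmeas D f ->
  Rintegrable mu D h -> (forall x, D x -> cabs (f x) <= h x) ->
  Cintable D f.
Proof.
move=> mD [f1 f2] Ih fh; split; apply: (le_integrable mD _ _ Ih).
- exact/measurable_EFinP.
- move=> x Dx /=; rewrite lee_fin (le_trans (Re_le_cabs _))//.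
  by rewrite (le_trans (fh _ Dx))// ler_norm.
- exact/measurable_EFinP.
- move=> x Dx /=; rewrite lee_fin (le_trans (Im_le_cabs _))//.
  by rewrite (le_trans (fh _ Dx))// ler_norm.
Qed.

Lemma eq_Cint D f g : (forall x, D x -> f x = g x) -> Cint D f = Cint D g.
Proof.
by move=> fg; rewrite /Cint; congr (Complex _ _); apply: eq_Rintegral => x /[!inE] Dx;
  rewrite fg.
Qed.

Lemma eq_Cintable D f g : measurable D -> (forall x, D x -> f x = g x) -> Cintable D f -> Cintable D g.
Proof.
by move=> mD fg [f1 f2]; split; [apply: eq_integrable f1|apply: eq_integrable f2];
  rewrite // => x /[!inE] Dx /=; rewrite fg.
Qed.

Lemma CintD D f g : measurable D -> Cintable D f -> Cintable D g ->
  Cint D (fun x => f x + g x) = Cint D f + Cint D g.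
Proof.
move=> mD [f1 f2] [g1 g2]; rewrite /Cint; apply: Cext; rewrite ?cReD ?cImD/=.
  rewrite -RintegralD//; apply: eq_Rintegral => x _; exact: cReD.
rewrite -RintegralD//; apply: eq_Rintegral => x _; exact: cImD.
Qed.

Lemma CintableD D f g : measurable D -> Cintable D f -> Cintable D g ->
  Cintable D (fun x => f x + g x).
Proof.
move=> mD [f1 f2] [g1 g2]; split.
  apply: eq_integrable (integrableD mD f1 g1) => // x _ /=.
  by rewrite cReD.
apply: eq_integrable (integrableD mD f2 g2) => // x _ /=.
by rewrite cImD.
Qed.

Lemma CintZl D (c : Cplx R) f : measurable D -> Cintable D f ->
  Cint D (fun x => c * f x) = c * Cint D f.
Proof.
move=> mD [f1 f2].
have Z (a : R) h : Rintegrable mu D h ->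
    Rintegrable mu D (fun x => a * h x).
  move=> Ih; apply: eq_integrable (integrableZl mD a Ih) => // x _ /=.
rewrite /Cint; apply: Cext; rewrite ?cReM ?cImM/=.
  rewrite -!RintegralZl// -RintegralB ?Z//.
  by apply: eq_Rintegral => x _; rewrite cReM.
rewrite -!RintegralZl// -RintegralD ?Z//.
by apply: eq_Rintegral => x _; rewrite cImM.
Qed.

Lemma CintableZl D (c : Cplx R) f : measurable D -> Cintable D f ->
  Cintable D (fun x => c * f x).
Proof.
move=> mD If; apply: (@Cintable_le _ _ (fun x => cabs c * cabs (f x))) => //.
- by apply: CmeasM; [exact: Cmeas_cst|exact: Cintable_meas].
- apply: eq_integrable (integrableZl mD (cabs c) (Cintable_cabs mD If)) => //.
- by move=> x Dx; rewrite cabsM.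
Qed.

Lemma CintN D f : measurable D -> Cintable D f ->
  Cint D (fun x => - f x) = - Cint D f.
Proof.
by move=> mD If; rewrite -mulN1r -CintZl//; apply: eq_Cint => x _; rewrite mulN1r.
Qed.

Lemma CintableN D f : measurable D -> Cintable D f -> Cintable D (fun x => - f x).
Proof.
move=> mD If; apply: eq_Cintable mD _ (CintableZl (-1) mD If) => x _.
by rewrite mulN1r.
Qed.

Lemma CintB D f g : measurable D -> Cintable D f -> Cintable D g ->
  Cint D (fun x => f x - g x) = Cint D f - Cint D g.
Proof. by move=> mD If Ig; rewrite CintD// ?CintN//; exact: CintableN. Qed.

Lemma CintableB D f g : measurable D -> Cintable D f -> Cintable D g ->
  Cintable D (fun x => f x - g x).
Proof. by move=> mD If Ig; apply: CintableD => //; exact: CintableN. Qed.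

Lemma Cint_conj D f : measurable D -> Cintable D f ->
  Cint D (fun x => (f x)^*) = (Cint D f)^*.
Proof.
move=> mD [f1 f2]; rewrite cconjE; apply: Cext => /=.
  by apply: eq_Rintegral => x _; rewrite cconjE.
rewrite -mulN1r -RintegralZl//; apply: eq_Rintegral => x _.
by rewrite cconjE/= mulN1r.
Qed.

Lemma Cint_sum D (I : Type) (r : seq I) (F : I -> T -> Cplx R) :
  measurable D -> (forall i, Cintable D (F i)) ->
  Cint D (fun x => \sum_(i <- r) F i x) = \sum_(i <- r) Cint D (F i) /\
  Cintable D (fun x => \sum_(i <- r) F i x).
Proof.
move=> mD IF; elim: r => [|i r [IH1 IH2]].
  split.
    rewrite big_nil; apply: Cext => /=;
    rewrite -[RHS](mul0r (fine (mu D))) -Rintegral_cst//; apply: eq_Rintegral => x _;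
    by rewrite big_nil.
  apply: (@eq_Cintable _ (fun=> 0)) => //; first by move=> x _; rewrite big_nil.
  by split; exact: integrable0.
split.
  rewrite big_cons -IH1 -CintD//; apply: eq_Cint => x _; by rewrite big_cons.
apply: eq_Cintable mD _ (CintableD mD (IF i) IH2) => x _; by rewrite big_cons.
Qed.

(** Multiplying by the conjugate of the integral c makes the integral equal to |c|^2, a real number;
    the real part of the integrand is then compared with its modulus. *)
Lemma cabs_Cint_le D f : measurable D -> Cintable D f ->
  cabs (Cint D f) <= \int[mu]_(x in D) cabs (f x).
Proof.
move=> mD If; set c := Cint D f.
have [c0|c0] := eqVneq (cabs c) 0.
  by rewrite c0; apply: Rintegral_ge0 => x _; exact: cabs_ge0.
have cp : 0 < cabs c by rewrite lt_neqAle eq_sym c0 cabs_ge0.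
rewrite -(ler_pM2l cp) -expr2.
have -> : cabs c ^+ 2 = complex.Re (Cint D (fun x => c^* * f x)).
  by rewrite CintZl// mulrC mulC_conj.
rewrite -RintegralZl//; last exact: Cintable_cabs.
apply: le_Rintegral => //.
- by have [] := CintableZl c^* mD If.
- by apply: eq_integrable (integrableZl mD (cabs c) (Cintable_cabs mD If)).
move=> x Dx; rewrite (le_trans (ler_norm _))// (le_trans (Re_le_cabs _))//.
by rewrite cabsM cabs_conj.
Qed.

Lemma cabs_Cint_bound D f (h : T -> R) : measurable D -> Cmeas D f ->
  Rintegrable mu D h -> (forall x, D x -> cabs (f x) <= h x) ->
  cabs (Cint D f) <= \int[mu]_(x in D) h x.
Proof.
move=> mD mf Ih fh; have If := Cintable_le mD mf Ih fh.
apply: (le_trans (cabs_Cint_le mD If)); apply: le_Rintegral => //.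
exact: Cintable_cabs.
Qed.

Lemma integrable_bounded D (h : T -> R) (K : R) : measurable D ->
  (mu D < +oo)%E -> measurable_fun D h -> (forall x, D x -> `|h x| <= K) ->
  Rintegrable mu D h.
Proof.
move=> mD fD mh hK; apply: measurable_bounded_integrable => //.
exists K; split; first exact: num_real.
by move=> M KM x Dx /=; rewrite (le_trans (hK _ Dx))// ltW.
Qed.

Lemma Cintable_bounded D f (K : R) : measurable D ->
  (mu D < +oo)%E -> Cmeas D f -> (forall x, D x -> cabs (f x) <= K) ->
  Cintable D f.
Proof.
move=> mD fD mf fK; apply: (@Cintable_le _ _ (fun=> K)) => //.
by apply: (@integrable_bounded _ _ `|K|).
Qed.

Lemma Cint_cst D (c : Cplx R) : measurable D ->
  Cint D (fun=> c) = c * (fine (mu D))%:C.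
Proof.
by move=> mD; apply: Cext; rewrite /= Rintegral_cst// ?cReM ?cImM /=; ring.
Qed.

Lemma CintableMl D f g (K : R) : measurable D -> Cintable D f -> Cmeas D g ->
  (forall x, D x -> cabs (g x) <= K) -> Cintable D (fun x => g x * f x).
Proof.
move=> mD If mg gK; apply: (@Cintable_le _ _ (fun x => K * cabs (f x))) => //.
- by apply: CmeasM => //; exact: Cintable_meas.
- by apply: eq_integrable (integrableZl mD K (Cintable_cabs mD If)).
- by move=> x Dx; rewrite cabsM ler_wpM2r ?cabs_ge0 ?gK.
Qed.

End ComplexIntegral.

Section FubiniBounded.
Context d1 d2 (T1 : measurableType d1) (T2 : measurableType d2) (R : realType).
Variables (m1 : {finite_measure set T1 -> \bar R})
          (m2 : {finite_measure set T2 -> \bar R}).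
Variables (D1 : set T1) (D2 : set T2).
Hypotheses (mD1 : measurable D1) (mD2 : measurable D2).

(** A majorant that splits as a product gives integrability on the product by Tonelli, and
    integrability of every section, not just of almost every one. So the real-valued inner integrals
    agree everywhere with the extended ones. *)
Lemma Rintegral_Fubini (f : T1 * T2 -> R) (a : T1 -> R) (b : T2 -> R) :
  measurable_fun (D1 `*` D2) f ->
  Rintegrable m1 D1 a -> Rintegrable m2 D2 b ->
  (forall x y, D1 x -> D2 y -> `|f (x, y)| <= a x * b y) ->
  (\int[m1]_(x in D1) (\int[m2]_(y in D2) f (x, y)) =
   \int[m2]_(y in D2) (\int[m1]_(x in D1) f (x, y))) /\
  measurable_fun D1 (fun x => \int[m2]_(y in D2) f (x, y)).
Proof.
move=> mf Ia Ib fab.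
(* Only the products a x * b y are known to be nonnegative, hence the absolute values; extension by
   zero replaces [D1] and [D2] by the whole spaces. *)
pose A x := `|(a \_ D1) x|; pose B y := `|(b \_ D2) y|.
have IA : Rintegrable m1 setT A.
  apply: integrable_norm; move/(integrable_mkcond _ mD1) : Ia.
  by rewrite restrict_EFin.
have IB : Rintegrable m2 setT B.
  apply: integrable_norm; move/(integrable_mkcond _ mD2) : Ib.
  by rewrite restrict_EFin.
pose g := f \_ (D1 `*` D2).
have mD : measurable (D1 `*` D2) by exact: measurableX.
have mg : measurable_fun setT g by apply/(measurable_restrictT _ _).1.
have gAB x y : `|g (x, y)| <= A x * B y.
  rewrite /g /A /B !patchE in_setX.
  case: ifPn => [/andP[/= xD yD]|_]; last by rewrite normr0 mulr_ge0.
  rewrite xD yD -normrM; move: xD yD; rewrite !inE => xD yD.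
  by rewrite (le_trans (fab _ _ xD yD))// ler_norm.
have A0 x : 0 <= A x by exact: normr_ge0.
have gy x : m2.-integrable setT (fun y => (g (x, y))%:E).
  apply: (le_integrable measurableT _ _ (integrableZl measurableT (A x) IB)).
    by apply/measurable_EFinP; apply: measurableT_comp => //; exact: measurable_pair1.
  by move=> y _ /=; rewrite lee_fin (le_trans (gAB _ _))// ler_norm.
have gx y : m1.-integrable setT (fun x => (g (x, y))%:E).
  apply: (le_integrable measurableT _ _ (integrableZl measurableT (B y) IA)).
    by apply/measurable_EFinP; apply: measurableT_comp => //; exact: measurable_pair2.
  by move=> x _ /=; rewrite lee_fin (le_trans (gAB _ _))// mulrC ler_norm.
have meg : measurable_fun setT (EFin \o g) by exact/measurable_EFinP.
have Ig : Rintegrable (m1 \x m2)%E setT g.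
  apply/(integrable12ltyP _ _ meg).
  apply: (@le_lt_trans _ _ (\int[m1]_x ((A x)%:E * \int[m2]_y (B y)%:E))%E).
    apply: ge0_le_integral => //.
    - by move=> x _; apply: integral_ge0.
    - apply: (measurable_fun_fubini_tonelli_F
        (fun z => `|(EFin \o g) z|%E)) => //.
      by apply: measurableT_comp => //; exact/measurable_EFinP.
    - apply: emeasurable_funM => //; first by have /measurable_int := IA.
    - move=> x _; rewrite -ge0_integralZl//=.
      + apply: ge0_le_integral => //.
        * apply/measurable_EFinP; apply: measurableT_comp => //.
          by apply/measurable_EFinP; have /measurable_int := gy x.
        * by apply: emeasurable_funM => //; have /measurable_int := IB.
        * by move=> y _ /=; rewrite -EFinM lee_fin.
      + by have /measurable_int := IB.
      + by move=> y _; rewrite lee_fin /B.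
      + by rewrite lee_fin.
  rewrite ge0_integralZr//.
  - apply: lte_mul_pinfty.
    + by apply: integral_ge0 => x _; rewrite lee_fin.
    + exact: integrable_fin_num IA.
    + exact: integrable_lty IB.
  - by have /measurable_int := IA.
  - by move=> x _; rewrite lee_fin.
  - by apply: integral_ge0 => y _; rewrite lee_fin /B.
have E1 x := EFin_Rintegral measurableT (gy x).
have E2 y := EFin_Rintegral measurableT (gx y).
have R1 x : D1 x -> \int[m2]_(y in D2) f (x, y) = \int[m2]_y g (x, y).
  move=> Dx; rewrite Rintegral_mkcond; apply: eq_Rintegral => y _.
  by rewrite /g !patchE in_setX /= (mem_set Dx).
have R2 y : D2 y -> \int[m1]_(x in D1) f (x, y) = \int[m1]_x g (x, y).
  move=> Dy; rewrite Rintegral_mkcond; apply: eq_Rintegral => x _.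
  by rewrite /g !patchE in_setX /= (mem_set Dy) andbT.
split.
  transitivity (\int[m1]_x \int[m2]_y g (x, y)).
    rewrite Rintegral_mkcond; apply: eq_Rintegral => x _.
    rewrite patchE; case: ifPn => [/[!inE] Dx|xD]; first exact: R1.
    rewrite -[LHS](mul0r (fine (m2 setT))) -Rintegral_cst//.
    apply: eq_Rintegral => y _.
    by rewrite /g patchE in_setX /= (negbTE xD).
  transitivity (\int[m2]_y \int[m1]_x g (x, y)); last first.
    rewrite [RHS]Rintegral_mkcond; apply: eq_Rintegral => y _.
    rewrite patchE; case: ifPn => [/[!inE] Dy|yD]; first by rewrite R2.
    rewrite -[RHS](mul0r (fine (m1 setT))) -Rintegral_cst//.
    apply: eq_Rintegral => x _.
    by rewrite /g patchE in_setX /= (negbTE yD) andbF.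
  rewrite /Rintegral; congr fine.
  have := Fubini Ig => /= H.
  transitivity (\int[m1]_x \int[m2]_y (g (x, y))%:E)%E.
    by apply: eq_integral => x _; rewrite E1.
  by rewrite H; apply: eq_integral => y _; rewrite E2.
apply: (eq_measurable_fun (fun x => \int[m2]_y g (x, y))) => [x /[!inE] Dx|].
  by rewrite R1.
apply/measurable_EFinP.
have := measurable_fubini_F Ig; rewrite /fubini_F /= => mF.
apply: (measurable_funS measurableT) => //.
by apply: eq_measurable_fun mF => x _ /=; rewrite E1.
Qed.

Lemma Cint_Fubini (k : T1 * T2 -> Cplx R) (a : T1 -> R) (b : T2 -> R) :
  Cmeas (D1 `*` D2) k ->
  Rintegrable m1 D1 a -> Rintegrable m2 D2 b ->
  (forall x y, D1 x -> D2 y -> cabs (k (x, y)) <= a x * b y) ->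
  Cint m1 D1 (fun x => Cint m2 D2 (fun y => k (x, y))) =
  Cint m2 D2 (fun y => Cint m1 D1 (fun x => k (x, y))) /\
  Cmeas D1 (fun x => Cint m2 D2 (fun y => k (x, y))).
Proof.
move=> [k1 k2] Ia Ib kab.
have [|e1 f1] := Rintegral_Fubini k1 Ia Ib.
  by move=> x y Dx Dy /=; rewrite (le_trans (Re_le_cabs _))// kab.
have [|e2 f2] := Rintegral_Fubini k2 Ia Ib.
  by move=> x y Dx Dy /=; rewrite (le_trans (Im_le_cabs _))// kab.
by split; [apply: Cext|split].
Qed.

End FubiniBounded.

Section Pushforward.
Context d (T : measurableType d) (R : realType).
Variable mu : {finite_measure set T -> \bar R}.

Lemma Rintegral_preserving (phi : T -> T) (D : set T) (f : T -> R) :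
  measurable_fun setT phi -> measurable D ->
  (forall A, measurable A -> mu (phi @^-1` A) = mu A) ->
  phi @^-1` D = D -> Rintegrable mu D f ->
  \int[mu]_(x in D) f (phi x) = \int[mu]_(x in D) f x.
Proof.
move=> mphi mD muphi phiD If; pose g := f \_ D.
have Ig : Rintegrable mu setT g.
  by move/(integrable_mkcond _ mD) : If; rewrite restrict_EFin.
have mg : measurable_fun setT (EFin \o g) by exact: measurable_int Ig.
have E : forall A, measurable A -> A `<=` setT -> pushforward mu phi A = mu A.
  by move=> A mA _; rewrite /pushforward muphi.
have Igp : mu.-integrable setT ((EFin \o g) \o phi).
  apply/integrableP; split; first exact: measurableT_comp.
  have /integrableP[_] := Ig; apply: le_lt_trans.
  have := @ge0_integral_pushforward _ _ _ _ R phi mphi mu setT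
    (fun x => `|(EFin \o g) x|%E) measurableT.
  rewrite preimage_setT => <- //.
    by rewrite (eq_measure_integral mu).
  exact: measurableT_comp.
rewrite Rintegral_mkcond [RHS]Rintegral_mkcond -/g.
transitivity (\int[mu]_x g (phi x)).
  apply: eq_Rintegral => x _; rewrite /g !patchE.
  have -> // : (phi x \in D) = (x \in D).
  by rewrite -[in RHS]phiD; apply/idP/idP; rewrite !inE.
rewrite /Rintegral; congr fine.
transitivity (\int[pushforward mu phi]_x (g x)%:E)%E.
  by rewrite (integral_pushforward mphi mg) ?preimage_setT.
exact: eq_measure_integral.
Qed.

Lemma Cint_preserving (phi : T -> T) (D : set T) (f : T -> Cplx R) :
  measurable_fun setT phi -> measurable D ->
  (forall A, measurable A -> mu (phi @^-1` A) = mu A) ->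
  phi @^-1` D = D -> Cintable mu D f ->
  Cint mu D (fun x => f (phi x)) = Cint mu D f.
Proof.
move=> mphi mD muphi phiD [f1 f2]; apply: Cext => /=.
  exact: (Rintegral_preserving mphi mD muphi phiD f1).
exact: (Rintegral_preserving mphi mD muphi phiD f2).
Qed.
End Pushforward.

(** * The unit sphere and its rotations *)

Section Sphere.
Context {R : realType} {n : nat}.
Implicit Types (z w v x : Cn R n) (c : Cplx R).
Local Notation C := (Cplx R).

Lemma hdotDl z w v : hdot (z + w) v = hdot z v + hdot w v.
Proof.
by rewrite /hdot -big_split/=; apply: eq_bigr => j _; rewrite mxE mulrDl.
Qed.
Lemma hdotZl c z v : hdot (c *: z) v = c * hdot z v.
Proof. by rewrite /hdot mulr_sumr; apply: eq_bigr => j _; rewrite mxE mulrA. Qed.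
Lemma hdotC z w : (hdot z w)^* = hdot w z.
Proof.
rewrite /hdot (rmorph_sum Num.conj); apply: eq_bigr => j _.
by rewrite /= conjM conjCK mulrC.
Qed.
Lemma hdotDr z w v : hdot v (z + w) = hdot v z + hdot v w.
Proof. by rewrite -hdotC hdotDl conjD !hdotC. Qed.
Lemma hdotZr c z v : hdot v (c *: z) = c^* * hdot v z.
Proof. by rewrite -hdotC hdotZl conjM hdotC. Qed.
Lemma hdotNl z v : hdot (- z) v = - hdot z v.
Proof. by rewrite -scaleN1r hdotZl mulN1r. Qed.
Lemma hdotNr z v : hdot v (- z) = - hdot v z.
Proof. by rewrite -hdotC hdotNl conjN hdotC. Qed.
Lemma hdotBl z w v : hdot (z - w) v = hdot z v - hdot w v.
Proof. by rewrite hdotDl hdotNl. Qed.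
Lemma hdotBr z w v : hdot v (z - w) = hdot v z - hdot v w.
Proof. by rewrite hdotDr hdotNr. Qed.
Lemma hdot0l v : hdot 0 v = 0.
Proof. by rewrite -(scale0r v) hdotZl mul0r. Qed.
Lemma hdot0r v : hdot v 0 = 0.
Proof. by rewrite -hdotC hdot0l conj0. Qed.

Lemma hdot_sum z : hdot z z = (\sum_(j < n) cabs (z 0 j) ^+ 2)%:C.
Proof. by rewrite rmorph_sum; apply: eq_bigr => j _; rewrite mulC_conj. Qed.

Lemma enorm_ge0 z : 0 <= enorm z. Proof. exact: sqrtr_ge0. Qed.

Lemma enorm_sqr z : enorm z ^+ 2 = \sum_(j < n) cabs (z 0 j) ^+ 2.
Proof.
by rewrite /enorm hdot_sum cReR sqr_sqrtr// sumr_ge0// => j _; rewrite sqr_ge0.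
Qed.

Lemma hdotzz z : hdot z z = (enorm z ^+ 2)%:C.
Proof. by rewrite enorm_sqr hdot_sum. Qed.

Lemma enorm_eq0 z : enorm z = 0 -> z = 0.
Proof.
move=> z0; apply/matrixP => i j; rewrite (ord1 i) mxE; apply: cabs_eq0.
have := enorm_sqr z; rewrite z0 expr0n /= => /esym/eqP.
rewrite psumr_eq0 => [|k _]; last exact: sqr_ge0.
by move/allP => /(_ j (mem_index_enum _)) /=; rewrite sqrf_eq0 => /eqP.
Qed.

Lemma enormE_le z (a : R) : 0 <= a -> enorm z ^+ 2 = a ^+ 2 -> enorm z = a.
Proof. by move=> a0 /eqP; rewrite eqrXn2// ?enorm_ge0// => /eqP. Qed.

Lemma enormZ c z : enorm (c *: z) = cabs c * enorm z.
Proof.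
apply: enormE_le; first by rewrite mulr_ge0 ?cabs_ge0 ?enorm_ge0.
rewrite exprMn !enorm_sqr mulr_sumr; apply: eq_bigr => j _.
by rewrite mxE cabsM exprMn.
Qed.

Lemma enormN z : enorm (- z) = enorm z.
Proof. by rewrite -scaleN1r enormZ cabsN cabs1 mul1r. Qed.

Lemma enormD_sqr z w :
  enorm (z + w) ^+ 2 = enorm z ^+ 2 + enorm w ^+ 2 + 2 * complex.Re (hdot z w).
Proof.
have e (u : Cn R n) : enorm u ^+ 2 = complex.Re (hdot u u) by rewrite hdotzz.
rewrite !e hdotDl !hdotDr !cReD -(hdotC z w) cconjE /=; ring.
Qed.

Lemma enormB_sqr z w :
  enorm (z - w) ^+ 2 = enorm z ^+ 2 + enorm w ^+ 2 - 2 * complex.Re (hdot z w).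
Proof. by rewrite enormD_sqr enormN hdotNr cReN mulrN. Qed.

Lemma hdot_CS z w : cabs (hdot z w) <= enorm z * enorm w.
Proof.
have [w0|w0] := eqVneq (enorm w) 0.
  by rewrite (enorm_eq0 w0) hdot0r cabs0 mulr_ge0 ?enorm_ge0.
have wp : 0 < enorm w ^+ 2 by rewrite exprn_gt0// lt_neqAle eq_sym w0 enorm_ge0.
rewrite -(ler_pXn2r (n := 2))// ?nnegrE ?cabs_ge0 ?mulr_ge0 ?enorm_ge0// exprMn.
(* The coefficient of the orthogonal projection of z on the line of w: z - a w has nonnegative
   square norm. *)
pose a := hdot z w * ((enorm w ^+ 2)^-1)%:C.
have := sqr_ge0 (enorm (z - a *: w)).
have wc : cabs (hdot z w) ^+ 2 = complex.Re (hdot z w) ^+ 2 + complex.Im (hdot z w) ^+ 2.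
  exact: cabs_sqr.
rewrite enormB_sqr enormZ exprMn hdotZr /a cabsM cabs_real conjM !cReM !cImM.
rewrite !cconjE /= normrV ?unitfE ?gt_eqF// ger0_norm ?sqr_ge0// => H.
rewrite -ler_pdivrMr//.
have e1 : (cabs (hdot z w) / enorm w ^+ 2) ^+ 2 * enorm w ^+ 2 =
   cabs (hdot z w) ^+ 2 / enorm w ^+ 2.
  by field; rewrite w0.
rewrite e1 in H.
rewrite wc in H *; move: H.
set P := complex.Re _; set Q := complex.Im _; set N := (_ ^+ 2)^-1; nra.
Qed.

Lemma rscaleE (a : R) z : rscale a z = a%:C *: z. Proof. by []. Qed.

Lemma enorm_rscale (a : R) z : enorm (rscale a z) = `|a| * enorm z.
Proof. by rewrite rscaleE enormZ cabs_real. Qed.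

Lemma sphere_hdot z w : unit_sphere z -> unit_sphere w -> cabs (hdot z w) <= 1.
Proof. by move=> z1 w1; have := hdot_CS z w; rewrite z1 w1 mulr1. Qed.

Lemma ndistC z w : ndist z w = ndist w z.
Proof. by rewrite /ndist -cabs_conj conjD conjN conj1 hdotC. Qed.

Lemma ndist_ge0 z w : 0 <= ndist z w. Proof. exact: cabs_ge0. Qed.

Lemma ndist_le2 z w : unit_sphere z -> unit_sphere w -> ndist z w <= 2.
Proof.
move=> z1 w1; rewrite /ndist (le_trans (cabsB _ _))// cabs1.
by have := sphere_hdot z1 w1; lra.
Qed.

(** The left side is 2 Re (1 - <z, w>). *)
Lemma enormB_ndist z w : unit_sphere z -> unit_sphere w ->
  enorm (z - w) ^+ 2 <= 2 * ndist z w.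
Proof.
move=> z1 w1; rewrite enormB_sqr z1 w1 expr1n.
have := Re_le_cabs (1 - hdot z w); rewrite cReD cReN /= -/(ndist z w).
by rewrite ler_norml => /andP[_ h]; lra.
Qed.

(** The defect of additivity of 1 - <z, v> is <z - w, w - v>. By Cauchy-Schwarz and [enormB_ndist]
    it costs at most another d(z, w) + d(w, v), whence the constant 2. *)
Lemma ndist_quasi z w v : unit_sphere z -> unit_sphere w -> unit_sphere v ->
  ndist z v <= 2 * (ndist z w + ndist w v).
Proof.
move=> z1 w1 v1.
have -> : ndist z v = cabs ((1 - hdot z w) + (1 - hdot w v) + hdot (z - w) (w - v)).
  have ww : hdot w w = 1 by rewrite hdotzz w1 expr1n.
  rewrite /ndist !hdotBl !hdotBr ww; congr cabs; ring.
rewrite (le_trans (cabsD _ _))// (le_trans (lerD (cabsD _ _) (hdot_CS _ _)))//.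
have a := enormB_ndist z1 w1; have b := enormB_ndist w1 v1.
have := sqr_ge0 (enorm (z - w) - enorm (w - v)).
by rewrite sqrrB -/(ndist z w) -/(ndist w v); nra.
Qed.

End Sphere.

(** * Borel measurability on C^n *)

Section Measurability.
Context {R : realType} {n : nat}.

Lemma continuous_Re : continuous (@complex.Re R : Cplx R -> R).
Proof.
move=> z A /nbhs_ballP[e e0 eA]; apply/nbhs_ballP.
exists e%:C => /=; first by rewrite ltcR.
move=> y; rewrite /ball /= normCE ltcR => h; apply: eA; rewrite /ball /=.
by rewrite -cReN -cReD (le_lt_trans (Re_le_cabs _)).
Qed.

Lemma continuous_Im : continuous (@complex.Im R : Cplx R -> R).
Proof.
move=> z A /nbhs_ballP[e e0 eA]; apply/nbhs_ballP.
exists e%:C => /=; first by rewrite ltcR.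
move=> y; rewrite /ball /= normCE ltcR => h; apply: eA; rewrite /ball /=.
by rewrite -cImN -cImD (le_lt_trans (Im_le_cabs _)).
Qed.

Lemma continuous_BorelCn (f : Cn R n -> R) : continuous f ->
  measurable_fun setT (f : BorelCn R n -> R).
Proof.
move=> /continuousP cf; apply: (measurability _ (RGenOpens.measurableE R)).
move=> _ -[_ [a [b ->] <-]]; rewrite setTI.
by apply: sub_sigma_algebra; exact: cf.
Qed.

Lemma Cmeas_coord (j : 'I_n) :
  Cmeas setT (fun z : BorelCn R n => (z : Cn R n) 0 j).
Proof.
split; apply: continuous_BorelCn => z.
  apply: (@continuous_comp _ _ _ (fun z : Cn R n => z 0 j) (@complex.Re R : Cplx R -> R)).
    exact: coord_continuous.
  exact: continuous_Re.
apply: (@continuous_comp _ _ _ (fun z : Cn R n => z 0 j) (@complex.Im R : Cplx R -> R)).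
  exact: coord_continuous.
exact: continuous_Im.
Qed.

Lemma Cmeas_comp d (T : measurableType d) (f : T -> BorelCn R n)
    (D : set T) (g : BorelCn R n -> Cplx R) :
  measurable_fun D f -> Cmeas setT g -> Cmeas D (fun x => g (f x)).
Proof.
move=> mf [g1 g2]; split.
  exact: (measurableT_comp (f := fun z => complex.Re (g z))).
exact: (measurableT_comp (f := fun z => complex.Im (g z))).
Qed.

Lemma Cmeas_hdot d (T : measurableType d) (D : set T) (f g : T -> BorelCn R n) :
  measurable_fun D f -> measurable_fun D g ->
  Cmeas D (fun x => hdot (f x : Cn R n) (g x : Cn R n)).
Proof.
move=> mf mg; apply: Cmeas_sum => j; apply: CmeasM.
  exact: (Cmeas_comp mf (Cmeas_coord j)).
apply: Cmeas_conj; exact: (Cmeas_comp mg (Cmeas_coord j)).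
Qed.

Lemma Cmeas_hdotl (D : set (BorelCn R n)) (w : Cn R n) :
  Cmeas D (fun z : BorelCn R n => hdot z w).
Proof. by apply: (@Cmeas_hdot _ _ D id (cst w)). Qed.

Lemma Cmeas_hdotr (D : set (BorelCn R n)) (w : Cn R n) :
  Cmeas D (fun z : BorelCn R n => hdot w (z : Cn R n)).
Proof. by apply: (@Cmeas_hdot _ _ D (cst w) id). Qed.

Lemma measurable_sphere : measurable (@unit_sphere R n : set (BorelCn R n)).
Proof.
have -> : (@unit_sphere R n : set (BorelCn R n)) =
    (fun z : BorelCn R n => complex.Re (hdot z z)) @^-1` [set 1].
  apply/seteqP; split => z /=; rewrite hdotzz cReR => h.
    by rewrite h expr1n.
  by apply: enormE_le => //; rewrite h expr1n.
rewrite -[X in measurable X]setTI.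
have [m _] := @Cmeas_hdot _ _ setT (@id (BorelCn R n)) id (@measurable_id _ _ _) (@measurable_id _ _ _).
exact: m.
Qed.

Lemma measurable_ndist (D : set (BorelCn R n)) (w : Cn R n) :
  measurable_fun D (fun z : BorelCn R n => ndist z w).
Proof.
apply: measurable_cabs; apply: CmeasB; first exact: Cmeas_cst.
exact: Cmeas_hdotl.
Qed.

Lemma measurable_nball (w : Cn R n) (r : R) :
  measurable (nball w r : set (BorelCn R n)).
Proof.
apply: measurableI; first exact: measurable_sphere.
have := @measurable_ndist setT w measurableT (`]-oo, r]%classic) (measurable_itv _).
by rewrite setTI; congr (measurable _); apply/seteqP; split => z /=; rewrite in_itv.
Qed.

(* The nbhs filter of a matrix is generated by products of neighbourhoods
   of the entries, so continuity may be checked entrywise. *)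
Lemma measurable_BorelCn_map (f : Cn R n -> Cn R n) :
  (forall j, continuous (fun z => f z 0 j)) ->
  measurable_fun setT (f : BorelCn R n -> BorelCn R n).
Proof.
move=> cf.
have cf' : continuous f.
  move=> z A [P PM sPA].
  have FF : Filter (nbhs z) by exact: nbhs_filter.
  have Q (j : 'I_n) : nbhs z [set y | P 0 j (f y 0 j)] by apply: (cf j z); exact: PM.
  have Q2 : nbhs z (fun y => forall j : 'I_n, P 0 j (f y 0 j)).
    exact: (@filter_forall _ _ _ (nbhs z) FF Q).
  suff : nbhs z (f @^-1` A) by [].
  apply: (@filterS _ (nbhs z) FF _ _ _ Q2) => y H.
  apply: sPA => i j; rewrite (ord1 i); exact: H.
apply: (@measurability _ _ (BorelCn R n) (BorelCn R n) setT f (@open (Cn R n)) erefl).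
move=> _ -[A oA <-]; rewrite setTI; apply: sub_sigma_algebra.
by move/continuousP : cf' => /(_ A oA).
Qed.

End Measurability.

(** * Rotations of the sphere and invariance of integrals *)

Section Rotations.
Context {R : realType} {n : nat}.
Local Notation C := (Cplx R).
Implicit Types (z w v x : Cn R n) (c : C).

Lemma continuous_hdotl v : continuous (fun z : Cn R n => hdot z v : C).
Proof.
rewrite /hdot; elim: (index_enum _) => [|j s IH].
  have -> : (fun z : Cn R n => \sum_(i <- [::]) z 0 i * (v 0 i)^*) = (fun=> 0 : C).
    by apply/funext => z; rewrite big_nil.
  by move=> z; exact: (@cvg_cst _ _ _ (nbhs z) (nbhs_filter z)).
have -> : (fun z : Cn R n => \sum_(i <- j :: s) z 0 i * (v 0 i)^*) =
    (fun z => z 0 j * (v 0 j)^* + \sum_(i <- s) z 0 i * (v 0 i)^*).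
  by apply/funext => z; rewrite big_cons.
move=> z; apply: (@cvgD _ _ _ (nbhs z) (nbhs_filter z)); last exact: IH.
by apply: (@cvgMr_tmp _ _ (nbhs z) (nbhs_filter z)); exact: coord_continuous.
Qed.

(** One family that contains the scalar maps, the complex reflections [refl] and the rotations
    [phase], so that linearity and measurability are settled once. *)
Definition rank1_map (a b : C) (v u x : Cn R n) : Cn R n :=
  a *: x + (b * hdot x v) *: u.

Lemma measurable_rank1_map a b v u :
  measurable_fun setT (rank1_map a b v u : BorelCn R n -> BorelCn R n).
Proof.
apply: measurable_BorelCn_map => j z.
have -> : (fun x => rank1_map a b v u x 0 j) =
    (fun x : Cn R n => a * x 0 j + b * hdot x v * u 0 j).
  by apply/funext => x; rewrite !mxE.
apply: (@cvgD _ _ _ (nbhs z) (nbhs_filter z)).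
  by apply: (@cvgMl_tmp _ _ (nbhs z) (nbhs_filter z)); exact: coord_continuous.
apply: (@cvgMr_tmp _ _ (nbhs z) (nbhs_filter z)).
by apply: (@cvgMl_tmp _ _ (nbhs z) (nbhs_filter z)); exact: continuous_hdotl.
Qed.

Lemma rank1_map_rotation a b v u :
  (forall x, enorm (rank1_map a b v u x) = enorm x) ->
  rotation (rank1_map a b v u).
Proof.
move=> H; split => // [z w|r z].
  by rewrite /rank1_map hdotDl mulrDr scalerDl scalerDr addrACA.
rewrite /rank1_map !rscaleE hdotZl scalerDr !scalerA.
by rewrite [a * _]mulrC [b * (_ * _)]mulrCA.
Qed.

(** The complex reflection: multiplication by [c] along [v], identity on the complement of [v]. For
    c = -1 it is the Householder reflection; for v = 0 it is the identity. *)
Definition refl v c := rank1_map 1 ((c - 1) / hdot v v) v v.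

Lemma enorm_refl v c x : cabs c = 1 -> enorm (refl v c x) = enorm x.
Proof.
move=> c1; apply: enormE_le; first exact: enorm_ge0.
have [v0|v0] := eqVneq (enorm v) 0.
  by rewrite /refl /rank1_map (enorm_eq0 v0) scaler0 addr0 scale1r.
rewrite /refl /rank1_map scale1r enormD_sqr enormZ exprMn hdotZr hdotzz.
have N0 : enorm v ^+ 2 != 0 by rewrite sqrf_eq0.
rewrite !conjM conjV conjR -[X in complex.Re X]mulrA [(hdot x v)^* * _]mulrC mulC_conj.
rewrite -real_complexV conjD conjN conj1 -[X in complex.Re X]mulrA -real_complexM !cabsM.
rewrite cabs_real !exprMn real_normK ?num_real// [cabs (c - 1) ^+ 2]cabs_sqr.
rewrite !cReM !cReD !cImD !cReN !cImN !cReR !cImR.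
rewrite cconjE /=.
have : cabs c ^+ 2 = 1 by rewrite c1 expr1n.
rewrite cabs_sqr => H.
set a := complex.Re c in H *; set b := complex.Im c in H *.
set h := cabs (hdot x v) ^+ 2; set N := enorm v ^+ 2 in N0 *.
set e := enorm x ^+ 2.
have hb : b ^+ 2 = 1 - a ^+ 2 by rewrite -H; ring.
rewrite !(subr0, mulr0) hb.
by field.
Qed.

Lemma refl_rotation v c : cabs c = 1 -> rotation (refl v c).
Proof. by move=> c1; apply: rank1_map_rotation => x; rewrite -/(refl v c) enorm_refl. Qed.

Lemma hdot_refl v c x y :
  hdot (refl v c x) y = hdot x y + (c - 1) / hdot v v * hdot x v * hdot v y.
Proof. by rewrite /refl /rank1_map scale1r hdotDl hdotZl. Qed.

Lemma rotation_sphere (T : Cn R n -> Cn R n) : rotation T ->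
  T @^-1` unit_sphere = unit_sphere.
Proof. by move=> [_ _ H]; apply/seteqP; split => z /=; rewrite /unit_sphere /= H. Qed.

Variable sigma : probability (BorelCn R n) R.
Hypothesis hsigma : rotation_invariant_sphere_measure sigma.
Local Notation S := (@unit_sphere R n : set (BorelCn R n)).

Lemma Cint_rotation (T : BorelCn R n -> BorelCn R n) (f : BorelCn R n -> C)
    (D : set (BorelCn R n)) :
  rotation (T : Cn R n -> Cn R n) -> measurable_fun setT T ->
  measurable D -> T @^-1` D = D ->
  Cintable sigma D f -> Cint sigma D (fun x => f (T x)) = Cint sigma D f.
Proof.
move=> rT mT mD TD If; apply: Cint_preserving => //.
by move=> A mA; apply: hsigma.2.
Qed.

Lemma sphere1 : sigma S = 1%E. Proof. exact: hsigma.1. Qed.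
Lemma sphere_fin (D : set (BorelCn R n)) : measurable D -> (sigma D < +oo)%E.
Proof. by move=> mD; apply: le_lt_trans (probability_le1 sigma mD) (ltry _). Qed.

Lemma integrable_sphere_cst (D : set (BorelCn R n)) (K : R) :
  measurable D -> Rintegrable sigma D (fun=> K).
Proof.
by move=> mD; apply: (@integrable_bounded _ _ _ _ _ _ `|K|) => //; exact: sphere_fin.
Qed.

End Rotations.

Section BoundedMeasurable.
Context d (T : measurableType d) (R : realType).
Implicit Types (D : set T) (f g : T -> Cplx R).

(** An algebra of functions, all integrable for a finite measure; membership discharges the
    integrability conditions on polynomials in the coordinates and on Cauchy kernels inside the
    ball. *)
Definition bdm D f := Cmeas D f /\ exists K : R, forall x, D x -> cabs (f x) <= K.

Lemma bdm_cst D (c : Cplx R) : bdm D (fun=> c).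
Proof. by split; [exact: Cmeas_cst|exists (cabs c)]. Qed.

Lemma bdmM D f g : bdm D f -> bdm D g -> bdm D (fun x => f x * g x).
Proof.
move=> [mf [K fK]] [mg [L gL]]; split; first exact: CmeasM.
exists (K * L) => x Dx; rewrite cabsM ler_pM ?cabs_ge0 ?fK ?gL//.
Qed.

Lemma bdmD D f g : bdm D f -> bdm D g -> bdm D (fun x => f x + g x).
Proof.
move=> [mf [K fK]] [mg [L gL]]; split; first exact: CmeasD.
by exists (K + L) => x Dx; rewrite (le_trans (cabsD _ _))// lerD ?fK ?gL.
Qed.

Lemma bdmN D f : bdm D f -> bdm D (fun x => - f x).
Proof.
move=> [mf [K fK]]; split; first exact: CmeasN.
by exists K => x Dx; rewrite cabsN fK.
Qed.

Lemma bdm_conj D f : bdm D f -> bdm D (fun x => (f x)^*).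
Proof.
move=> [mf [K fK]]; split; first exact: Cmeas_conj.
by exists K => x Dx; rewrite cabs_conj fK.
Qed.

Lemma bdmX D f k : bdm D f -> bdm D (fun x => f x ^+ k).
Proof.
move=> bf; elim: k => [|k IH]; first exact: bdm_cst.
have -> : (fun x => f x ^+ k.+1) = (fun x => f x * f x ^+ k).
  by apply/funext => x; rewrite exprS.
exact: bdmM.
Qed.

Lemma bdm_sum D (I : Type) (r : seq I) (F : I -> T -> Cplx R) :
  (forall i, bdm D (F i)) -> bdm D (fun x => \sum_(i <- r) F i x).
Proof.
move=> bF; elim: r => [|i r IH].
  have -> : (fun x => \sum_(i <- [::]) F i x) = (fun=> 0).
    by apply/funext => x; rewrite big_nil.
  exact: bdm_cst.
have -> : (fun x => \sum_(j <- i :: r) F j x) =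
    (fun x => F i x + \sum_(j <- r) F j x).
  by apply/funext => x; rewrite big_cons.
exact: bdmD.
Qed.

Lemma Cintable_bdm (mu : {measure set T -> \bar R}) D f : measurable D ->
  (mu D < +oo)%E -> bdm D f -> Cintable mu D f.
Proof. by move=> mD fD [mf [K fK]]; apply: Cintable_bounded fK. Qed.

End BoundedMeasurable.

(** The difference vanishes at more natural numbers than its degree allows. *)
Lemma poly_eq_real (R : realType) (P Q : {poly Cplx R}) :
  (forall t : R, P.[t%:C] = Q.[t%:C]) -> P = Q.
Proof.
move=> PQ; apply/eqP; rewrite -subr_eq0; apply/eqP.
pose rs := [seq (i%:R : Cplx R) | i <- iota 0 (size (P - Q))].
apply: (@roots_geq_poly_eq0 _ _ rs).
- apply/allP => _ /mapP[i _ ->]; rewrite /root hornerD hornerN.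
  by have := PQ i%:R; rewrite rmorph_nat => ->; rewrite subrr.
- by rewrite map_inj_uniq ?iota_uniq// => i j /eqP; rewrite eqr_nat => /eqP.
- by rewrite size_map size_iota.
Qed.

Lemma coef1_deriv (R : comNzRingType) (P : {poly R}) : P`_1 = P^`().[0].
Proof. by rewrite horner_coef0 coef_deriv. Qed.

(** * Moments of coordinate functions and Cauchy's formula *)

Section UnitPhase.
Context {R : realType}.

Lemma cexp_phaseX (a : R) k : cexp (0 +i* a)%C ^+ k = cexp (0 +i* (k%:R * a))%C.
Proof.
elim: k => [|k IH].
  by rewrite expr0 mul0r; apply: Cext; rewrite /= expR0 ?cos0 ?sin0; ring.
rewrite exprS IH -cexpD; congr cexp; apply: Cext => /=; first by rewrite addr0.
by rewrite -natr1; ring.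
Qed.

(** The number exp (i pi / d). The value -1 is enough to make an integral vanish by a change of
    sign. *)
Lemma unit_phase d : (0 < d)%N ->
  exists c : Cplx R, cabs c = 1 /\ c ^+ d = -1.
Proof.
move=> d0; exists (cexp (0 +i* (pi / d%:R))%C); split.
  by rewrite cabs_cexp expR0.
rewrite cexp_phaseX mulrC divfK ?pnatr_eq0 ?gtn_eqF//.
by apply: Cext; rewrite /= expR0 ?cospi ?sinpi; ring.
Qed.

Lemma unit_conj (c : Cplx R) : cabs c = 1 -> c * c^* = 1.
Proof. by move=> c1; rewrite mulC_conj c1 expr1n. Qed.

End UnitPhase.

Section Moments.
Context {R : realType} {n : nat}.
Local Notation C := (Cplx R).
Implicit Types (z w v x : Cn R n) (c : C).
Variable sigma : probability (BorelCn R n) R.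
Hypothesis hsigma : rotation_invariant_sphere_measure sigma.
Local Notation S := (@unit_sphere R n : set (BorelCn R n)).
Local Notation I f := (Cint sigma S f).

Lemma bdm_hdotl w : bdm S (fun x : BorelCn R n => hdot x w).
Proof.
split; first exact: Cmeas_hdotl.
by exists (enorm w) => x Sx; rewrite (le_trans (hdot_CS _ _))// Sx mul1r.
Qed.

Lemma bdm_hdotr w : bdm S (fun x : BorelCn R n => hdot w (x : Cn R n)).
Proof.
split; first exact: Cmeas_hdotr.
by exists (enorm w) => x Sx; rewrite (le_trans (hdot_CS _ _))// Sx mulr1.
Qed.

Lemma Cintable_S f : bdm S f -> Cintable sigma S f.
Proof.
move=> bf; apply: Cintable_bdm bf; first exact: (@measurable_sphere R n).
by apply: sphere_fin; exact: (@measurable_sphere R n).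
Qed.

Lemma Cint_S_cst c : I (fun=> c) = c.
Proof.
rewrite Cint_cst; last exact: (@measurable_sphere R n).
rewrite [X in fine X](_ : _ = 1%E) ?mulr1//.
exact: sphere1.
Qed.

Lemma Cint_SZl c f : bdm S f -> I (fun x => c * f x) = c * I f.
Proof.
by move=> bf; apply: CintZl; [exact: (@measurable_sphere R n)|exact: Cintable_S].
Qed.

Let S_rot (T : BorelCn R n -> BorelCn R n) (f : BorelCn R n -> C) :
  rotation (T : Cn R n -> Cn R n) -> measurable_fun setT T -> bdm S f ->
  I (fun x => f (T x)) = I f.
Proof.
move=> rT mT bf; apply: (Cint_rotation hsigma) => //.
- exact: (@measurable_sphere R n).
- exact: rotation_sphere.
- exact: Cintable_S.
Qed.

(** By invariance the integral equals [a] times itself. *)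
Lemma Cint_rot_eq0 (T : BorelCn R n -> BorelCn R n) (f : BorelCn R n -> C) a :
  rotation (T : Cn R n -> Cn R n) -> measurable_fun setT T -> bdm S f ->
  (forall x, f (T x) = a * f x) -> a != 1 -> I f = 0.
Proof.
move=> rT mT bf fT a1.
have : I f = a * I f.
  rewrite -Cint_SZl//.
  by rewrite -[LHS](S_rot rT mT bf); apply: eq_Cint => x _; rewrite fT.
move/eqP; rewrite -subr_eq0 -{1}(mul1r (I f)) -mulrBl mulf_eq0 subr_eq0.
by rewrite eq_sym (negbTE a1) => /eqP.
Qed.

Lemma neg1_neq1 : (-1 : C) != 1.
Proof. by rewrite -subr_eq0 -opprD oppr_eq0 -mulr2n pnatr_eq0. Qed.

(** The scalar rotation by a phase c with c^|k - l| = -1 changes the sign of the integrand. *)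
Lemma moment_offdiag z w k l : (k != l)%N ->
  I (fun x => hdot z x ^+ k * hdot x w ^+ l) = 0.
Proof.
move=> kl.
have [c [c1 cd]] : exists c : C, cabs c = 1 /\ c^* ^+ k * c ^+ l != 1.
  have [lk|lk] : (k < l)%N \/ (l < k)%N by move/eqP : kl; lia.
    have [c [c1 cd]] := @unit_phase R (l - k)%N ltac:(lia).
    exists c; split => //; rewrite -(subnKC (ltnW lk)) exprD mulrA -exprMn.
    by rewrite [c^* * c]mulrC unit_conj// expr1n mul1r cd neg1_neq1.
  have [c [c1 cd]] := @unit_phase R (k - l)%N ltac:(lia).
  exists c; split => //; rewrite -(subnK (ltnW lk)) exprD -mulrA -exprMn.
  rewrite [c^* * c]mulrC unit_conj// expr1n mulr1 -conjX cd conjN conj1.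
  exact: neg1_neq1.
apply: (@Cint_rot_eq0 (rank1_map c 0 0 0) _ (c^* ^+ k * c ^+ l)) => //.
- apply: rank1_map_rotation => x; rewrite /rank1_map scaler0 addr0 enormZ c1.
  by rewrite mul1r.
- exact: measurable_rank1_map.
- apply: bdmM; apply: bdmX; [exact: bdm_hdotr|exact: bdm_hdotl].
- move=> x; rewrite /rank1_map scaler0 addr0 hdotZl hdotZr !exprMn; ring.
Qed.

Definition moment k z : C := I (fun x => hdot z x ^+ k * hdot x z ^+ k).

Let bdm_mom k l z w : bdm S (fun x => hdot z x ^+ k * hdot x w ^+ l).
Proof. apply: bdmM; apply: bdmX; [exact: bdm_hdotr|exact: bdm_hdotl]. Qed.

(** A reflection along z with c^i = -1 leaves <x, v> unchanged and multiplies the integrand by the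
    conjugate of c^i, that is by -1. For z = 0 the integrand vanishes, since k >= i > 0. *)
Lemma moment_orth z v k i : hdot v z = 0 -> (0 < i)%N -> (i <= k)%N ->
  I (fun x => hdot z x ^+ k * (hdot x z ^+ (k - i) * hdot x v ^+ i)) = 0.
Proof.
move=> vz i0 ik.
have [z0|z0] := eqVneq (hdot z z) 0.
  have {}z0 : z = 0.
    apply: enorm_eq0; move: z0; rewrite hdotzz => -[] /eqP.
    by rewrite sqrf_eq0 => /eqP.
  rewrite -[RHS]Cint_S_cst; apply: eq_Cint => x _.
  by rewrite z0 hdot0l expr0n gtn_eqF ?mul0r// (leq_trans i0).
have [c [c1 ci]] := @unit_phase R i i0.
have zv : hdot z v = 0 by rewrite -hdotC vz conj0.
apply: (@Cint_rot_eq0 (refl z c) _ (-1)) => //.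
- exact: refl_rotation.
- exact: measurable_rank1_map.
- apply: bdmM; first by apply: bdmX; exact: bdm_hdotr.
  by apply: bdmM; apply: bdmX; exact: bdm_hdotl.
- move=> x; have hx : hdot (refl z c x) z = c * hdot x z.
    by rewrite hdot_refl -mulrA [hdot x z * _]mulrC mulrA divfK//; ring.
  have hz : hdot z (refl z c x) = c^* * hdot z x.
    by rewrite -hdotC hx conjM hdotC.
  rewrite hz hx hdot_refl zv mulr0 addr0 !exprMn.
  have : c^* ^+ k * c ^+ (k - i) = -1.
    rewrite -(subnK ik) exprD addnK mulrAC -exprMn [_ * c]mulrC unit_conj//.
    by rewrite expr1n mul1r -conjX ci conjN conj1.
  move=> e; rewrite [LHS](_ : _ = (c^* ^+ k * c ^+ (k - i)) *
    (hdot z x ^+ k * (hdot x z ^+ (k - i) * hdot x v ^+ i))); last by ring.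
  by rewrite e.
- exact: neg1_neq1.
Qed.

(** Write w as a multiple of z plus a vector orthogonal to z. By [moment_orth] only the first term
    of the binomial expansion survives. *)
Lemma moment_offE z w k : hdot z z != 0 ->
  I (fun x => hdot z x ^+ k * hdot x w ^+ k) =
  (hdot z w / hdot z z) ^+ k * moment k z.
Proof.
move=> z0; set a := hdot z w / hdot z z.
pose v := w - (a^* *: z).
have zv : hdot z v = 0.
  by rewrite /v hdotBr hdotZr conjCK /a divfK// subrr.
have vz : hdot v z = 0 by rewrite -hdotC zv conj0.
have mS := @measurable_sphere R n.
transitivity (I (fun x => \sum_(i <- index_iota 0 k.+1)
   'C(k, i)%:R * a ^+ (k - i) *
     (hdot z x ^+ k * (hdot x z ^+ (k - i) * hdot x v ^+ i)))).
  apply: eq_Cint => x _.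
  have -> : hdot x w = a * hdot x z + hdot x v.
    by rewrite /v hdotBr hdotZr conjCK; ring.
  rewrite exprDn big_mkord mulr_sumr; apply: eq_bigr => i _.
  by rewrite exprMn -mulr_natl; ring.
have bF i : bdm S (fun x => hdot z x ^+ k * (hdot x z ^+ (k - i) * hdot x v ^+ i)).
  apply: bdmM; first by apply: bdmX; exact: bdm_hdotr.
  by apply: bdmM; apply: bdmX; exact: bdm_hdotl.
have [-> _] := @Cint_sum _ _ _ sigma S nat (index_iota 0 k.+1) _ mS (fun i =>
  Cintable_S (bdmM (bdm_cst _ ('C(k, i)%:R * a ^+ (k - i))) (bF i))).
rewrite big_nat_recl// big_nat_cond big1 ?addr0.
  rewrite (Cint_SZl _ (bF 0%N)) bin0 mul1r subn0; congr (_ * _).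
  by apply: eq_Cint => x _; rewrite expr0 mulr1.
move=> i /andP[/andP[_ ik] _].
by rewrite (Cint_SZl _ (bF i.+1)) moment_orth ?mulr0.
Qed.

Lemma momentZ k c z : moment k (c *: z) = (cabs c ^+ 2)%:C ^+ k * moment k z.
Proof.
rewrite /moment -Cint_SZl//.
apply: eq_Cint => x _; rewrite hdotZl hdotZr !exprMn -mulC_conj exprMn; ring.
Qed.

(* The Householder reflection along [z - w] exchanges [z] and [w]. *)
Lemma moment_householder k z w : enorm z = enorm w -> complex.Im (hdot z w) = 0 ->
  moment k z = moment k w.
Proof.
move=> zw re.
have [v0|v0] := eqVneq (hdot (z - w) (z - w)) 0.
  suff -> : z = w by [].
  apply/eqP; rewrite -subr_eq0; apply/eqP; apply: enorm_eq0.
  by move: v0; rewrite hdotzz => -[] /eqP; rewrite sqrf_eq0 => /eqP.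
have e x : hdot (refl (z - w) (-1) x) z = hdot x w.
  have E : 2 * hdot (z - w) z = hdot (z - w) (z - w).
    have sw : hdot w z = hdot z w by rewrite -hdotC cconjE re oppr0; apply: Cext.
    have ww : hdot w w = hdot z z by rewrite !hdotzz zw.
    rewrite hdotBr !hdotBl sw ww; ring.
  rewrite hdot_refl.
  have -> : (-1 - 1) / hdot (z - w) (z - w) * hdot x (z - w) * hdot (z - w) z =
     - (hdot x (z - w)) * (2 * hdot (z - w) z / hdot (z - w) (z - w)) by ring.
  by rewrite E divff// mulr1 hdotBr; ring.
rewrite /moment -(@S_rot (refl (z - w) (-1))).
- apply: eq_Cint => x _; rewrite e; congr (_ ^+ _ * _).
  by rewrite -hdotC e hdotC.
- by apply: refl_rotation; rewrite cabsN cabs1.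
- exact: measurable_rank1_map.
- exact: bdm_mom.
Qed.

(** The phase of <z, w> is first moved into w, which does not change the moment; then <z, w> is real
    and the Householder reflection applies. *)
Lemma moment_norm k z w : enorm z = enorm w -> moment k z = moment k w.
Proof.
move=> zw; set h := hdot z w.
have [h0|h0] := eqVneq h 0; first by apply: moment_householder => //; rewrite -/h h0.
have ch : cabs h != 0 by apply/eqP => /cabs_eq0; apply/eqP.
pose c : C := h * ((cabs h)^-1)%:C.
have c1 : cabs c = 1.
  by rewrite /c cabsM cabs_real normrV ?unitfE// ger0_norm ?cabs_ge0// divff.
have -> : moment k w = moment k (c *: w) by rewrite momentZ c1 expr1n expr1n mul1r.
apply: moment_householder; first by rewrite enormZ c1 mul1r.
rewrite hdotZr /c -/h conjM conjR mulrAC [h^* * _]mulrC mulC_conj.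
by rewrite cImM /=; ring.
Qed.

Lemma bdm_mom_deriv_aux (g p q : BorelCn R n -> C) k i :
  bdm S g -> bdm S p -> bdm S q ->
  bdm S (fun x => g x * (p x ^+ (k - i) * q x ^+ i)).
Proof. by move=> bg bp bq; apply: bdmM => //; apply: bdmM; exact: bdmX. Qed.

(* Comparing the coefficients of [t] on both sides of an identity between
   polynomials in the real variable [t]. *)
Lemma Cint_polarize (g p q : BorelCn R n -> C) k (P : {poly C}) :
  bdm S g -> bdm S p -> bdm S q ->
  (forall t : R, I (fun x => g x * (p x + t%:C * q x) ^+ k.+1) = P.[t%:C]) ->
  k.+1%:R * I (fun x => g x * (p x ^+ k * q x)) = P^`().[0].
Proof.
move=> bg bp bq H.
pose F i x := g x * (p x ^+ (k.+1 - i) * q x ^+ i).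
pose Q : {poly C} := \poly_(i < k.+2) ('C(k.+1, i)%:R * I (F i)).
have bF i : bdm S (F i) by exact: bdm_mom_deriv_aux.
have <- : Q = P.
  apply: poly_eq_real => t; rewrite -H horner_poly.
  have mS := @measurable_sphere R n.
  have [E _] := @Cint_sum _ _ _ sigma S nat (index_iota 0 k.+2) _ mS (fun i =>
    Cintable_S (bdmM (bdm_cst _ ('C(k.+1, i)%:R * t%:C ^+ i)) (bF i))).
  transitivity (\sum_(0 <= i < k.+2) I (fun x => 'C(k.+1, i)%:R * t%:C ^+ i * F i x)).
    rewrite big_mkord; apply: eq_bigr => i _.
    by rewrite Cint_SZl//; ring.
  rewrite -E; apply: eq_Cint => x _; rewrite exprDn big_mkord mulr_sumr.
  by apply: eq_bigr => i _; rewrite exprMn -mulr_natl /F; ring.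
rewrite -coef1_deriv coef_poly /= bin1; congr (_ * _).
by apply: eq_Cint => x _; rewrite /F subSS subn0 expr1.
Qed.

Lemma hdot_e1 (n0 : (0 < n)%N) : hdot (e1 : Cn R n) e1 = 1.
Proof.
rewrite /hdot (bigD1 (Ordinal n0))//= big1 ?addr0.
  by rewrite !mxE /= conj1 mulr1.
move=> j jn0; rewrite !mxE.
have -> : (val j == 0%N) = false by apply/negbTE; move: jn0; rewrite -val_eqE.
by rewrite mul0r.
Qed.

Lemma enorm_e1 (n0 : (0 < n)%N) : enorm (e1 : Cn R n) = 1.
Proof.
apply: enormE_le => //; rewrite expr1n.
by have := hdot_e1 n0; rewrite hdotzz => -[].
Qed.

Lemma moment_diag (n0 : (0 < n)%N) z w k :
  I (fun x => hdot z x ^+ k * hdot x w ^+ k) = hdot z w ^+ k * moment k e1.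
Proof.
have [z0|z0] := eqVneq (hdot z z) 0.
  have {}z0 : z = 0.
    apply: enorm_eq0; move: z0; rewrite hdotzz => -[] /eqP.
    by rewrite sqrf_eq0 => /eqP.
  case: k => [|k].
    rewrite expr0 mul1r /moment; apply: eq_Cint => x _.
    by rewrite !expr0.
  rewrite z0 hdot0l expr0n /= mul0r -[RHS]Cint_S_cst; apply: eq_Cint => x _.
  by rewrite hdot0l expr0n /= mul0r.
rewrite [LHS](moment_offE _ _ z0).
have -> : moment k z = hdot z z ^+ k * moment k e1.
  rewrite (@moment_norm _ z ((enorm z)%:C *: e1)).
    by rewrite momentZ cabs_real ger0_norm ?enorm_ge0// hdotzz.
  by rewrite enormZ cabs_real enorm_e1// mulr1 ger0_norm ?enorm_ge0.
by rewrite mulrA -exprMn divfK.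
Qed.

(** Insert 1 = sum_j |x_j|^2 on the sphere. The integrals with the extra factor |x_j|^2 come from
    polarizing the diagonal formula of degree k + 1 twice, once in w ([L1]) and once in z ([L2]);
    the sum over j of k |e1_j|^2 + 1 is n + k. *)
Lemma moment_rec (n0 : (0 < n)%N) k :
  k.+1%:R * moment k e1 = (n + k)%:R * moment k.+1 e1.
Proof.
pose m := moment k.+1 (e1 : Cn R n).
have L1 z w v : I (fun x => hdot z x ^+ k.+1 * (hdot x w ^+ k * hdot x v)) =
    m * (hdot z w ^+ k * hdot z v).
  pose P : {poly C} := m%:P * ((hdot z w)%:P + (hdot z v)%:P * 'X) ^+ k.+1.
  have := @Cint_polarize (fun x => hdot z x ^+ k.+1) (fun x => hdot x w)
    (fun x => hdot x v) k P (bdmX _ (bdm_hdotr z)) (bdm_hdotl w) (bdm_hdotl v).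
  have -> : P^`().[0] = k.+1%:R * (m * (hdot z w ^+ k * hdot z v)).
    by rewrite /P !(derivM, derivD, derivC, derivX, deriv_exp) !(hornerE, hornerMn, horner_exp) /= -mulr_natl; ring.
  move=> H; apply: (mulfI (x := k.+1%:R)); first by rewrite pnatr_eq0.
  apply: H => t; rewrite /P !hornerE -[X in X * _]/m.
  have := moment_diag n0 z (w + t%:C *: v) k.+1.
  rewrite hdotDr hdotZr conjR -/m mulrC [_ * t%:C]mulrC => <-.
  by apply: eq_Cint => x _; rewrite hdotDr hdotZr conjR.
(* The exponent [k.-1] is harmless at k = 0, where its coefficient is 0. *)
have L2 z w u v : k.+1%:R * I (fun x => (hdot x w ^+ k * hdot x v) *
      (hdot z x ^+ k * hdot u x)) =
    m * (k%:R * (hdot z w ^+ k.-1 * hdot u w) * hdot z v + hdot z w ^+ k * hdot u v).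
  pose P : {poly C} := m%:P * (((hdot z w)%:P + (hdot u w)%:P * 'X) ^+ k
     * ((hdot z v)%:P + (hdot u v)%:P * 'X)).
  have := @Cint_polarize (fun x => hdot x w ^+ k * hdot x v) (fun x => hdot z x)
    (fun x => hdot u x) k P (bdmM (bdmX _ (bdm_hdotl w)) (bdm_hdotl v))
    (bdm_hdotr z) (bdm_hdotr u).
  have -> : P^`().[0] = m * (k%:R * (hdot z w ^+ k.-1 * hdot u w) * hdot z v +
     hdot z w ^+ k * hdot u v).
    by rewrite /P !(derivM, derivD, derivC, derivX, deriv_exp) !(hornerE, hornerMn, horner_exp) /= -mulr_natl; ring.
  apply=> t; rewrite /P !hornerE.
  transitivity (m * (hdot (z + t%:C *: u) w ^+ k * hdot (z + t%:C *: u) v)).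
    by rewrite -L1; apply: eq_Cint => x _; rewrite hdotDl hdotZl mulrC.
  by rewrite !hdotDl !hdotZl mulrA ![t%:C * _]mulrC.
have bE (j : 'I_n) : bdm S (fun x : BorelCn R n => (hdot x e1 ^+ k * hdot x (delta_mx 0 j)) *
      (hdot e1 x ^+ k * hdot (delta_mx 0 j) x)).
  apply: bdmM; apply: bdmM; try apply: bdmX;
    by [exact: bdm_hdotl|exact: bdm_hdotr].
have dl (x : Cn R n) (j : 'I_n) : hdot x (delta_mx 0 j) = x 0 j.
  rewrite /hdot (bigD1 j)//= mxE !eqxx /= conj1 mulr1 big1 ?addr0// => i ij.
  by rewrite mxE (negbTE ij) andbF conj0 mulr0.
have dr (x : Cn R n) (j : 'I_n) : hdot (delta_mx 0 j) x = (x 0 j)^*.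
  by rewrite -hdotC dl.
have dj (j : 'I_n) : (delta_mx 0 j : Cn R n) 0 j = 1 by rewrite mxE !eqxx.
have mS := @measurable_sphere R n.
have [E _] := @Cint_sum _ _ _ sigma S _ (index_enum 'I_n) _ mS (fun i =>
    Cintable_S (bE i)).
have -> : moment k e1 = I (fun x => \sum_(j < n) (hdot x e1 ^+ k * hdot x (delta_mx 0 j)) *
      (hdot e1 x ^+ k * hdot (delta_mx 0 j) x)).
  apply: eq_Cint => x Sx.
  transitivity (hdot e1 x ^+ k * hdot x e1 ^+ k * hdot x x).
    by rewrite hdotzz Sx expr1n mulr1.
  rewrite {3}/hdot mulr_sumr; apply: eq_bigr => j _; rewrite dl dr; ring.
rewrite E mulr_sumr (eq_bigr (fun j : 'I_n => m *
  (k%:R * ((e1 : Cn R n) 0 j * ((e1 : Cn R n) 0 j)^*) + 1))); last first.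
  move=> j _; rewrite L2 hdot_e1// !expr1n !dl !dr dj.
  by rewrite mul1r mul1r; ring.
rewrite -mulr_sumr big_split /= -mulr_sumr -/(hdot _ _) hdot_e1// mulr1.
by rewrite sumr_const card_ord natrD mulrC [n%:R + _]addrC.
Qed.

End Moments.

(** * The power series of (1 - x)^-n *)

Section NegativeBinomialSeries.
Context {R : realType}.
Local Notation C := (Cplx R).

(** The coefficient of x^k in (1 - x)^-n. For n = 0 the truncated predecessor gives 1 at k = 0 and 0
    afterwards, as it should. *)
Definition nbin n k := 'C((n + k).-1, k).

Lemma nbin_pascal n k : (nbin n.+1 k.+1 = nbin n k.+1 + nbin n.+1 k)%N.
Proof. have e1 : ((n.+1 + k.+1).-1 = (n + k).+1)%N by lia.
have e2 : ((n + k.+1).-1 = n + k)%N by lia.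
have e3 : ((n.+1 + k).-1 = n + k)%N by lia.
by rewrite /nbin e1 e2 e3 binS. Qed.

Lemma nbin0 n : nbin n 0 = 1%N. Proof. by rewrite /nbin bin0. Qed.

Lemma nbin_rec n k : (k.+1 * nbin n k.+1 = (n + k) * nbin n k)%N.
Proof. by rewrite /nbin addnS /= -mul_bin_diag. Qed.

Definition nbin_sum (F : nzRingType) n N (x : F) : F :=
  \sum_(0 <= k < N) (nbin n k)%:R * x ^+ k.

(** The truncated form of (1 - x) (1 - x)^-(n+1) = (1 - x)^-n, with its boundary term. It drives all
    inductions on n below, so that no infinite sum is formed. *)
Lemma nbin_sum_rec (F : comNzRingType) n N (x : F) :
  (1 - x) * nbin_sum n.+1 N.+1 x =
  nbin_sum n N.+1 x - (nbin n.+1 N)%:R * x ^+ N.+1.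
Proof.
rewrite /nbin_sum; elim: N => [|N IH].
  by rewrite !big_nat1 !nbin0 expr0 expr1; ring.
rewrite big_nat_recr//= [X in _ = X - _]big_nat_recr//= mulrDr IH.
rewrite !nbin_pascal natrD !exprS; ring.
Qed.

Lemma nbin_sum0 (F : comNzRingType) N (x : F) : nbin_sum 0 N.+1 x = 1.
Proof.
rewrite /nbin_sum big_nat_recl// nbin0 expr0 mulr1 big1 ?addr0// => i _.
by rewrite /nbin add0n /= bin_small ?mul0r.
Qed.

(** Induction on n: for t >= 0 the boundary term of [nbin_sum_rec] has a favourable sign and is
    dropped. *)
Lemma nbin_sum_le n N (t : R) : 0 <= t < 1 -> nbin_sum n N t <= (1 - t) ^- n.
Proof.
move=> /andP[t0 t1]; have p : 0 < 1 - t by rewrite subr_gt0.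
case: N => [|N].
  by rewrite /nbin_sum big_geq// invr_ge0 exprn_ge0// ltW.
elim: n => [|n IH]; first by rewrite nbin_sum0 expr0 invr1.
rewrite exprS invfM ler_pdivlMl// nbin_sum_rec (le_trans _ IH)//.
by rewrite gerBl mulr_ge0// exprn_ge0.
Qed.

Lemma nbin_term_le n k (t : R) : 0 <= t < 1 ->
  (nbin n k)%:R * t ^+ k <= (1 - t) ^- n.
Proof.
move=> t01; rewrite (le_trans _ (nbin_sum_le n k.+1 t01))//.
rewrite /nbin_sum big_nat_recr//= lerDr sumr_ge0// => i _.
by rewrite mulr_ge0// exprn_ge0//; case/andP : t01.
Qed.

Lemma geometric_small (q K e : R) : 0 <= q < 1 -> 0 < e ->
  exists N0, forall N, (N0 <= N)%N -> K * q ^+ N <= e.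
Proof.
move=> /andP[q0 q1] e0.
have q1' : `|q| < 1 by rewrite ger0_norm.
have H := cvg_geometric K q1'.
have /cvgrPdist_le /(_ e e0) [N0 _ HN] := H.
exists N0 => N NN0; have := HN N NN0; rewrite /= sub0r normrN.
exact: le_trans (ler_norm _).
Qed.

Lemma nbin_term_small n (s e : R) : 0 <= s < 1 -> 0 < e ->
  exists N0, forall N, (N0 <= N)%N -> (nbin n N)%:R * s ^+ N <= e.
Proof.
move=> /andP[s0 s1] e0; pose t := (s + 1) / 2.
have t01 : 0 < t < 1 by rewrite /t; apply/andP; split; lra.
have [t0 t1] := andP t01.
have [|N0 HN] := @geometric_small (s / t) ((1 - t) ^- n) e _ e0.
  rewrite divr_ge0// ?(ltW t0)//= ltr_pdivrMr// mul1r /t; lra.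
exists N0 => N /HN; apply: le_trans.
rewrite -[in X in X <= _](divfK (lt0r_neq0 t0) s) [_ * t]mulrC exprMn mulrA.
apply: ler_wpM2r; first by rewrite exprn_ge0// divr_ge0// ltW.
by apply: nbin_term_le; rewrite (ltW t0).
Qed.

Lemma cabs_1B_ge (x : C) (s : R) : cabs x <= s -> 1 - s <= cabs (1 - x).
Proof.
move=> xs; have := ler_dist_cabs 1 x; rewrite cabs1 => h.
by rewrite (le_trans _ h)// (le_trans _ (ler_norm _))// lerD2l lerN2.
Qed.

(** Induction on n by [nbin_sum_rec]. Dividing by 1 - x costs a factor 1 / (1 - s), and half of the
    allowance goes to the boundary term. *)
Lemma nbin_sum_unif n (s e : R) : 0 <= s < 1 -> 0 < e ->
  exists N0, forall N, (N0 <= N)%N -> forall x : C, cabs x <= s ->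
    cabs ((1 - x) ^- n - nbin_sum n N x) <= e.
Proof.
move=> s01; have [s0 s1] := andP s01.
have p : 0 < 1 - s by rewrite subr_gt0.
elim: n e => [|n IH] e e0.
  exists 1%N => -[//|N] _ x xs.
  by rewrite expr0 invr1 nbin_sum0 subrr cabs0 ltW.
have e' : 0 < e * (1 - s) / 2 by rewrite divr_gt0 ?mulr_gt0.
have [N1 H1] := IH _ e'.
have [N2 H2] := nbin_term_small n.+1 s01 e'.
exists (maxn N1 N2).+1 => -[//|N]; rewrite ltnS geq_max => /andP[h1 h2] x xs.
have x1 : 1 - s <= cabs (1 - x) by exact: cabs_1B_ge.
have x0 : 1 - x != 0.
  by apply/eqP => x0; move: x1; rewrite x0 cabs0; lra.
have -> : (1 - x) ^- n.+1 - nbin_sum n.+1 N.+1 x =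
   (1 - x)^-1 * (((1 - x) ^- n - nbin_sum n N.+1 x) +
      (nbin n.+1 N)%:R * x ^+ N.+1).
  have := nbin_sum_rec n N x => /(canRL (mulKf x0)) ->.
  by rewrite exprS invfM; ring.
rewrite cabsM cabsV mulrC ler_pdivrMr; last exact: lt_le_trans x1.
rewrite (le_trans (cabsD _ _))//.
have a := H1 N.+1 (leqW h1) x xs; have b := H2 N h2.
have c : cabs ((nbin n.+1 N)%:R * x ^+ N.+1) <= (nbin n.+1 N)%:R * s ^+ N.
  rewrite cabsM cabs_nat cabsX ler_wpM2l// exprS.
  rewrite -[leRHS]mul1r ler_pM ?cabs_ge0 ?exprn_ge0 ?cabs_ge0//.
    by rewrite (le_trans xs)// ltW.
  by rewrite lerXn2r// nnegrE ?cabs_ge0.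
have : e * (1 - s) <= e * cabs (1 - x) by rewrite ler_wpM2l// ltW.
lra.
Qed.

Lemma cabs_nbin_sum_le n N (x : C) (s : R) : s < 1 -> cabs x <= s ->
  cabs (nbin_sum n N x) <= (1 - s) ^- n.
Proof.
move=> s1 xs; have s0 : 0 <= s by exact: le_trans (cabs_ge0 _) xs.
rewrite (le_trans _ (nbin_sum_le n N _)) ?s0//.
rewrite /nbin_sum (le_trans (cabs_sum _ _ _))// ler_sum// => k _.
by rewrite cabsM cabs_nat cabsX ler_wpM2l// lerXn2r// nnegrE ?cabs_ge0.
Qed.

Lemma cabs_power_le n (x : C) (s : R) : s < 1 -> cabs x <= s ->
  cabs ((1 - x) ^- n) <= (1 - s) ^- n.
Proof.
move=> s1 xs; have p : 0 < 1 - s by rewrite subr_gt0.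
have h := cabs_1B_ge xs.
rewrite cabsV cabsX lef_pV2 ?posrE ?exprn_gt0//; last exact: lt_le_trans h.
by rewrite lerXn2r// nnegrE ?cabs_ge0// ltW.
Qed.

End NegativeBinomialSeries.

(** * Cauchy's formula *)

Section CauchyFormula.
Context {R : realType} {n : nat}.
Local Notation C := (Cplx R).
Implicit Types (z w v x : Cn R n) (c : C).
Hypothesis n0 : (0 < n)%N.
Variable sigma : probability (BorelCn R n) R.
Hypothesis hsigma : rotation_invariant_sphere_measure sigma.
Local Notation S := (@unit_sphere R n : set (BorelCn R n)).
Local Notation I f := (Cint sigma S f).

(** The recursions [moment_rec] and [nbin_rec] are inverse to each other; at k = 0 the moment is the
    total mass 1. *)
Lemma moment_nbin k : moment sigma k e1 * (nbin n k)%:R = 1.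
Proof.
elim: k => [|k IH].
  rewrite nbin0 mulr1 /moment -[RHS](Cint_S_cst hsigma); apply: eq_Cint => x _.
  by rewrite expr0 mul1r.
apply: (mulfI (x := k.+1%:R)); first by rewrite pnatr_eq0.
rewrite mulrCA -natrM nbin_rec natrM mulrCA mulrA -(moment_rec hsigma n0).
by rewrite -mulrA IH.
Qed.

(** Off-diagonal products integrate to 0, and on the diagonal the moment cancels one of the two
    equal coefficients: the truncated kernels reproduce themselves. *)
Lemma Cint_nbin_sum N z w :
  I (fun x => nbin_sum n N (hdot z x) * nbin_sum n N (hdot x w)) =
  nbin_sum n N (hdot z w).
Proof.
have mS := @measurable_sphere R n.
have bF k l : bdm S (fun x => hdot z x ^+ k * hdot x w ^+ l).
  by apply: bdmM; apply: bdmX; [exact: bdm_hdotr|exact: bdm_hdotl].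
transitivity (I (fun x => \sum_(k <- index_iota 0 N) \sum_(l <- index_iota 0 N)
    ((nbin n k)%:R * (nbin n l)%:R) * (hdot z x ^+ k * hdot x w ^+ l))).
  apply: eq_Cint => x _; rewrite /nbin_sum mulr_suml; apply: eq_bigr => k _.
  by rewrite mulr_sumr; apply: eq_bigr => l _; ring.
have I1 k l : Cintable sigma S (fun x => ((nbin n k)%:R * (nbin n l)%:R) *
    (hdot z x ^+ k * hdot x w ^+ l)).
  by apply: Cintable_S; apply: bdmM => //; exact: bdm_cst.
have J k := @Cint_sum _ _ _ sigma S nat (index_iota 0 N) _ mS (I1 k).
have [-> _] := @Cint_sum _ _ _ sigma S nat (index_iota 0 N) _ mS (fun k => (J k).2).
rewrite /nbin_sum !big_mkord; apply: eq_bigr => k _.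
rewrite (J k).1 big_mkord (bigD1 k)//= big1 ?addr0.
  rewrite (Cint_SZl _ _ (bF _ _)) moment_diag// -mulrA; congr (_ * _).
  by rewrite mulrCA [_%:R * moment _ _ _]mulrC moment_nbin mulr1.
move=> l lk; rewrite (Cint_SZl _ _ (bF _ _)) moment_offdiag ?mulr0// eq_sym.
by move: lk; rewrite -val_eqE.
Qed.

Lemma bdm_cauchy_r z : enorm z < 1 -> bdm S (fun x => (1 - hdot z x) ^- n).
Proof.
move=> z1; split.
  apply: CmeasV; apply: CmeasX; apply: CmeasB; first exact: Cmeas_cst.
  exact: Cmeas_hdotr.
exists ((1 - enorm z) ^- n) => x Sx; apply: cabs_power_le => //.
by rewrite (le_trans (hdot_CS _ _))// Sx mulr1.
Qed.

Lemma bdm_cauchy_l z : enorm z < 1 -> bdm S (fun x => (1 - hdot x z) ^- n).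
Proof.
move=> z1; split.
  apply: CmeasV; apply: CmeasX; apply: CmeasB; first exact: Cmeas_cst.
  exact: Cmeas_hdotl.
exists ((1 - enorm z) ^- n) => x Sx; apply: cabs_power_le => //.
by rewrite (le_trans (hdot_CS _ _))// Sx mul1r.
Qed.

Lemma bdm_nbin_sum N (f : BorelCn R n -> C) : bdm S f ->
  bdm S (fun x => nbin_sum n N (f x)).
Proof.
move=> bf; apply: bdm_sum => k; apply: bdmM; [exact: bdm_cst|exact: bdmX].
Qed.

(** Both kernels are uniform limits of their truncations on the sphere, because z and w are in the
    open ball; the identity passes to the limit from [Cint_nbin_sum]. *)
Lemma cauchy_formula z w : enorm z < 1 -> enorm w < 1 ->
  I (fun x => (1 - hdot z x) ^- n * (1 - hdot x w) ^- n) = (1 - hdot z w) ^- n.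
Proof.
move=> z1 w1; apply/eqP; rewrite -subr_eq0; apply/eqP; apply: cabs_eq0.
apply/eqP; rewrite eq_le cabs_ge0 andbT; apply/ler_addgt0Pl => e e0; rewrite addr0.
pose s := Num.max (enorm z) (enorm w).
have s1 : s < 1 by rewrite gt_max z1.
have s0 : 0 <= s by rewrite le_max enorm_ge0.
have p : 0 < 1 - s by rewrite subr_gt0.
pose K := (1 - s) ^- n.
have K1 : 1 <= K.
  rewrite /K invf_ge1 ?exprn_gt0//; apply: exprn_ile1; [exact: ltW|lra].
(* [K] bounds the kernels and their truncations. Replacing the two factors of the product costs 2 K
   e', and the kernel on the right e' <= K e'. *)
have e' : 0 < e / (3 * K) by rewrite divr_gt0// mulr_gt0//; lra.
have [N HN] := nbin_sum_unif n (s:=s) (introT andP (conj s0 s1)) e'.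
have mS := @measurable_sphere R n.
have H := HN N (leqnn N).
have zs x : S x -> cabs (hdot z x) <= s.
  by move=> Sx; rewrite (le_trans (hdot_CS _ _))// Sx mulr1 le_max lexx.
have ws x : S x -> cabs (hdot x w) <= s.
  by move=> Sx; rewrite (le_trans (hdot_CS _ _))// Sx mul1r le_max lexx orbT.
have zw : cabs (hdot z w) <= s.
  rewrite (le_trans (hdot_CS _ _))// -[leRHS]mulr1.
  by rewrite ler_pM ?enorm_ge0// ?(ltW w1)// le_max lexx.
have bA := bdmM (bdm_cauchy_r z1) (bdm_cauchy_l w1).
have bP := bdmM (bdm_nbin_sum N (bdm_hdotr z)) (bdm_nbin_sum N (bdm_hdotl w)).
have -> : I (fun x => (1 - hdot z x) ^- n * (1 - hdot x w) ^- n) - (1 - hdot z w) ^- n =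
   I (fun x => (1 - hdot z x) ^- n * (1 - hdot x w) ^- n -
       nbin_sum n N (hdot z x) * nbin_sum n N (hdot x w)) -
   ((1 - hdot z w) ^- n - nbin_sum n N (hdot z w)).
  rewrite CintB//; [|exact: Cintable_S..].
  by rewrite Cint_nbin_sum; ring.
rewrite (le_trans (cabsB _ _))//.
have b1 := H _ zw.
have b2 : cabs (I (fun x => (1 - hdot z x) ^- n * (1 - hdot x w) ^- n -
       nbin_sum n N (hdot z x) * nbin_sum n N (hdot x w))) <= 2 * K * (e / (3 * K)).
  apply: (@le_trans _ _ (\int[sigma]_(x in S) (2 * K * (e / (3 * K))))); last first.
    rewrite Rintegral_cst// [X in _ * fine X](_ : _ = 1%E) ?mulr1//.
    exact: sphere1.
  apply: cabs_Cint_bound => //.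
  - apply: CmeasB; [by case: bA|by case: bP].
  - exact: integrable_sphere_cst.
  move=> x Sx.
  have -> : (1 - hdot z x) ^- n * (1 - hdot x w) ^- n -
       nbin_sum n N (hdot z x) * nbin_sum n N (hdot x w) =
    ((1 - hdot z x) ^- n - nbin_sum n N (hdot z x)) * (1 - hdot x w) ^- n +
    nbin_sum n N (hdot z x) * ((1 - hdot x w) ^- n - nbin_sum n N (hdot x w)) by ring.
  rewrite (le_trans (cabsD _ _))// !cabsM.
  have a1 := H _ (zs x Sx); have a2 := H _ (ws x Sx).
  have c1 := cabs_power_le n s1 (ws x Sx).
  have c2 := cabs_nbin_sum_le n N s1 (zs x Sx).
  have := ler_pM (cabs_ge0 _) (cabs_ge0 _) a1 c1.
  have := ler_pM (cabs_ge0 _) (cabs_ge0 _) c2 a2.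
  rewrite -/K; lra.
have -> : e = 2 * K * (e / (3 * K)) + K * (e / (3 * K)) by field; rewrite gt_eqF//; lra.
apply: lerD => //; rewrite (le_trans b1)// ler_peMl// ltW//.
Qed.

End CauchyFormula.

(* [X j] stands for [||A^(2^j) h||^2]: a bounded sequence cannot keep up with
   the growth forced by [X j ^ 2 <= E * X j.+1] unless [X 0 <= E]. *)
Lemma bounded_square_growth (R : realType) (X : nat -> R) (E B : R) :
  0 <= E -> (forall j, X j <= B) ->
  (forall j l, 0 < l -> X j <= (l * E + X j.+1 / l) / 2) -> X 0%N <= E.
Proof.
move=> E0 XB H; rewrite leNgt; apply/negP => EX.
(* [E] may be 0, so the normalisation uses a number strictly between [E] and [X 0]. With l = y_j the
   hypothesis becomes y_j^2 <= y_(j+1), and linear growth already contradicts boundedness. *)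
pose E' := (E + X 0%N) / 2.
have EE' : E < E' by rewrite /E'; lra.
have E'X : E' < X 0%N by rewrite /E'; lra.
have E'0 : 0 < E' by exact: le_lt_trans EE'.
pose y j := X j / E'.
have y0 : 1 < y 0%N by rewrite /y ltr_pdivlMr// mul1r.
have step j : 1 < y j -> y j ^+ 2 <= y j.+1.
  move=> y1; have yp : 0 < y j by exact: lt_trans y1.
  have := H j _ yp; have XE k : X k = y k * E' by rewrite /y divfK ?gt_eqF.
  rewrite !XE => h.
  have {}h : y j * E' <= (y j * E' + y j.+1 * E' / y j) / 2.
    apply: (le_trans h); rewrite ler_pM2r ?invr_gt0// lerD2r.
    by rewrite ler_wpM2l ?ltW.
  have {}h : y j * E' <= y j.+1 * E' / y j by lra.
  by move: h; rewrite ler_pdivlMr// mulrAC ler_pM2r.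
have lin j : 1 + j.+1%:R * (y 0%N - 1) <= y j /\ 1 < y j.
  elim: j => [|j [IH1 IH2]]; first by split => //; lra.
  have s := step j IH2.
  have y0j : y 0%N <= y j.
    apply: le_trans IH1; rewrite -natr1.
    have : 0 <= j%:R * (y 0%N - 1) by rewrite mulr_ge0// subr_ge0 ltW.
    lra.
  have : 1 + j.+2%:R * (y 0%N - 1) <= y j.+1.
    apply: le_trans s; rewrite -natr1 expr2; nra.
  move=> h; split => //; apply: lt_le_trans h.
  by rewrite ltrDl mulr_gt0// subr_gt0.
pose M := B / E' / (y 0%N - 1).
have yB j : y j <= B / E' by rewrite /y ler_pM2r ?invr_gt0.
have yp : 0 < y 0%N - 1 by rewrite subr_gt0.
have := archi_boundP (normr_ge0 M); set j := Num.bound _ => Mj.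
have [h _] := lin j; have := yB j.
have : M * (y 0%N - 1) = B / E' by rewrite /M divfK ?gt_eqF.
have : M < j%:R by rewrite (le_lt_trans (ler_norm _)).
rewrite -(ltr_pM2r yp); rewrite -natr1 in h; nra.
Qed.

Section ProductProjections.
Context d1 d2 (T1 : measurableType d1) (T2 : measurableType d2) (R : realType).
Variables (D1 : set T1) (D2 : set T2).

Lemma Cmeas_fst (u : T1 -> Cplx R) : measurable D1 -> Cmeas D1 u ->
  Cmeas (D1 `*` D2) (fun p : T1 * T2 => u p.1).
Proof.
have c1 : measurable_fun (D1 `*` D2) (fst : T1 * T2 -> T1) by exact: measurable_funTS.
have sub : [set p.1 | p in D1 `*` D2] `<=` D1 by move=> _ [[a b] [/= Da _] <-].
by move=> mD [u1 u2]; have := measurable_comp mD sub u1 c1;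
  have := measurable_comp mD sub u2 c1; split.
Qed.

Lemma Cmeas_snd (u : T2 -> Cplx R) : measurable D2 -> Cmeas D2 u ->
  Cmeas (D1 `*` D2) (fun p : T1 * T2 => u p.2).
Proof.
have c2 : measurable_fun (D1 `*` D2) (snd : T1 * T2 -> T2) by exact: measurable_funTS.
have sub : [set p.2 | p in D1 `*` D2] `<=` D2 by move=> _ [[a b] [/= _ Db] <-].
by move=> mD [u1 u2]; have := measurable_comp mD sub u1 c2;
  have := measurable_comp mD sub u2 c2; split.
Qed.
End ProductProjections.

(** * The Cauchy operator *)

Section CauchyOperator.
Context {R : realType} {n : nat}.
Local Notation C := (Cplx R).
Implicit Types (z w v x : Cn R n) (c : C).
Hypothesis n0 : (0 < n)%N.
Variable sigma : probability (BorelCn R n) R.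
Hypothesis hsigma : rotation_invariant_sphere_measure sigma.
Local Notation S := (@unit_sphere R n : set (BorelCn R n)).
Local Notation I f := (Cint sigma S f).
Let mS : measurable S := @measurable_sphere R n.

Lemma cauchy_kernel_rscale (s : R) z x :
  cauchy_kernel (rscale s z) x = (1 - s%:C * hdot z x) ^- n.
Proof. by rewrite /cauchy_kernel rscaleE hdotZl. Qed.

Lemma cabs_cauchy_kernel (s : R) z x : 0 <= s < 1 -> S z -> S x ->
  cabs (cauchy_kernel (rscale s z) x) <= (1 - s) ^- n.
Proof.
move=> /andP[s0 s1] Sz Sx; apply: cabs_power_le => //.
rewrite (le_trans (hdot_CS _ _))// enorm_rscale Sz Sx !mulr1 ger0_norm//.
Qed.

Lemma measurable_rscale (s : R) (D : set (BorelCn R n)) :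
  measurable_fun D (fun z : BorelCn R n => rscale s (z : Cn R n) : BorelCn R n).
Proof.
have -> : (fun z : BorelCn R n => rscale s (z : Cn R n) : BorelCn R n) =
    (rank1_map s%:C 0 0 0 : BorelCn R n -> BorelCn R n).
  by apply/funext => z; rewrite /rank1_map scaler0 addr0.
by apply: measurable_funTS; exact: measurable_rank1_map.
Qed.

Lemma Cmeas_cauchy_kernel d (T : measurableType d) (D : set T)
    (f g : T -> BorelCn R n) (s : R) :
  measurable_fun D f -> measurable_fun D g ->
  Cmeas D (fun t => cauchy_kernel (rscale s (f t : Cn R n)) (g t : Cn R n)).
Proof.
move=> mf mg; apply: CmeasV; apply: CmeasX; apply: CmeasB; first exact: Cmeas_cst.
apply: (@Cmeas_hdot _ _ _ _ D (fun t => rscale s (f t : Cn R n) : BorelCn R n) g) => //.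
apply: (measurableT_comp (f := fun z : BorelCn R n => rscale s (z : Cn R n) : BorelCn R n)) => //.
exact: measurable_rscale.
Qed.

Lemma bdm_cauchy_kernel (s : R) z : 0 <= s < 1 -> S z ->
  bdm S (fun x => cauchy_kernel (rscale s z) x).
Proof.
move=> s01 Sz; split.
  exact: (@Cmeas_cauchy_kernel _ _ S (cst z) id).
by exists ((1 - s) ^- n) => x Sx; exact: cabs_cauchy_kernel.
Qed.

Definition cauchy_op (s : R) (h : BorelCn R n -> C) (z : BorelCn R n) : C :=
  I (fun x => cauchy_kernel (rscale s z) x * h x).

Lemma Rintegral_S_cst (K : R) : \int[sigma]_(x in S) K = K.
Proof.
rewrite Rintegral_cst// [X in _ * fine X](_ : _ = 1%E) ?mulr1//.
exact: sphere1.
Qed.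

Lemma cabs_cauchy_op_le (s : R) h (L : R) z : 0 <= s < 1 -> bdm S h ->
  (forall x, S x -> cabs (h x) <= L) -> S z ->
  cabs (cauchy_op s h z) <= (1 - s) ^- n * L.
Proof.
move=> s01 bh hL Sz.
have -> : (1 - s) ^- n * L = \int[sigma]_(x in S) ((1 - s) ^- n * L).
  by rewrite Rintegral_S_cst.
apply: cabs_Cint_bound => //.
- by apply: CmeasM; [case: (bdm_cauchy_kernel s01 Sz)|case: bh].
- exact: integrable_sphere_cst.
- by move=> x Sx; rewrite cabsM ler_pM ?cabs_ge0 ?hL// cabs_cauchy_kernel.
Qed.

(** Here [h] is only integrable; measurability in z is the second conclusion of Fubini's theorem. *)
Lemma Cmeas_op (s : R) (h : BorelCn R n -> C) : 0 <= s < 1 ->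
  Cintable sigma S h -> Cmeas S (cauchy_op s h).
Proof.
move=> s01 Ih.
have [||_ //] := @Cint_Fubini _ _ (BorelCn R n) (BorelCn R n) R sigma sigma S S mS mS
  (fun p => cauchy_kernel (rscale s (p.1 : Cn R n)) p.2 * h p.2)
  (fun=> (1 - s) ^- n) (fun x => cabs (h x)) _ (integrable_sphere_cst sigma _ mS)
  (Cintable_cabs mS Ih).
  apply: CmeasM.
    by apply: Cmeas_cauchy_kernel; exact: measurable_funTS.
  by apply: (Cmeas_snd _ mS); exact: (Cintable_meas Ih).
by move=> x y Sx Sy /=; rewrite cabsM ler_wpM2r ?cabs_ge0// cabs_cauchy_kernel.
Qed.

Lemma bdm_op (s : R) (h : BorelCn R n -> C) : 0 <= s < 1 -> bdm S h ->
  bdm S (cauchy_op s h).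
Proof.
move=> s01 bh; split; first by apply: Cmeas_op => //; exact: Cintable_S.
have [_ [L hL]] := bh.
by exists ((1 - s) ^- n * L) => z Sz; exact: cabs_cauchy_op_le.
Qed.

Lemma cauchy_kernelC (s : R) z x :
  (cauchy_kernel (rscale s z) x)^* = cauchy_kernel (rscale s x) z.
Proof.
by rewrite !cauchy_kernel_rscale conjV conjX conjD conjN conjM conjR hdotC conj1.
Qed.

Lemma Cint_swap (s : R) (u v : BorelCn R n -> C) : 0 <= s < 1 ->
  bdm S u -> bdm S v ->
  I (fun z => u z * I (fun x => cauchy_kernel (rscale s z) x * v x)) =
  I (fun x => v x * I (fun z => u z * cauchy_kernel (rscale s z) x)).
Proof.
move=> s01 bu bv; have [mu [K uK]] := bu; have [mv [L vL]] := bv.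
have c1 : measurable_fun (S `*` S) (fst : BorelCn R n * BorelCn R n -> BorelCn R n).
  exact: measurable_funTS.
have c2 : measurable_fun (S `*` S) (snd : BorelCn R n * BorelCn R n -> BorelCn R n).
  exact: measurable_funTS.
have [] := @Cint_Fubini _ _ (BorelCn R n) (BorelCn R n) R sigma sigma S S mS mS
  (fun p => u p.1 * (cauchy_kernel (rscale s (p.1 : Cn R n)) p.2 * v p.2))
  (fun=> `|K| * (1 - s) ^- n) (fun=> `|L|) _ (integrable_sphere_cst sigma _ mS) (integrable_sphere_cst sigma _ mS).
- apply: CmeasM; first exact: Cmeas_fst.
  apply: CmeasM; first exact: Cmeas_cauchy_kernel.
  exact: Cmeas_snd.
- move=> x y Sx Sy /=; rewrite !cabsM mulrA ler_pM ?mulr_ge0 ?cabs_ge0//; last first.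
    by rewrite (le_trans (vL _ Sy))// ler_norm.
  rewrite ler_pM ?cabs_ge0 ?cabs_cauchy_kernel//.
  by rewrite (le_trans (uK _ Sx))// ler_norm.
move=> E _; transitivity (I (fun z => I (fun x =>
    u z * (cauchy_kernel (rscale s z) x * v x)))).
  apply: eq_Cint => z Sz.
  exact/esym/(Cint_SZl sigma (u z) (bdmM (bdm_cauchy_kernel s01 Sz) bv)).
apply: (etrans E); apply: eq_Cint => x Sx.
have bk : bdm S (fun z => u z * cauchy_kernel (rscale s z) x).
  apply: (bdmM bu); split.
    exact: (@Cmeas_cauchy_kernel _ _ S id (cst x)).
  by exists ((1 - s) ^- n) => z Sz; exact: cabs_cauchy_kernel.
apply: (etrans _ (Cint_SZl sigma (v x) bk)).
by apply: eq_Cint => z _; rewrite /= mulrA [RHS]mulrC.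
Qed.

(** After exchanging the integrals, the inner one is a product of kernels evaluated by
    [cauchy_formula] at the points s z and t x. *)
Lemma cauchy_op_comp (s t : R) (h : BorelCn R n -> C) z :
  0 <= s < 1 -> 0 <= t < 1 -> bdm S h -> S z ->
  cauchy_op s (cauchy_op t h) z = cauchy_op (s * t) h z.
Proof.
move=> s01 t01 bh Sz; rewrite /cauchy_op (Cint_swap t01 (bdm_cauchy_kernel s01 Sz) bh).
have [s0 s1] := andP s01; have [t0 t1] := andP t01.
apply: eq_Cint => x Sx; rewrite mulrC; congr (_ * _).
rewrite -[RHS]/((1 - _) ^- n).
have := @cauchy_formula R n n0 sigma hsigma (rscale s z) (rscale t x).
rewrite !enorm_rscale Sz Sx !mulr1 !ger0_norm// => /(_ s1 t1).
rewrite !rscaleE hdotZr !hdotZl conjR => E.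
transitivity ((1 - t%:C * (s%:C * hdot z x)) ^- n); last first.
  by congr ((1 - _) ^- n); rewrite ?hdotZl real_complexM; ring.
rewrite -E; apply: eq_Cint => y _.
by rewrite /cauchy_kernel !rscaleE !hdotZl hdotZr conjR.
Qed.

(** The kernel is hermitian in its two variables ([cauchy_kernelC]); the rest is an exchange of
    integrals. *)
Lemma cauchy_op_adj (s : R) (h g : BorelCn R n -> C) : 0 <= s < 1 ->
  bdm S h -> bdm S g ->
  I (fun z => cauchy_op s h z * (g z)^*) = I (fun z => h z * (cauchy_op s g z)^*).
Proof.
move=> s01 bh bg.
transitivity (I (fun z => (g z)^* * cauchy_op s h z)).
  by apply: eq_Cint => z _; rewrite mulrC.
rewrite /cauchy_op (Cint_swap s01 (bdm_conj bg) bh); apply: eq_Cint => x Sx.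
congr (_ * _); rewrite -Cint_conj//; last first.
  by apply: Cintable_S; apply: bdmM => //; exact: bdm_cauchy_kernel.
by apply: eq_Cint => z Sz; rewrite conjM cauchy_kernelC mulrC.
Qed.

(** The square of the L^2 norm; no root is taken. *)
Definition normL2 (h : BorelCn R n -> C) : R := \int[sigma]_(x in S) (cabs (h x) ^+ 2).

Lemma integrable_cabs_sqr h : bdm S h ->
  Rintegrable sigma S (fun x => cabs (h x) ^+ 2).
Proof.
move=> [mh [K hK]]; apply: (@integrable_bounded _ _ _ _ _ _ (`|K| ^+ 2)) => //.
- exact: sphere_fin.
- by apply: measurable_funX; exact: measurable_cabs.
- move=> x Sx; rewrite ger0_norm ?sqr_ge0// lerXn2r ?nnegrE ?cabs_ge0//.
  by rewrite (le_trans (hK _ Sx))// ler_norm.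
Qed.

Lemma normL2E h : I (fun x => h x * (h x)^*) = (normL2 h)%:C.
Proof.
apply: Cext => /=.
  by apply: eq_Rintegral => x _; rewrite mulC_conj.
rewrite -[RHS](Rintegral_S_cst 0); apply: eq_Rintegral => x _.
by rewrite mulC_conj.
Qed.

(** Young's inequality with a free weight [l] serves as Cauchy-Schwarz without square roots;
    [bounded_square_growth] chooses the weight. *)
Lemma Re_Cint_young h g (l : R) : bdm S h -> bdm S g -> 0 < l ->
  complex.Re (I (fun x => h x * (g x)^*)) <= (l * normL2 h + normL2 g / l) / 2.
Proof.
move=> bh bg l0; rewrite /normL2.
have Ih := integrable_cabs_sqr bh; have Ig := integrable_cabs_sqr bg.
have Jh := integrableZl mS l Ih.
have Jg := integrableZl mS l^-1 Ig.
have -> : (l * \int[sigma]_(x in S) cabs (h x) ^+ 2 +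
   (\int[sigma]_(x in S) cabs (g x) ^+ 2) / l) / 2 =
   \int[sigma]_(x in S) (2^-1 * (l * cabs (h x) ^+ 2 + l^-1 * cabs (g x) ^+ 2)).
  rewrite RintegralZl//; last exact: (integrableD mS Jh Jg).
  rewrite RintegralD// !RintegralZl//; ring.
apply: le_Rintegral => //.
- have [//] := Cintable_S sigma (bdmM bh (bdm_conj bg)).
- exact: (integrableZl mS 2^-1 (integrableD mS Jh Jg)).
move=> x Sx; rewrite (le_trans (ler_norm _))// (le_trans (Re_le_cabs _))//.
rewrite cabsM cabs_conj; set a := cabs _; set b := cabs _.
have : 0 <= l^-1 * (l * a - b) ^+ 2 by rewrite mulr_ge0 ?sqr_ge0// invr_ge0 ltW.
have -> : l^-1 * (l * a - b) ^+ 2 = l * a ^+ 2 - 2 * (a * b) + l^-1 * b ^+ 2.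
  by field; rewrite gt_eqF.
lra.
Qed.

Lemma normL2_op (s : R) (h : BorelCn R n -> C) : 0 <= s < 1 -> bdm S h ->
  normL2 (cauchy_op s h) =
  complex.Re (I (fun z => h z * (cauchy_op (s * s) h z)^*)).
Proof.
move=> s01 bh; have E := cauchy_op_adj s01 bh (bdm_op s01 bh).
apply: (etrans (congr1 (@complex.Re R) (etrans (esym (normL2E _)) E))).
apply: (congr1 (@complex.Re R)); apply: eq_Cint => z Sz.
exact: (congr1 (fun c : C => h z * c^*) (cauchy_op_comp s01 s01 bh Sz)).
Qed.

Lemma cauchy_op_L2 (s : R) (h : BorelCn R n -> C) : 0 <= s < 1 -> bdm S h ->
  normL2 (cauchy_op s h) <= normL2 h.
Proof.
move=> s01 bh; have [s0 s1] := andP s01.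
pose sj j := s ^+ (2 ^ j).
have sj0 j : 0 <= sj j by exact: exprn_ge0.
have sjs j : sj j <= s.
  rewrite /sj -{2}(expr1 s) ler_wiXn2l// ?ltW// expn_gt0//.
have sj01 j : 0 <= sj j < 1 by rewrite sj0 (le_lt_trans (sjs j)).
have [_ [L hL]] := bh.
have p : 0 < 1 - s by rewrite subr_gt0.
have -> : s = sj 0%N by rewrite /sj expn0 expr1.
(* All exponents [sj j] stay below s, so the sup bound of the kernel at radius s bounds the whole
   sequence. *)
apply: (@bounded_square_growth R (fun j => normL2 (cauchy_op (sj j) h)) _
  (((1 - s) ^- n * `|L|) ^+ 2)).
- by apply: Rintegral_ge0 => x _; rewrite sqr_ge0.
- move=> j; rewrite -[leRHS]Rintegral_S_cst; apply: le_Rintegral => //.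
  + by apply: integrable_cabs_sqr; exact: bdm_op.
  + exact: integrable_sphere_cst.
  move=> z Sz; rewrite lerXn2r ?nnegrE ?cabs_ge0 ?mulr_ge0 ?invr_ge0 ?exprn_ge0 ?(ltW p)//.
  have hL' x : S x -> cabs (h x) <= `|L|.
    by move=> Sx; rewrite (le_trans (hL _ Sx))// ler_norm.
  rewrite (le_trans (cabs_cauchy_op_le (sj01 j) bh hL' Sz))// ler_wpM2r//.
  have pj : 0 < 1 - sj j by rewrite subr_gt0; have /andP[] := sj01 j.
  rewrite lef_pV2 ?posrE ?exprn_gt0// lerXn2r ?nnegrE ?(ltW p) ?(ltW pj)//.
  by rewrite lerD2l lerN2.
- move=> j l l0.
  have bA := bdm_op (sj01 j) bh.
  have bA' := bdm_op (sj01 j.+1) bh.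
  apply: (le_trans _ (Re_Cint_young bh bA' l0)).
  have e2 : sj j.+1 = sj j * sj j by rewrite /sj -expr2 -exprM expnS mulnC.
  by rewrite (normL2_op (sj01 j) bh) e2.
Qed.

End CauchyOperator.

Section RealPowers.
Context {R : realType}.
Implicit Types a b r : R.

Lemma real_complexB a b : (a - b)%:C = a%:C - b%:C :> Cplx R.
Proof. exact: rmorphB. Qed.

Lemma powR_mono a b r : 0 <= a -> a <= b -> 0 <= r -> a `^ r <= b `^ r.
Proof. by move=> a0 ab r0; apply: ge0_ler_powR; rewrite ?nnegrE//; lra. Qed.

Lemma powRN_anti a b r : 0 < a -> a <= b -> 0 <= r -> b `^ (- r) <= a `^ (- r).
Proof.
move=> a0 ab r0; have b0 := lt_le_trans a0 ab.
by rewrite !powRN lef_pV2 ?posrE ?powR_gt0// powR_mono// ltW.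
Qed.

Lemma powR_lt1 a r : 1 < a -> r < 0 -> a `^ r < 1.
Proof.
move=> a1 r0; rewrite /powR gt_eqF; last exact: lt_trans a1.
by rewrite -expR0 ltr_expR nmulr_rlt0// ln_gt0.
Qed.

End RealPowers.

Section RintegralMonotone.
Context d (T : measurableType d) (R : realType).
Variable mu : {measure set T -> \bar R}.

Lemma Rintegral_subset (A B : set T) (f : T -> R) :
  measurable A -> measurable B -> A `<=` B -> Rintegrable mu B f ->
  (forall x, B x -> 0 <= f x) ->
  \int[mu]_(x in A) f x <= \int[mu]_(x in B) f x.
Proof.
move=> mA mB AB If f0.
have IA : Rintegrable mu A f by apply: integrableS If.
rewrite /Rintegral fine_le ?(integrable_fin_num _ If) ?(integrable_fin_num _ IA)//.
by apply: ge0_subset_integral => //; have /measurable_int := If.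
Qed.

Lemma Rintegral_union (A B : set T) (f : T -> R) :
  measurable A -> measurable B -> A `&` B = set0 ->
  Rintegrable mu (A `|` B) f ->
  \int[mu]_(x in A `|` B) f x = \int[mu]_(x in A) f x + \int[mu]_(x in B) f x.
Proof. by move=> mA mB AB If; apply: Rintegral_setU => //; apply/disj_set2P. Qed.

End RintegralMonotone.

(** * Volumes of nonisotropic balls *)

Section BallVolume.
Context {R : realType} {n : nat}.
Local Notation C := (Cplx R).
Implicit Types (z w v x xi : Cn R n) (c : C).
Hypothesis n0 : (0 < n)%N.
Variable sigma : probability (BorelCn R n) R.
Hypothesis hsigma : rotation_invariant_sphere_measure sigma.
Local Notation S := (@unit_sphere R n : set (BorelCn R n)).
Let mS : measurable S := @measurable_sphere R n.
Local Notation Q xi r := (nball xi r : set (BorelCn R n)).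

Definition vol xi (r : R) : R := fine (sigma (Q xi r)).

Definition nfar xi (r : R) : set (BorelCn R n) :=
  [set x | unit_sphere (x : Cn R n) /\ r < ndist x xi].

Lemma nfarE xi r : nfar xi r = S `\` (Q xi r).
Proof.
apply/seteqP; split => x [Sx]; rewrite /nball/=.
  by move=> h; split => //= -[_]; rewrite leNgt h.
by move=> h; split => //; rewrite ltNge; apply/negP => h'; apply: h.
Qed.

Lemma measurable_nfar xi r : measurable (nfar xi r).
Proof. by rewrite nfarE; apply: measurableD => //; exact: measurable_nball. Qed.

Lemma nfar_split xi (r r' : R) : r <= r' ->
  nfar xi r = (nfar xi r `&` (Q xi r')) `|` nfar xi r'.
Proof.
move=> rr'; apply/seteqP; split => x.
  move=> [Sx xr]; have [h|h] := leP (ndist x xi) r'.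
    by left; split.
  by right.
by move=> [[]//|[Sx h]]; split => //; exact: le_lt_trans h.
Qed.

Lemma vol_ge0 xi r : 0 <= vol xi r.
Proof. by rewrite fine_ge0. Qed.

Lemma vol_le1 xi r : vol xi r <= 1.
Proof.
rewrite -lee_fin fineK; last first.
  by rewrite fin_num_measure//; exact: measurable_nball.
by apply: probability_le1; exact: measurable_nball.
Qed.

(** Cauchy's formula with both points equal to s xi. *)
Lemma kernel_sqr_integral xi (s : R) : 0 <= s < 1 -> unit_sphere xi ->
  \int[sigma]_(x in S) (cabs (cauchy_kernel (rscale s xi) x) ^+ 2) =
  (1 - s ^+ 2) ^- n.
Proof.
move=> /andP[s0 s1] Sxi.
have e : enorm (rscale s xi) = s by rewrite enorm_rscale Sxi mulr1 ger0_norm.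
have := @cauchy_formula R n n0 sigma hsigma (rscale s xi) (rscale s xi).
rewrite e hdotzz e => /(_ s1 s1) E.
apply: (@complexI R); rewrite -(normL2E hsigma (fun x => cauchy_kernel (rscale s xi) x)).
transitivity ((1 - (s ^+ 2)%:C) ^- n : C); last first.
  have -> : 1 - (s ^+ 2)%:C = (1 - s ^+ 2)%:C :> C by rewrite real_complexB.
  by rewrite real_complexV real_complexX.
rewrite -E; apply: eq_Cint => x _; congr (_ * _).
by rewrite /cauchy_kernel conjV conjX conjD conjN conj1 hdotC.
Qed.

Lemma integrable_kernel_sqr xi (s : R) : 0 <= s < 1 -> unit_sphere xi ->
  Rintegrable sigma S
   (fun x : BorelCn R n => cabs (cauchy_kernel (rscale s xi) x) ^+ 2).
Proof. by move=> s01 Sxi; apply: integrable_cabs_sqr; exact: bdm_cauchy_kernel. Qed.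

Lemma cabs_kernel_sqr xi (s : R) x :
  cabs (cauchy_kernel (rscale s xi) x) ^+ 2 = cabs (1 - hdot (rscale s xi) x) ^- (2 * n).
Proof. by rewrite /cauchy_kernel cabsV cabsX exprVn -exprM mulnC. Qed.

(** At the point (1 - r) xi the squared kernel is at least (2 r)^(-2 n) on the ball, while its total
    integral is (r (2 - r))^-n. *)
Lemma vol_upper xi (r : R) : unit_sphere xi -> 0 < r -> vol xi r <= 4 ^+ n * r ^+ n.
Proof.
move=> Sxi r0; have [r1|r1] := leP 1 r.
  rewrite (le_trans (vol_le1 _ _))// -exprMn exprn_ege1//; lra.
have s01 : 0 <= 1 - r < 1 by apply/andP; split; lra.
have mB := @measurable_nball R n xi r.
have BS : (Q xi r) `<=` S by move=> x [].
have I1 := integrable_kernel_sqr s01 Sxi.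
have h1 : (2 * r) ^- (2 * n) * vol xi r <=
    \int[sigma]_(x in S) (cabs (cauchy_kernel (rscale (1 - r) xi) x) ^+ 2).
  apply: (@le_trans _ _ (\int[sigma]_(x in Q xi r)
      (cabs (cauchy_kernel (rscale (1 - r) xi) x) ^+ 2))); last first.
    by apply: Rintegral_subset => // x _; rewrite sqr_ge0.
  rewrite /vol -(Rintegral_cst sigma mB); apply: le_Rintegral => //.
  - exact: integrable_sphere_cst.
  - by apply: integrableS I1.
  move=> x [Sx xr]; rewrite cabs_kernel_sqr.
  have p : 0 < cabs (1 - hdot (rscale (1 - r) xi) x).
    apply: (@lt_le_trans _ _ r) => //.
    have := @cabs_1B_ge R (hdot (rscale (1 - r) xi) x) (1 - r).
    have -> : 1 - (1 - r) = r by ring.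
    apply; rewrite (le_trans (hdot_CS _ _))// enorm_rscale Sxi Sx !mulr1.
    by rewrite ger0_norm//; lra.
  rewrite lef_pV2 ?posrE ?exprn_gt0 ?mulr_gt0//.
  rewrite lerXn2r ?nnegrE ?cabs_ge0 ?mulr_ge0// ?(ltW r0)//.
  have -> : 1 - hdot (rscale (1 - r) xi) x =
     (1 - hdot xi (x : Cn R n)) + r%:C * hdot xi (x : Cn R n).
    by rewrite rscaleE hdotZl real_complexB; ring.
  rewrite (le_trans (cabsD _ _))// cabsM cabs_real (ger0_norm (ltW r0)).
  have := sphere_hdot Sxi Sx; rewrite ndistC /ndist in xr => h.
  have : r * cabs (hdot xi (x : Cn R n)) <= r * 1 by rewrite ler_wpM2l// ltW.
  lra.
rewrite kernel_sqr_integral// in h1.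
have p : 0 < (2 * r) ^+ (2 * n) by rewrite exprn_gt0// mulr_gt0.
rewrite mulrC ler_pdivrMr// in h1.
apply: (le_trans h1).
have -> : 1 - (1 - r) ^+ 2 = r * (2 - r) by ring.
have q : 0 < r * (2 - r) by rewrite mulr_gt0//; lra.
rewrite mulrC ler_pdivrMr ?exprn_gt0// exprM -!exprMn.
apply: lerXn2r; rewrite ?nnegrE ?sqr_ge0//; first by apply: mulr_ge0; [apply: mulr_ge0 => //; exact: ltW|exact: ltW].
nra.
Qed.

Lemma integrable_nfar_power xi (b r : R) : unit_sphere xi -> 0 < r -> 0 <= b ->
  Rintegrable sigma (nfar xi r)
    (fun x : BorelCn R n => ndist x xi `^ (- b)).
Proof.
move=> Sxi r0 b0.
apply: (@integrable_bounded _ _ _ _ _ _ (r `^ (- b))).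
- exact: measurable_nfar.
- by apply: sphere_fin; exact: measurable_nfar.
- apply: (measurableT_comp (measurable_powR _)) => //; exact: measurable_ndist.
move=> x [Sx xr]; rewrite ger0_norm ?powR_ge0//.
by apply: powRN_anti => //; exact: ltW.
Qed.

(** Dyadic shells: r < d <= 2 r contributes at most 8^n r^(n - b), and the next scale is smaller by
    the ratio 2^(n - b) < 1. The induction goes down from large radii, the region being empty once r
    >= 2. *)
Lemma nfar_power_integral (b : R) : n%:R < b -> exists K : R, 0 < K /\
  forall xi (r : R), unit_sphere xi -> 0 < r ->
  \int[sigma]_(x in nfar xi r) (ndist x xi `^ (- b)) <= K * r `^ (n%:R - b).
Proof.
move=> nb.
have b0 : 0 <= b by rewrite (le_trans _ (ltW nb)).
have q1 : 2 `^ (n%:R - b) < 1 :> R.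
  by apply: powR_lt1; lra.
(* The sum of the geometric series, that is the solution of K = 8^n + K 2^(n - b). *)
pose K := 8 ^+ n / (1 - 2 `^ (n%:R - b)).
have p : 0 < 1 - 2 `^ (n%:R - b) by rewrite subr_gt0.
exists K; split; first by rewrite divr_gt0// exprn_gt0.
move=> xi r Sxi r0.
have [N rN] : exists N, 2 <= 2 ^+ N * r.
  have [] := archi_boundP (normr_ge0 (2 / r)); set N := Num.bound _ => hN.
  exists N; rewrite -ler_pdivrMr// (le_trans (ler_norm _))// (le_trans (ltW hN))//.
  by rewrite -natrX ler_nat ltnW// ltn_expl.
elim: N r r0 rN => [|N IH] r r0 rN.
  rewrite (_ : nfar xi r = set0); last first.
    rewrite -subset0 => x [Sx] /=; rewrite expr0 mul1r in rN.
    have := ndist_le2 Sx Sxi => h1 h2; lra.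
  by rewrite Rintegral_set0 mulr_ge0 ?powR_ge0// divr_ge0 ?exprn_ge0// ltW.
have r2 : 0 < 2 * r by rewrite mulr_gt0.
have r2N : 2 <= 2 ^+ N * (2 * r) by rewrite mulrA -exprSr.
have h := IH _ r2 r2N.
have le2 : r <= 2 * r by lra.
have mF := measurable_nfar xi r.
have mA : measurable (nfar xi r `&` Q xi (2 * r)).
  by apply: measurableI => //; exact: measurable_nball.
have If := integrable_nfar_power Sxi r0 b0.
rewrite (nfar_split xi le2) Rintegral_union//; last 3 first.
- exact: measurable_nfar.
- rewrite -subset0 => x [[_ [_ /= h1]] [_ h2]]; move: h1; rewrite leNgt h2//.
- by rewrite -nfar_split.
have h1 : \int[sigma]_(x in nfar xi r `&` Q xi (2 * r))
    (ndist x xi `^ (- b)) <= 8 ^+ n * r `^ (n%:R - b).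
  apply: (@le_trans _ _ (\int[sigma]_(x in nfar xi r `&` Q xi (2 * r))
      (r `^ (- b)))).
    apply: le_Rintegral => //.
    - by apply: integrableS If => // x [].
    - exact: integrable_sphere_cst.
    move=> x [[Sx xr] _]; apply: powRN_anti => //; exact: ltW.
  rewrite Rintegral_cst//.
  have v1 : fine (sigma (nfar xi r `&` Q xi (2 * r))) <= vol xi (2 * r).
    have mB := @measurable_nball R n xi (2 * r).
    rewrite fine_le ?fin_num_measure// le_measure ?inE//.
  have v2 := vol_upper Sxi r2.
  rewrite powRD; last by rewrite (gt_eqF r0) implybT.
  rewrite powR_mulrn ?(ltW r0)// mulrA [leRHS]mulrC ler_wpM2l ?powR_ge0//.
  rewrite (le_trans v1)// (le_trans v2)// exprMn mulrA -exprMn.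
  by have -> : 4 * 2 = 8 :> R by ring.
have e : (2 * r) `^ (n%:R - b) = 2 `^ (n%:R - b) * r `^ (n%:R - b).
  by rewrite powRM// ltW.
rewrite e in h.
have -> : K * r `^ (n%:R - b) = 8 ^+ n * r `^ (n%:R - b) +
    K * (2 `^ (n%:R - b) * r `^ (n%:R - b)).
  by rewrite /K; field; rewrite gt_eqF.
exact: lerD.
Qed.

(* With t = r / A the kernel at (1 - t) xi has L^2 mass at least (2 t)^-n, at
   most half of it off the ball, and its square is at most t^(-2 n) on the ball. *)
Lemma vol_lower : exists c : R, 0 < c /\
  forall xi (r : R), unit_sphere xi -> 0 < r <= 1 -> c * r ^+ n <= vol xi r.
Proof.
have n2 : n%:R < (2 * n)%:R :> R by rewrite ltr_nat; lia.
have [K [K0 HK]] := nfar_power_integral n2.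
(* In [h4] the tail is at most half of the mass as soon as A^n >= 2 * 8^n * K; the summand 1 gives A
   >= 1, hence A^n >= A. *)
pose A := 2 * 8 ^+ n * K + 1.
have e8 : 0 < (8 : R) ^+ n by rewrite exprn_gt0.
have A1 : 1 <= A by rewrite /A lerDr !mulr_ge0 ?(ltW K0) ?(ltW e8).
have A0 : 0 < A by exact: lt_le_trans A1.
have AA : A <= A ^+ n by rewrite -{1}(expr1 A) ler_weXn2l.
exists (2 ^- n / 2 / A ^+ n); split.
  by rewrite !divr_gt0 ?invr_gt0 ?exprn_gt0.
move=> xi r Sxi /andP[r0 r1].
pose t := r / A.
have t0 : 0 < t by rewrite divr_gt0.
have t1 : t <= 1 by rewrite /t ler_pdivrMr// mul1r (le_trans r1).
have rE : r = A * t by rewrite /t mulrC divfK ?gt_eqF.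
clearbody t.
have s01 : 0 <= 1 - t < 1 by apply/andP; split; lra.
have Ik := integrable_kernel_sqr s01 Sxi.
have mB := @measurable_nball R n xi r.
have mF := measurable_nfar xi r.
have SE : S = Q xi r `|` nfar xi r.
  apply/seteqP; split => x.
    move=> Sx; have [h|h] := leP (ndist x xi) r; first by left.
    by right.
  by case=> -[].
have E := kernel_sqr_integral s01 Sxi.
rewrite SE Rintegral_union -?SE// in E; last first.
  by rewrite -subset0 => x [[_ /= h1] [_ h2]]; move: h1; rewrite leNgt h2.
have kge x : S x -> t <= cabs (1 - hdot (rscale (1 - t) xi) x).
  move=> Sx; have := @cabs_1B_ge R (hdot (rscale (1 - t) xi) x) (1 - t).
  have -> : 1 - (1 - t) = t by ring.
  apply; rewrite (le_trans (hdot_CS _ _))// enorm_rscale Sxi Sx !mulr1.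
  by rewrite ger0_norm//; lra.
have h1 : \int[sigma]_(x in Q xi r)
    (cabs (cauchy_kernel (rscale (1 - t) xi) x) ^+ 2) <= t ^- (2 * n) * vol xi r.
  rewrite /vol -(Rintegral_cst sigma mB); apply: le_Rintegral => //.
  - by apply: integrableS Ik => // x [].
  - exact: integrable_sphere_cst.
  move=> x [Sx _]; rewrite cabs_kernel_sqr; have h := kge _ Sx.
  rewrite lef_pV2 ?posrE ?exprn_gt0//; last exact: lt_le_trans h.
  by apply: lerXn2r; rewrite ?nnegrE ?cabs_ge0// ltW.
have h2 : \int[sigma]_(x in nfar xi r)
    (cabs (cauchy_kernel (rscale (1 - t) xi) x) ^+ 2) <=
    4 ^+ n * (K * r `^ (n%:R - (2 * n)%:R)).
  have If := integrable_nfar_power Sxi r0 (ler0n R (2 * n)).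
  apply: (@le_trans _ _ (4 ^+ n * \int[sigma]_(x in nfar xi r)
      (ndist x xi `^ (- (2 * n)%:R)))); last first.
    by rewrite ler_wpM2l ?exprn_ge0// HK.
  rewrite -RintegralZl//; apply: le_Rintegral => //.
  - by apply: integrableS Ik => // x [].
  - by apply: eq_integrable (integrableZl mF (4 ^+ n) If).
  move=> x [Sx xr]; rewrite cabs_kernel_sqr powRN powR_mulrn ?cabs_ge0//.
  have h := kge _ Sx; have d0 := lt_trans r0 xr.
  have c0 := lt_le_trans t0 h.
  rewrite ler_pdivlMr ?exprn_gt0// mulrC ler_pdivrMr ?exprn_gt0//.
  have -> : (4 : R) ^+ n = 2 ^+ (2 * n) by rewrite exprM; congr (_ ^+ _); ring.
  rewrite -exprMn; apply: lerXn2r; rewrite ?nnegrE ?cabs_ge0 ?mulr_ge0 ?cabs_ge0//.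
  have -> : ndist x xi = cabs (1 - hdot (rscale (1 - t) xi) x -
      t%:C * hdot xi (x : Cn R n)).
    rewrite ndistC /ndist rscaleE hdotZl real_complexB; congr cabs; ring.
  rewrite (le_trans (cabsB _ _))// cabsM cabs_real (ger0_norm (ltW t0)).
  have : t * cabs (hdot xi (x : Cn R n)) <= t * 1.
    by rewrite ler_wpM2l ?(ltW t0)// sphere_hdot.
  lra.
have h3 : (2 * t) ^- n <= (1 - (1 - t) ^+ 2) ^- n.
  have -> : 1 - (1 - t) ^+ 2 = t * (2 - t) by ring.
  have q : 0 < t * (2 - t) by rewrite mulr_gt0//; lra.
  rewrite lef_pV2 ?posrE ?exprn_gt0 ?mulr_gt0//; last by lra.
  apply: lerXn2r; [by rewrite nnegrE ltW|by rewrite nnegrE mulr_ge0// ltW|nra].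
rewrite -E in h3.
have h4 : 4 ^+ n * (K * r `^ (n%:R - (2 * n)%:R)) <= (2 * t) ^- n / 2.
  have -> : n%:R - (2 * n)%:R = - n%:R :> R by rewrite natrM; ring.
  rewrite powRN powR_mulrn ?(ltW r0)// rE !exprMn.
  rewrite [X in _ <= X](_ : _ = 4 ^+ n * ((8 ^+ n)^-1 / 2 / t ^+ n)); last first.
    have -> : (8 : R) ^+ n = 2 ^+ n * 4 ^+ n by rewrite -exprMn; congr (_ ^+ _); ring.
    by field; rewrite !expf_neq0 ?gt_eqF.
  rewrite ler_wpM2l ?exprn_ge0// invfM mulrA ler_wpM2r ?invr_ge0 ?exprn_ge0 ?(ltW t0)//.
  rewrite ler_pdivrMr ?exprn_gt0// -invfM mulrC ler_pdivlMr ?mulr_gt0//.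
  apply: le_trans AA; rewrite /A; nra.
have h5 : (2 * t) ^- n / 2 <= t ^- (2 * n) * vol xi r by lra.
have t2 : 0 < t ^+ (2 * n) by rewrite exprn_gt0.
have : t ^+ (2 * n) * ((2 * t) ^- n / 2) <= vol xi r.
  by rewrite -ler_pdivlMl.
apply: le_trans; rewrite rE !exprMn le_eqVlt; apply/orP; left; apply/eqP.
rewrite mulnC exprM; field.
by rewrite !expf_neq0 ?gt_eqF.
Qed.

End BallVolume.

(** Induction on n: passing to n + 1 divides the remainder by 1 - x, of modulus at least 1/2, and
    adds (n + 1) x^2. *)
Lemma power_taylor (R : realType) n : exists K : R, 0 <= K /\
  forall x : Cplx R, cabs x <= 2^-1 ->
    cabs ((1 - x) ^- n - 1 - n%:R * x) <= K * cabs x ^+ 2.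
Proof.
elim: n => [|n [K [K0 IH]]].
  exists 0; split => // x _; rewrite expr0 invr1 subrr mul0r subr0 cabs0 mul0r//.
exists (2 * K + 2 * n.+1%:R); split; first by rewrite addr_ge0// mulr_ge0.
move=> x x2; have h := IH x x2.
have p : 2^-1 <= cabs (1 - x) by have := cabs_1B_ge x2; lra.
have p0 : 0 < cabs (1 - x) by apply: lt_le_trans p; rewrite invr_gt0.
have nz : 1 - x != 0 by apply/eqP => E; rewrite E cabs0 ltxx in p0.
have -> : (1 - x) ^- n.+1 - 1 - n.+1%:R * x =
    (1 - x)^-1 * (((1 - x) ^- n - 1 - n%:R * x) + n.+1%:R * x ^+ 2).
  rewrite exprS invfM -[n.+1]addn1 natrD; field.
  by rewrite nz expf_neq0.
rewrite cabsM cabsV mulrC ler_pdivrMr//.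
rewrite (le_trans (cabsD _ _))// cabsM cabs_nat cabsX.
have q : 0 <= cabs x ^+ 2 by exact: sqr_ge0.
have : (2 * K + 2 * n.+1%:R) * cabs x ^+ 2 * 2^-1 <=
    (2 * K + 2 * n.+1%:R) * cabs x ^+ 2 * cabs (1 - x).
  by rewrite ler_wpM2l// mulr_ge0// addr_ge0// mulr_ge0.
lra.
Qed.

Lemma le_mul_chain (R : realType) (H A B S2 c d' de : R) :
  H <= A * B -> S2 * A <= 2 * c -> B <= 2 * d' ->
  0 <= S2 -> 0 <= A -> 0 <= B -> c <= de -> S2 * H <= 4 * de * d'.
Proof.
move=> k1 k2 k3 k4 k5 k6 k7.
have a1 : S2 * H <= (S2 * A) * B by rewrite -mulrA ler_wpM2l.
have a2 : (S2 * A) * B <= (2 * de) * (2 * d').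
  by apply: ler_pM => //; [exact: mulr_ge0|lra].
lra.
Qed.

(** For [kernel_taylor]: 2 t^2 + 2 g^2 <= (8 + 1/32) de d, which is where 9 comes from. *)
Lemma le_sqr_sum (R : realType) (t g de d : R) :
  t ^+ 2 <= 4 * de * d -> g ^+ 2 <= de ^+ 2 -> de ^+ 2 * 64 <= de * d ->
  0 <= de * d -> (t + g) ^+ 2 <= 9 * de * d.
Proof.
move=> a b c d0; have e : (t + g) ^+ 2 = 2 * t ^+ 2 + 2 * g ^+ 2 - (t - g) ^+ 2 by ring.
have := sqr_ge0 (t - g); rewrite e; lra.
Qed.

(** * Local behaviour of the outer logarithm *)

Section KernelTaylor.
Context {R : realType} {n : nat}.
Local Notation C := (Cplx R).
Hypothesis n0 : (0 < n)%N.
Implicit Types z x : Cn R n.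

(** The component orthogonal to [e1]. On the sphere it has size of order d(z, 1)^(1/2), while 1 -
    <z, 1> has size d(z, 1): it is the only part of z whose first-order effect on the kernel is too
    large to be an error. *)
Definition tang z : Cn R n := z - hdot z e1 *: e1.

Lemma hdot_tang z x : hdot (tang z) x = hdot z x - hdot z e1 * hdot e1 x.
Proof. by rewrite /tang hdotBl hdotZl. Qed.

Lemma hdot_tang2 z x : hdot (tang z) (tang x) = hdot (tang z) x.
Proof.
by rewrite [in LHS]/tang hdotBr hdotZr [hdot (tang z) e1]hdot_tang hdot_e1//; ring.
Qed.

Lemma enorm_tang_sqr z : enorm (tang z) ^+ 2 = enorm z ^+ 2 - cabs (hdot z e1) ^+ 2.
Proof.
apply: (@complexI R); rewrite -hdotzz hdot_tang2 hdot_tang real_complexB -hdotzz.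
by rewrite -mulC_conj hdotC.
Qed.

(** Cauchy-Schwarz between the orthogonal components of s z and of x; each satisfies a^2 (1 - b^2)
    <= 2 (1 - a b), where b is the modulus of the first coordinate. *)
Lemma cabs_tang_le (s : R) z x (de : R) : unit_sphere z -> unit_sphere x ->
  0 <= s <= 1 -> cabs (1 - s%:C * hdot z e1) <= de ->
  cabs (s%:C * hdot (tang z) x) ^+ 2 <= 4 * de * ndist x e1.
Proof.
move=> Sz Sx /andP[s0 s1] zd.
have e x' : unit_sphere x' -> forall a : R, 0 <= a <= 1 ->
    a ^+ 2 * enorm (tang x') ^+ 2 <= 2 * cabs (1 - a%:C * hdot x' e1).
  move=> Sx' a /andP[a0 a1]; rewrite enorm_tang_sqr Sx' expr1n.
  have := ler_dist_cabs 1 (a%:C * hdot x' e1).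
  rewrite cabs1 cabsM cabs_real (ger0_norm a0) ler_norml => /andP[_ h].
  have S1 : unit_sphere (e1 : Cn R n) by exact: enorm_e1.
  have h1 := sphere_hdot Sx' S1; have h0 := cabs_ge0 (hdot x' e1).
  have : a ^+ 2 <= 1 by rewrite expr_le1.
  have : a * cabs (hdot x' e1) <= 1 by rewrite mulr_ile1.
  have : 0 <= a * cabs (hdot x' e1) by rewrite mulr_ge0.
  set b := cabs (hdot x' e1) in h h0 h1 *; nra.
rewrite -hdot_tang2 cabsM cabs_real (ger0_norm s0) exprMn.
have h : cabs (hdot (tang z) (tang x)) ^+ 2 <= enorm (tang z) ^+ 2 * enorm (tang x) ^+ 2.
  rewrite -exprMn; apply: lerXn2r; rewrite ?nnegrE ?cabs_ge0 ?mulr_ge0 ?enorm_ge0//.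
  exact: hdot_CS.
have h1 := e z Sz s; rewrite s0 s1 in h1; have {}h1 := h1 isT.
have h2 := e x Sx 1; rewrite ler01 lexx in h2; have {}h2 := h2 isT.
rewrite expr1n !mul1r -/(ndist x e1) in h2.
exact: (le_mul_chain h h1 h2 (sqr_ge0 _) (sqr_ge0 _) (sqr_ge0 _) zd).
Qed.

(** With a = 1 - <1, x>, write 1 - <s z, x> = a (1 - b / a) and b = t + g. The tangential part t is
    O((de d)^(1/2)) and is kept to first order; g is O(de), and |b / a|^2 = O(de / d), so both enter
    the error. The ratio 64 ensures |b / a| <= 1/2. *)
Lemma kernel_taylor : exists K : R, 0 < K /\
  forall (s : R) z x (de : R), unit_sphere z -> unit_sphere x -> 0 <= s <= 1 ->
  0 < de -> cabs (1 - s%:C * hdot z e1) <= de -> 64 * de <= ndist x e1 ->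
  cabs (cauchy_kernel (rscale s z) x - cauchy_kernel e1 x -
     n%:R * (s%:C * hdot (tang z) x) * (1 - hdot e1 x) ^- n.+1) <=
  K * de * ndist x e1 ^- n.+1.
Proof.
have [K [K0 HK]] := power_taylor R n.
exists (9 * K + n%:R); split.
  by rewrite ltr_wpDl ?ltr0n// mulr_ge0.
move=> s z x de Sz Sx s01 de0 zd dx.
have S1 : unit_sphere (e1 : Cn R n) by exact: enorm_e1.
set d := ndist x e1 in dx *.
have d0 : 0 < d by apply: lt_le_trans dx; rewrite mulr_gt0.
set a := 1 - hdot e1 x.
have ad : cabs a = d by rewrite /d ndistC.
have a0 : a != 0 by apply/eqP => E; rewrite E cabs0 in ad; rewrite -ad ltxx in d0.
pose t := s%:C * hdot (tang z) x.
pose g := (s%:C * hdot z e1 - 1) * hdot e1 x.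
pose b := t + g.
have tt : cabs t ^+ 2 <= 4 * de * d by exact: cabs_tang_le.
have gg : cabs g <= de.
  rewrite /g cabsM -[leRHS]mulr1 ler_pM ?cabs_ge0//; last exact: sphere_hdot.
  by rewrite -opprB cabsN.
have bb : cabs b ^+ 2 <= 9 * de * d.
  apply: (@le_trans _ _ ((cabs t + cabs g) ^+ 2)).
    by apply: lerXn2r; rewrite ?nnegrE ?addr_ge0 ?cabs_ge0 ?cabsD.
  have t0 := cabs_ge0 t; have g0 := cabs_ge0 g.
  have g2 : cabs g ^+ 2 <= de ^+ 2 by apply: lerXn2r; [exact: g0|exact: ltW|exact: gg].
  have dd : de ^+ 2 * 64 <= de * d by rewrite expr2 -mulrA ler_pM2l// mulrC.
  exact: le_sqr_sum tt g2 dd (ltW (mulr_gt0 de0 d0)).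
have bd : cabs b <= d / 2.
  rewrite -(ler_pXn2r (n := 2))// ?nnegrE ?cabs_ge0 ?divr_ge0 ?(ltW d0)//.
  apply: (le_trans bb); rewrite expr_div_n expr2.
  have : 64 * de * d <= d * d by rewrite ler_pM2r.
  have : 0 < de * d by rewrite mulr_gt0.
  lra.
have E1 : 1 - hdot (rscale s z) x = a * (1 - b / a).
  rewrite mulrBr mulr1 mulrC divfK// /b /t /g rscaleE hdotZl hdot_tang /a; ring.
rewrite -/t; clearbody g t.
have dn0 : d != 0 by rewrite gt_eqF.
have yb : cabs (b / a) <= 2^-1.
  by rewrite cabsM cabsV ad ler_pdivrMr// mulrC.
have H := HK _ yb.
have ne : 1 - b / a != 0.
  apply/eqP => E; have := cabs_1B_ge yb; rewrite E cabs0; lra.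
have -> : cauchy_kernel (rscale s z) x - cauchy_kernel e1 x - n%:R * t * a ^- n.+1 =
   a ^- n * ((1 - b / a) ^- n - 1 - n%:R * (b / a)) + n%:R * g * a ^- n.+1.
  rewrite /cauchy_kernel E1 -/a exprMn invfM exprS invfM /b; field.
  by rewrite a0 !expf_neq0//.
rewrite (le_trans (cabsD _ _))// !cabsM !cabsV !cabsX ad cabs_nat.
have dn : 0 <= d ^- n by rewrite invr_ge0 exprn_ge0 ?(ltW d0).
have -> : (9 * K + n%:R) * de * d ^- n.+1 =
    d ^- n * (K * (9 * de * d / d ^+ 2)) + n%:R * de * d ^- n.+1.
  by rewrite exprS; field; rewrite ?expf_neq0 ?dn0.
apply: lerD.
  rewrite ler_wpM2l// (le_trans H)// ler_wpM2l// cabsM cabsV ad exprMn exprVn.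
  by rewrite ler_wpM2r// invr_ge0 exprn_ge0 ?(ltW d0).
by rewrite ler_wpM2r ?invr_ge0 ?exprn_ge0 ?(ltW d0)// ler_wpM2l.
Qed.

End KernelTaylor.

Section CintUnion.
Context d (T : measurableType d) (R : realType).
Variable mu : {measure set T -> \bar R}.

Lemma Cint_union (A B : set T) (f : T -> Cplx R) :
  measurable A -> measurable B -> A `&` B = set0 -> Cintable mu (A `|` B) f ->
  Cint mu (A `|` B) f = Cint mu A f + Cint mu B f.
Proof.
move=> mA mB AB [f1 f2]; apply: Cext; rewrite ?cReD ?cImD /=.
  exact: (Rintegral_union mA mB AB f1).
exact: (Rintegral_union mA mB AB f2).
Qed.

Lemma eq_Cmeas (D : set T) (f g : T -> Cplx R) :
  (forall x, D x -> f x = g x) -> Cmeas D f -> Cmeas D g.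
Proof.
move=> fg [f1 f2]; split.
  by apply: eq_measurable_fun f1 => x /[!inE] Dx; rewrite fg.
by apply: eq_measurable_fun f2 => x /[!inE] Dx; rewrite fg.
Qed.

Lemma CmeasS (A B : set T) (f : T -> Cplx R) :
  measurable B -> A `<=` B -> Cmeas B f -> Cmeas A f.
Proof.
by move=> mB AB [f1 f2]; split; [exact: measurable_funS f1|exact: measurable_funS f2].
Qed.

Lemma CintableS (A B : set T) (f : T -> Cplx R) :
  measurable A -> measurable B -> A `<=` B -> Cintable mu B f -> Cintable mu A f.
Proof. by move=> mA mB AB [f1 f2]; split; [apply: integrableS f1|apply: integrableS f2]. Qed.

Lemma Cintable_realM (D : set T) (k : T -> Cplx R) (G : T -> R) (K : R) :
  measurable D -> Rintegrable mu D G -> Cmeas D k ->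
  (forall x, D x -> cabs (k x) <= K) -> Cintable mu D (fun x => k x * (G x)%:C).
Proof.
move=> mD IG mk kK; apply: (CintableMl mD _ mk kK); split => //=.
exact: integrable0.
Qed.

End CintUnion.

(** This identity and the next isolate the algebra of [core_estimate]: k and k1 are the kernels at s
    z and at 1, h the tangential pairing, P the power -(n + 1), g the density. The form is
    normalised with 2 n, whence s / 2. *)
Lemma taylor_split (R : realType) (n : nat) (k k1 s h P g : Cplx R) :
  k * g - k1 * g - s / 2 * (h * (2 * n%:R * (P * g))) = (k - k1 - n%:R * (s * h) * P) * g.
Proof. by field. Qed.

Lemma taylor_join (R : realType) (n : nat) (k k1 s h P g : Cplx R) :
  k * g = (k - k1 - n%:R * (s * h) * P) * g + k1 * g + s / 2 * (h * (2 * n%:R * (P * g))).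
Proof. by field. Qed.

(** * Approximation of the logarithm by a constant plus a tangential form *)

Section CoreEstimate.
Context {R : realType} {n : nat}.
Local Notation C := (Cplx R).
Implicit Types (z w v x xi : Cn R n) (c : C).
Hypothesis n0 : (0 < n)%N.
Variable sigma : probability (BorelCn R n) R.
Hypothesis hsigma : rotation_invariant_sphere_measure sigma.
Local Notation S := (@unit_sphere R n : set (BorelCn R n)).
Let mS : measurable S := @measurable_sphere R n.
Let S1 : unit_sphere (e1 : Cn R n) := enorm_e1 n0.

Definition ball1 (r : R) : set (BorelCn R n) := nball e1 r.
Definition far1 (r : R) : set (BorelCn R n) := nfar e1 r.

Lemma measurable_ball1 r : measurable (ball1 r). Proof. exact: measurable_nball. Qed.
Lemma measurable_far1 r : measurable (far1 r). Proof. exact: measurable_nfar. Qed.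

Lemma sphere_ball_far r : S = ball1 r `|` far1 r.
Proof.
apply/seteqP; split => x.
  move=> Sx; have [h|h] := leP (ndist x e1) r; first by left.
  by right.
by case=> -[].
Qed.

Lemma ball_far_disj r : ball1 r `&` far1 r = set0.
Proof. by rewrite -subset0 => x [[_ /= h1] [_ h2]]; move: h1; rewrite leNgt h2. Qed.

(** The exponent in the definition of [outer], with an arbitrary density in place of log |f|. *)
Definition outer_log (G : BorelCn R n -> R) (z : Cn R n) : C :=
  Cint sigma S (fun x => (2 * cauchy_kernel z x - 1) * (G x)%:C).

(* [|a| <= e / 2 + a^2 / (2 e)] turns the L^2 bound into an L^1 bound. *)
Lemma cauchy_op_L1_ball (s e : R) (G : BorelCn R n -> R) (r r' : R) :
  0 <= s < 1 -> 0 < e -> Rintegrable sigma S G ->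
  (forall x, ball1 r' x -> `|G x| <= e) ->
  Rintegrable sigma (ball1 r) (fun z : BorelCn R n =>
     cabs (Cint sigma (ball1 r') (fun x => cauchy_kernel (rscale s z) x * (G x)%:C))) /\
  \int[sigma]_(z in ball1 r)
     cabs (Cint sigma (ball1 r') (fun x => cauchy_kernel (rscale s z) x * (G x)%:C))
   <= e / 2 * (vol sigma e1 r + vol sigma e1 r').
Proof.
move=> s01 e0 IG Ge.
have mB := measurable_ball1 r; have mB' := measurable_ball1 r'.
have BS : ball1 r `<=` S by move=> x [].
have BS' : ball1 r' `<=` S by move=> x [].
(* [G] is only integrable, but its restriction extended by zero is bounded by [e]; the L^2
   contraction applies to it, and the integral over the ball becomes [cauchy_op]. *)
pose h (x : BorelCn R n) : C := ((G \_ (ball1 r')) x)%:C.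
have mG : measurable_fun S G by apply/measurable_EFinP; have /measurable_int := IG.
have hball x : ball1 r' x -> h x = (G x)%:C.
  by move=> Bx; rewrite /h patchE mem_set.
have hfar x : far1 r' x -> h x = 0.
  move=> [_ Fx]; rewrite /h patchE memNset//= => -[_].
  by rewrite /= leNgt Fx.
have he x : S x -> cabs (h x) <= e.
  move=> Sx; rewrite /h patchE; case: ifPn => [/[!inE] Bx|_].
    by rewrite cabs_real Ge.
  by rewrite cabs0 ltW.
have bh : bdm S h.
  split; last by exists e.
  apply: Cmeas_real; apply/(measurable_restrict _ mB' mS).
  by apply: measurable_funS mG => // x [].
have E z : S z -> Cint sigma (ball1 r') (fun x => cauchy_kernel (rscale s z) x * (G x)%:C) =
    cauchy_op sigma s h z.
  move=> Sz; rewrite /cauchy_op.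
  have Ik := Cintable_S sigma (bdmM (bdm_cauchy_kernel s01 Sz) bh).
  have := Ik; rewrite {1}(sphere_ball_far r') => Iu.
  rewrite (sphere_ball_far r') (Cint_union mB' (measurable_far1 r') (ball_far_disj r') Iu).
  rewrite [X in _ = _ + X](_ : _ = 0) ?addr0.
    by apply: eq_Cint => x Bx; rewrite hball.
  transitivity (Cint sigma (far1 r') (fun=> 0)).
    by apply: eq_Cint => x Fx; rewrite hfar// mulr0.
  by rewrite Cint_cst ?mul0r//; exact: measurable_far1.
have bA := bdm_op hsigma s01 bh.
have IA : Rintegrable sigma (ball1 r) (fun z => cabs (cauchy_op sigma s h z)).
  apply: (integrableS mS mB BS).
  exact: (Cintable_cabs mS (Cintable_S sigma bA)).
have EA : {in ball1 r, (EFin \o (fun z => cabs (cauchy_op sigma s h z))) =1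
   (EFin \o (fun z : BorelCn R n =>
     cabs (Cint sigma (ball1 r') (fun x => cauchy_kernel (rscale s z) x * (G x)%:C))))}.
  move=> z /[!inE] Bz; apply: (congr1 (fun c : C => (cabs c)%:E)).
  exact: (esym (E z (BS z Bz))).
split; first exact: eq_integrable EA IA.
apply: (@le_trans _ _ (\int[sigma]_(z in ball1 r) cabs (cauchy_op sigma s h z))).
  rewrite le_eqVlt; apply/orP; left; apply/eqP; apply: eq_Rintegral => z /[!inE] Bz.
  by rewrite E//; exact: BS.
have I2 := integrable_cabs_sqr sigma bA.
have I2B : Rintegrable sigma (ball1 r) (fun z => cabs (cauchy_op sigma s h z) ^+ 2).
  exact: integrableS I2.
have I2c : Rintegrable sigma (ball1 r) (fun z : BorelCn R n => e / 2).
  exact: integrable_sphere_cst.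
have I2h : Rintegrable sigma (ball1 r) (fun z => (2 * e)^-1 * cabs (cauchy_op sigma s h z) ^+ 2).
  by apply: eq_integrable (integrableZl mB (2 * e)^-1 I2B).
apply: (@le_trans _ _ (\int[sigma]_(z in ball1 r) (e / 2 + (2 * e)^-1 * cabs (cauchy_op sigma s h z) ^+ 2))).
  apply: le_Rintegral => //.
    by apply: eq_integrable (integrableD mB I2c I2h).
  move=> z Bz; set a := cabs _.
  have : 0 <= (2 * e)^-1 * (a - e) ^+ 2 by rewrite mulr_ge0 ?sqr_ge0// invr_ge0 mulr_ge0 ?ltW.
  have -> : (2 * e)^-1 * (a - e) ^+ 2 = (2 * e)^-1 * a ^+ 2 - a + e / 2.
    by field; rewrite gt_eqF.
  lra.
rewrite (RintegralD mB I2c I2h) (RintegralZl _ mB I2B) (Rintegral_cst sigma mB).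
rewrite -/(vol sigma e1 r) mulrDr; apply: lerD => //.
have h1 : \int[sigma]_(z in ball1 r) cabs (cauchy_op sigma s h z) ^+ 2 <= normL2 sigma h.
  apply: (le_trans _ (cauchy_op_L2 n0 hsigma s01 bh)).
  by apply: Rintegral_subset => // x _; rewrite sqr_ge0.
have h2 : normL2 sigma h <= e ^+ 2 * vol sigma e1 r'.
  have Ih := integrable_cabs_sqr sigma bh.
  have := Ih; rewrite {1}(sphere_ball_far r') => Iu.
  rewrite /normL2 (sphere_ball_far r') (Rintegral_union mB' (measurable_far1 r') (ball_far_disj r') Iu).
  rewrite [X in _ + X](_ : _ = 0) ?addr0; last first.
    transitivity (\int[sigma]_(x in far1 r') (0 : R)).
      by apply: eq_Rintegral => x /[!inE] Fx; rewrite hfar// cabs0 expr0n.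
    by rewrite Rintegral_cst ?mul0r//; exact: measurable_far1.
  rewrite /vol -Rintegral_cst//; apply: le_Rintegral => //.
  - by apply: integrableS Ih.
  - exact: integrable_sphere_cst.
  move=> x Bx; apply: lerXn2r; rewrite ?nnegrE ?cabs_ge0 ?(ltW e0)//.
  by apply: he; exact: BS'.
have -> : e / 2 * vol sigma e1 r' = (2 * e)^-1 * (e ^+ 2 * vol sigma e1 r').
  by field; rewrite gt_eqF.
rewrite ler_wpM2l ?invr_ge0 ?mulr_ge0 ?(ltW e0)//.
exact: le_trans h2.
Qed.

(** Used only to know that the first-order term is a linear form: nothing is claimed about the size
    of [v]. *)
Lemma linear_form (D : set (BorelCn R n)) (k : BorelCn R n -> C) :
  measurable D -> D `<=` S -> Cintable sigma D k ->
  exists v, forall z, Cint sigma D (fun x => hdot z x * k x) = hdot z v.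
Proof.
move=> mD DS Ik.
have bj (j : 'I_n) : Cintable sigma D (fun x : BorelCn R n => ((x : Cn R n) 0 j)^* * k x).
  apply: (CintableMl (K := 1) mD Ik).
    by apply: Cmeas_conj; have [m1 m2] := Cmeas_coord (R := R) j;
      split; [exact: measurable_funTS m1|exact: measurable_funTS m2].
  move=> x Dx; rewrite cabs_conj -(ler_pXn2r (n := 2))// ?nnegrE ?cabs_ge0// expr1n.
  have Sx := DS _ Dx; have := enorm_sqr (x : Cn R n).
  rewrite Sx expr1n (bigD1 j)//= => ->.
  by rewrite lerDl sumr_ge0// => i _; rewrite sqr_ge0.
exists (\row_j (Cint sigma D (fun x : BorelCn R n => ((x : Cn R n) 0 j)^* * k x))^*) => z.
have [E _] := @Cint_sum _ _ _ sigma D _ (index_enum 'I_n)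
  (fun (j : 'I_n) (x : BorelCn R n) => z 0 j * (((x : Cn R n) 0 j)^* * k x)) mD
  (fun j => CintableZl (z 0 j) mD (bj j)).
transitivity (Cint sigma D (fun x : BorelCn R n => \sum_(j < n) z 0 j * (((x : Cn R n) 0 j)^* * k x))).
  by apply: eq_Cint => x _; rewrite /hdot mulr_suml; apply: eq_bigr => j _; rewrite mulrA.
apply: (etrans E); rewrite /hdot; apply: eq_bigr => j _.
by rewrite CintZl// mxE conjCK.
Qed.

(** The constant and the vector are chosen before s; this uniformity is what allows s to tend to 1
    afterwards. The radius 4 r is that of a ball around 1 containing every nonisotropic ball of
    radius r through 1. *)
Lemma core_estimate : exists C1 : R, 0 < C1 /\
  forall (G : BorelCn R n -> R) (r e J : R),
  0 < r -> 0 < e -> Rintegrable sigma S G ->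
  (forall x, ball1 (320 * r) x -> `|G x| <= e) ->
  \int[sigma]_(x in far1 (320 * r)) (ndist x e1 ^- n.+1 * `|G x|) <= J ->
  exists (c : C) v, forall s, 0 <= s < 1 -> 1 - s <= r ->
    let E z := outer_log G (rscale s z) - c - s%:C * hdot (tang z) v in
    Cmeas (ball1 (4 * r)) E /\
    Rintegrable sigma (ball1 (4 * r)) (fun z => cabs (E z)) /\
    \int[sigma]_(z in ball1 (4 * r)) cabs (E z) <= C1 * r ^+ n * (e + r * J).
Proof.
have [K [K0 HK]] := @kernel_taylor R n n0.
pose A : R := 4 ^+ n * 4 ^+ n; pose A' : R := 4 ^+ n * 320 ^+ n.
have A0 : 0 < A by rewrite mulr_gt0 ?exprn_gt0.
have p320 : 0 < 320 :> R by rewrite ltr0n.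
have A'0 : 0 < A' by exact: (mulr_gt0 (exprn_gt0 _ (ltr0Sn R 3)) (exprn_gt0 _ p320)).
(* The volumes of the balls of radii 4 r and 320 r for the near part, and twice the factor 5 K of
   the Taylor error for the far part. *)
exists (A + A' + 10 * K * A); split.
  by rewrite !addr_gt0// !mulr_gt0.
move=> G r e J r0 e0 IG Ge HJ.
set B := ball1 (4 * r); set D := ball1 (320 * r); set Fr := far1 (320 * r).
have mB : measurable B by exact: measurable_ball1.
have mD : measurable D by exact: measurable_ball1.
have mF : measurable Fr by exact: measurable_far1.
have BS : B `<=` S by move=> x [].
have DS : D `<=` S by move=> x [].
have FS : Fr `<=` S by move=> x [].
have r320 : 0 < 320 * r := mulr_gt0 p320 r0.
have IGF : Rintegrable sigma Fr G by exact: integrableS IG.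
have IGD : Rintegrable sigma D G by exact: integrableS IG.
have dF x : Fr x -> 0 < cabs (1 - hdot e1 x).
  by move=> [_ Fx]; rewrite -/(ndist e1 _) ndistC; exact: lt_trans Fx.
have dF' x : Fr x -> 320 * r <= cabs (1 - hdot e1 x).
  by move=> [_ Fx]; rewrite -/(ndist e1 _) ndistC; exact: ltW.
have mk m : Cmeas Fr (fun x : BorelCn R n => (1 - hdot e1 x) ^- m).
  apply: CmeasV; apply: CmeasX; apply: CmeasB; first exact: Cmeas_cst.
  exact: Cmeas_hdotr.
have bk m x : Fr x -> cabs ((1 - hdot e1 x) ^- m) <= (320 * r) ^- m.
  move=> Fx; rewrite cabsV cabsX lef_pV2 ?posrE ?exprn_gt0 ?dF//.
  by apply: lerXn2r; [exact: ltW|exact: cabs_ge0|exact: dF'].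
have Ia : Cintable sigma Fr (fun x => cauchy_kernel e1 x * (G x)%:C).
  by apply: Cintable_realM IGF (mk n) _ => // x Fx; exact: bk.
have Ib : Cintable sigma Fr (fun x => (1 - hdot e1 x) ^- n.+1 * (G x)%:C).
  by apply: Cintable_realM IGF (mk n.+1) _ => // x Fx; exact: bk.
have Ib' := CintableZl ((2 * n%:R) : C) mF Ib.
have [v Hv] := linear_form mF FS Ib'.
have IGC : Cintable sigma S (fun x => (G x)%:C).
  by split => //=; exact: integrable0.
pose cG := Cint sigma S (fun x => (G x)%:C).
pose c1 := Cint sigma Fr (fun x => cauchy_kernel e1 x * (G x)%:C).
(* The far integral of 2 C - 1 frozen at the boundary point 1, where the -1 is integrated over the
   whole sphere. *)
exists (2 * c1 - cG), v => s s01 s1r E.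
have [s0 s1] := andP s01.
pose near z := Cint sigma D (fun x => cauchy_kernel (rscale s z) x * (G x)%:C).
pose T z (x : BorelCn R n) := cauchy_kernel (rscale s z) x - cauchy_kernel e1 x -
   n%:R * (s%:C * hdot (tang z) x) * (1 - hdot e1 x) ^- n.+1.
pose rest z := Cint sigma Fr (fun x => T z x * (G x)%:C).
have IkS z : S z -> Cintable sigma S (fun x => cauchy_kernel (rscale s z) x * (G x)%:C).
  move=> Sz; have [mkz _] := bdm_cauchy_kernel s01 Sz.
  by apply: Cintable_realM IG mkz _ => // x Sx; exact: cabs_cauchy_kernel.
have ET z : S z -> E z = 2 * near z + 2 * rest z.
  move=> Sz; have Ik := IkS z Sz.
  have IkF := CintableS mF mS FS Ik.
  have oE : outer_log G (rscale s z) = 2 * Cint sigma S (fun x => cauchy_kernel (rscale s z) x * (G x)%:C) - cG.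
    rewrite /cG -(CintZl _ mS Ik) -(CintB mS (CintableZl _ mS Ik) IGC).
    by apply: eq_Cint => x _; rewrite mulrBl mul1r mulrA.
  have Iu := Ik; rewrite {1}(sphere_ball_far (320 * r)) in Iu.
  have sE : Cint sigma S (fun x => cauchy_kernel (rscale s z) x * (G x)%:C) =
      near z + Cint sigma Fr (fun x => cauchy_kernel (rscale s z) x * (G x)%:C).
    rewrite [in LHS](sphere_ball_far (320 * r)).
    exact: (Cint_union mD mF (ball_far_disj _) Iu).
  pose t (x : BorelCn R n) : C := hdot (tang z) x *
       (2 * n%:R * ((1 - hdot e1 x) ^- n.+1 * (G x)%:C)).
  have It : Cintable sigma Fr t.
    apply: (CintableMl (K := enorm (tang z)) mF Ib'); first exact: Cmeas_hdotr.
    by move=> x Fx; rewrite (le_trans (hdot_CS _ _))// (FS _ Fx) mulr1.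
  have rE : Cint sigma Fr (fun x => cauchy_kernel (rscale s z) x * (G x)%:C) =
      rest z + c1 + s%:C / 2 * hdot (tang z) v.
    rewrite -(Hv (tang z)) -CintZl// /rest.
    have If : Cintable sigma Fr (fun x => T z x * (G x)%:C).
      apply: (@eq_Cintable _ _ _ sigma Fr (fun x => cauchy_kernel (rscale s z) x * (G x)%:C
         - cauchy_kernel e1 x * (G x)%:C - s%:C / 2 * t x)) => //.
        by move=> x _; exact: taylor_split.
      exact: (CintableB mF (CintableB mF IkF Ia) (CintableZl _ mF It)).
    rewrite -(CintD mF If Ia) -(CintD mF (CintableD mF If Ia) (CintableZl _ mF It)).
    by apply: eq_Cint => x _; exact: taylor_join.
  by rewrite /E oE sE rE; field.
have mE : Cmeas B E.
  apply: CmeasB.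
    apply: CmeasB; last exact: Cmeas_cst.
    have mop := Cmeas_op s01 IGC.
    have mS' : Cmeas S (fun z => 2 * cauchy_op sigma s (fun x => (G x)%:C) z - cG).
      by apply: CmeasB; [apply: CmeasM => //; exact: Cmeas_cst|exact: Cmeas_cst].
    have eS z : S z -> 2 * cauchy_op sigma s (fun x => (G x)%:C) z - cG = outer_log G (rscale s z).
      move=> Sz; rewrite /cG -(CintZl _ mS (IkS z Sz)).
      rewrite -(CintB mS (CintableZl _ mS (IkS z Sz)) IGC).
      by apply: eq_Cint => x _; rewrite mulrBl mul1r mulrA.
    apply: (eq_Cmeas _ (CmeasS mS BS mS')) => z Bz.
    by apply: eS; exact: BS.
  apply: CmeasM; first exact: Cmeas_cst.
  have -> : (fun z : BorelCn R n => hdot (tang z) v) =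
     (fun z : BorelCn R n => hdot z v - hdot z e1 * hdot e1 v).
    by apply/funext => z; rewrite hdot_tang.
  apply: CmeasB; first exact: Cmeas_hdotl.
  by apply: CmeasM; [exact: Cmeas_hdotl|exact: Cmeas_cst].
have [In1 In2] := @cauchy_op_L1_ball s e G (4 * r) (320 * r) s01 e0 IG Ge.
have IGn : Rintegrable sigma Fr (fun x : BorelCn R n => ndist x e1 ^- n.+1 * `|G x|).
  have := Cintable_cabs mF Ib; apply: eq_integrable => // x _ /=.
  by rewrite cabsM cabs_real cabsV cabsX -/(ndist e1 _) ndistC.
have rest_le z : B z -> cabs (rest z) <= K * (5 * r) * J.
  move=> [Sz Bz].
  (* Distance 4 r from z to 1 plus 1 - s <= r; the cut at 320 r = 64 (5 r) is thus the one that
     [kernel_taylor] asks for. *)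
  have zd : cabs (1 - s%:C * hdot z e1) <= 5 * r.
    have -> : 1 - s%:C * hdot z e1 = (1 - hdot z e1) +
       (1 - s)%:C * hdot z e1 by rewrite real_complexB; ring.
    rewrite (le_trans (cabsD _ _))// cabsM cabs_real ger0_norm; last by rewrite subr_ge0 ltW.
    have : (1 - s) * cabs (hdot z e1) <= r * 1.
      by apply: ler_pM; rewrite ?cabs_ge0 ?subr_ge0 ?(ltW s1)//; exact: sphere_hdot.
    rewrite -/(ndist _ e1); move: Bz; rewrite /=; lra.
  have r5 : 0 < 5 * r by rewrite mulr_gt0.
  have r50 : 0 <= K * (5 * r) by rewrite mulr_ge0 ?ltW.
  apply: (@le_trans _ _ (\int[sigma]_(x in Fr) (K * (5 * r) * (ndist x e1 ^- n.+1 * `|G x|)))).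
    apply: cabs_Cint_bound => //.
    - apply: CmeasM; last by apply: Cmeas_real; apply/measurable_EFinP; have /measurable_int := IGF.
      have [mkz _] := bdm_cauchy_kernel s01 Sz.
      apply: CmeasB.
        apply: CmeasB; last exact: mk.
        by have [m1 m2] := mkz; split; [exact: measurable_funS m1|exact: measurable_funS m2].
      apply: CmeasM; last exact: mk.
      by apply: CmeasM; [exact: Cmeas_cst|apply: CmeasM; [exact: Cmeas_cst|exact: Cmeas_hdotr]].
    - by apply: eq_integrable (integrableZl mF (K * (5 * r)) IGn).
    move=> x Fx; rewrite cabsM cabs_real [leRHS]mulrA; apply: ler_wpM2r => //.
    apply: HK => //; [exact: FS|by rewrite s0 ltW|].
    have [_ Fx'] := Fx; have e64 : 64 * (5 * r) = 320 * r by ring.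
    by rewrite e64 ltW.
  by rewrite RintegralZl// ler_wpM2l.
have Ic : Rintegrable sigma B (fun z : BorelCn R n => 2 * (K * (5 * r) * J)).
  exact: integrable_sphere_cst.
have In2' : Rintegrable sigma B (fun z => 2 * cabs (near z)).
  by apply: eq_integrable (integrableZl mB 2 In1).
have Ebound z : B z -> cabs (E z) <= 2 * cabs (near z) + 2 * (K * (5 * r) * J).
  move=> Bz; rewrite ET; last exact: BS.
  rewrite (le_trans (cabsD _ _))// !cabsM !cabs_nat lerD2l.
  by rewrite ler_wpM2l// rest_le.
have IE : Rintegrable sigma B (fun z => cabs (E z)).
  apply: (le_integrable mB _ _ (integrableD mB In2' Ic)).
    by apply/measurable_EFinP; exact: measurable_cabs.
  move=> z Bz /=; rewrite lee_fin ger0_norm ?cabs_ge0//.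
  by rewrite (le_trans (Ebound _ Bz))// ler_norm.
split => //; split => //.
apply: (@le_trans _ _ (\int[sigma]_(z in B) (2 * cabs (near z) + 2 * (K * (5 * r) * J)))).
  apply: le_Rintegral => //.
  by apply: eq_integrable (integrableD mB In2' Ic).
rewrite RintegralD// RintegralZl// Rintegral_cst//.
have r4 : 0 < 4 * r by rewrite mulr_gt0.
have v4 := vol_upper n0 hsigma S1 r4.
have v320 := vol_upper n0 hsigma S1 r320.
rewrite -/(vol sigma e1 (4 * r)).
have J0 : 0 <= J.
  apply: le_trans HJ; apply: Rintegral_ge0 => x _.
  by rewrite mulr_ge0// invr_ge0 exprn_ge0// ndist_ge0.
rewrite exprMn mulrA -/A in v4; rewrite exprMn mulrA -/A' in v320.
have rn0 : 0 <= r ^+ n by rewrite exprn_ge0 ?(ltW r0).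
have h1 : 2 * (K * (5 * r) * J) * vol sigma e1 (4 * r) <= 2 * (K * (5 * r) * J) * (A * r ^+ n).
  by rewrite ler_wpM2l// !mulr_ge0 ?(ltW K0) ?(ltW r0).
have h2 : 2 * (e / 2 * (vol sigma e1 (4 * r) + vol sigma e1 (320 * r))) <= e * (A * r ^+ n + A' * r ^+ n).
  have -> : 2 * (e / 2 * (vol sigma e1 (4 * r) + vol sigma e1 (320 * r))) =
      e * (vol sigma e1 (4 * r) + vol sigma e1 (320 * r)) by field.
  by rewrite ler_wpM2l ?(ltW e0)// lerD.
have h3 : 2 * \int[sigma]_(z in B) cabs (near z) <=
    2 * (e / 2 * (vol sigma e1 (4 * r) + vol sigma e1 (320 * r))) by rewrite ler_wpM2l.
have : 0 <= 10 * K * A * r ^+ n * e by rewrite !mulr_ge0 ?(ltW K0) ?(ltW A0) ?(ltW e0).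
have : 0 <= (A + A') * r ^+ n * (r * J).
  by rewrite !mulr_ge0 ?addr_ge0 ?(ltW A0) ?(ltW A'0) ?(ltW r0).
have -> : (A + A' + 10 * K * A) * r ^+ n * (e + r * J) =
  e * (A * r ^+ n + A' * r ^+ n) + 2 * (K * (5 * r) * J) * (A * r ^+ n) +
  (10 * K * A * r ^+ n * e + (A + A') * r ^+ n * (r * J)) by ring.
move=> h4 h5; apply: ler_wpDr; first exact: addr_ge0.
by apply: lerD => //; exact: le_trans h2.
Qed.

End CoreEstimate.

(** * Passage to the boundary *)

Section LowerIntegral.
Context d (T : measurableType d) (R : realType).
Variable mu : {measure set T -> \bar R}.
Local Open Scope ereal_scope.

(* No measurability is assumed: the integral of a nonnegative function is the
   lower integral.  This matters because [phi] is an arbitrary representative. *)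
Lemma ge0_le_lower_integral (D : set T) (f g : T -> \bar R) :
  (forall x, D x -> 0 <= f x) -> (forall x, D x -> f x <= g x) ->
  \int[mu]_(x in D) f x <= \int[mu]_(x in D) g x.
Proof.
move=> f0 fg; have g0 x : D x -> 0 <= g x by move=> Dx; exact: le_trans (f0 x Dx) (fg x Dx).
rewrite (ge0_integralE mu f0) (ge0_integralE mu g0); apply: le_ereal_sup.
move=> _ [h hf <-]; exists h => //= x; apply: (le_trans (hf x)).
by rewrite !patchE; case: ifPn => // /[!inE] Dx; exact: fg.
Qed.

Lemma measurable_off_null d' (T' : measurableType d') (D N : set T) (g : T -> T') c :
  measurable D -> measurable N -> measurable_fun D g ->
  measurable_fun D (fun x => if x \in N then c else g x).
Proof.
move=> mD mN mg; apply: measurable_fun_if => //.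
- apply: measurable_fun_bool (true) _ => //.
  by rewrite preimage_mem_true; exact: measurableI.
- by apply: measurable_funS mg => // x [].
Qed.

(** Raising [h] to +oo on [N] makes the comparison hold everywhere without changing the integral of
    [h], so that no measurability of [f] is involved. *)
Lemma ge0_le_integral_off_null (D N : set T) (f h : T -> \bar R) :
  measurable D -> measurable N -> mu N = 0 ->
  (forall x, D x -> 0 <= f x) -> (forall x, D x -> 0 <= h x) ->
  measurable_fun D h -> (forall x, D x -> ~ N x -> f x <= h x) ->
  \int[mu]_(x in D) f x <= \int[mu]_(x in D) h x.
Proof.
move=> mD mN N0 f0 h0 mh fh.
pose h' x := if x \in N then +oo else h x.
have h'0 x : D x -> 0 <= h' x by move=> Dx; rewrite /h'; case: ifP => // _; exact: h0.
have mh' : measurable_fun D h' by exact: measurable_off_null.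
apply: (@le_trans _ _ (\int[mu]_(x in D) h' x)).
  apply: ge0_le_lower_integral => // x Dx; rewrite /h'; case: ifPn => [_|nN].
    exact: leey.
  by apply: fh => // Nx; rewrite mem_set in nN.
rewrite (ge0_ae_eq_integral mD mh' mh h'0 h0)//.
exists N; split => // x /= nx; apply: contrapT => Nx; apply: nx => _.
by rewrite /h' memNset.
Qed.

(** [L] is the lower limit, possibly infinite. The last clause, that a larger value is undercut for
    arbitrarily large j, is the form in which [limit_bounds] consumes it. *)
Lemma fatou_frequently (D : set T) (u : nat -> T -> R) (H : R) :
  measurable D -> (forall j, measurable_fun D (u j)) ->
  (forall j x, D x -> (0 <= u j x)%R) ->
  (forall j, \int[mu]_(x in D) (u j x)%:E <= H%:E) ->
  exists L : T -> \bar R, [/\ measurable_fun D L, forall x, D x -> 0 <= L x,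
    \int[mu]_(x in D) L x <= H%:E &
    forall x y k, L x < y%:E -> exists2 j, (k <= j)%N & (u j x < y)%R].
Proof.
move=> mD mu_ u0 uH.
pose f j x := (u j x)%:E.
have mf j : measurable_fun D (f j) by apply/measurable_EFinP.
have f0 j x : D x -> 0 <= f j x by move=> Dx; rewrite lee_fin u0.
have le_lim (v : (\bar R)^nat) k : einfs v k <= limn_einf v.
  rewrite limn_einf_lim (cvg_lim _ (cvg_einfs_sup (u := v)))//.
  by apply: ereal_sup_ubound; exists k.
exists (fun x => limn_einf (f^~ x)); split.
- apply: measurableT_comp => //.
  have mnf j : measurable_fun D (fun x => - f j x) by exact: measurableT_comp.
  exact: (measurable_fun_limn_esup (f := fun j x => - f j x) mnf).
- move=> x Dx; apply: le_trans (le_lim _ 0%N); apply: le_ereal_inf_tmp => _ [j _ <-].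
  exact: f0.
- have fat := fatou mu mD mf f0; apply: (le_trans fat); rewrite limn_einf_lim.
  rewrite (cvg_lim _ (cvg_einfs_sup (u := fun j => \int[mu]_(x in D) f j x)))//.
  apply: ge_ereal_sup => _ [k _ <-].
  apply: le_trans (uH k); apply: ereal_inf_lbound; exists k => //=.
- move=> x y k Ly; have : einfs (f^~ x) k < y%:E by exact: le_lt_trans (le_lim _ k) Ly.
  by move=> /ereal_inf_lt[_ [j /= kj <-]] h; exists j.
Qed.

End LowerIntegral.

(** * Estimates for the complex exponential *)

Section ExpDifference.
Context {R : realType}.
Local Notation C := (Cplx R).

Lemma nonexpansive_derive (f df : R -> R) :
  (forall x : R, is_derive x 1 f (df x)) -> (forall x, `|df x| <= 1) ->
  forall y, `|f y - f 0| <= `|y|.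
Proof.
move=> fd df1.
have cf a b : {within `[a, b], continuous f}.
  apply: continuous_subspaceT => x; apply: differentiable_continuous.
  by apply/derivable1_diffP; have [] := fd x.
have main a b : a <= b -> `|f b - f a| <= b - a.
  move=> ab; have [c _ ->] := MVT_segment ab (fun x _ => fd x) (cf a b).
  by rewrite normrM (ger0_norm (x := b - a)) ?subr_ge0// ler_piMl ?subr_ge0.
move=> y; have [y0|y0] := leP 0 y.
  by have := main 0 y y0; rewrite subr0 (ger0_norm y0).
by have := main y 0 (ltW y0); rewrite sub0r distrC (ltr0_norm y0).
Qed.

Lemma cabs_cexp_sub1 (u : C) :
  cabs (cexp u - 1) <= 2 * (1 + expR (complex.Re u)) * cabs u.
Proof.
set x := complex.Re u; set y := complex.Im u.
have e0 := expR_gt0 x.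
have hs : `|sin y| <= `|y|.
  have := nonexpansive_derive (f := sin) (df := cos) (fun x => is_derive_sin x)
    (fun x => _) y; rewrite sin0 subr0; apply => z.
  by rewrite ler_norml cos_geN1 cos_le1.
have hc : `|cos y - 1| <= `|y|.
  have := nonexpansive_derive (f := cos) (df := fun x => - sin x) (fun x => is_derive_cos x)
    (fun x => _) y; rewrite cos0; apply => z.
  by rewrite normrN ler_norml sin_geN1 sin_le1.
have he : `|expR x - 1| <= (1 + expR x) * `|x|.
  have [x0|x0] := leP 0 x.
    have e1' : 0 <= expR x - 1 by have := expR_ge1Dx x; lra.
    rewrite (ger0_norm e1') (ger0_norm x0).
    have := expR_ge1Dx (- x); rewrite expRN => h.
    have : expR x * (1 - x) <= expR x * (expR x)^-1 by rewrite ler_wpM2l// (ltW e0).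
    rewrite divff ?gt_eqF//; nra.
  rewrite ltr0_norm; last by rewrite subr_lt0 expR_lt1.
  by rewrite (ltr0_norm x0); have := expR_ge1Dx x; nra.
have hx : `|x| <= cabs u by exact: Re_le_cabs.
have hy : `|y| <= cabs u by exact: Im_le_cabs.
have h1 : `|complex.Re (cexp u - 1)| <= (1 + expR x) * `|x| + `|y|.
  rewrite cReD cReN /cexp /= -/x -/y.
  have -> : expR x * cos y - 1 = (expR x - 1) * cos y + (cos y - 1) by ring.
  rewrite (le_trans (ler_normD _ _))// lerD// normrM.
  have c1 : `|cos y| <= 1 by rewrite ler_norml cos_geN1 cos_le1.
  by rewrite (le_trans _ he)// ler_piMr.
have h2 : `|complex.Im (cexp u - 1)| <= expR x * `|y|.
  by rewrite cImD cImN /cexp /= oppr0 addr0 -/x -/y normrM (ger0_norm (ltW e0)) ler_pM2l.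
apply: (le_trans (cabs_le_ReIm _)); nra.
Qed.

Lemma cabs_cexpB (z w : C) : cabs (cexp z - cexp w) <=
  2 * (expR (complex.Re z) + expR (complex.Re w)) * cabs (z - w).
Proof.
have -> : cexp z - cexp w = cexp w * (cexp (z - w) - 1).
  by rewrite mulrBr mulr1 -cexpD [w + _]addrC subrK.
rewrite cabsM cabs_cexp.
have := cabs_cexp_sub1 (z - w); rewrite cReD cReN expRD expRN.
have := expR_gt0 (complex.Re w); set a := expR (complex.Re w); set b := expR _ => a0 h.
have : a * cabs (cexp (z - w) - 1) <= a * (2 * (1 + b / a) * cabs (z - w)).
  by rewrite ler_pM2l.
move=> /le_trans; apply; rewrite le_eqVlt; apply/orP; left; apply/eqP.
by field; rewrite gt_eqF.
Qed.

End ExpDifference.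

Section RadialLimits.
Context {R : realType} {n : nat}.
Local Notation C := (Cplx R).

Lemma radial_limit (f : Cn R n -> C) (xi : Cn R n) :
  cvg (radial f xi r @[r --> (1 : R)^'-]) ->
  forall e : R, 0 < e -> exists2 d : R, 0 < d &
    forall r : R, 1 - d < r -> r < 1 -> cabs (f (rscale r xi) - boundary_value f xi) < e.
Proof.
move=> cf e e0.
have eC : 0 < e%:C :> C by rewrite ltcR.
have cf' : radial f xi r @[r --> (1 : R)^'-] --> boundary_value f xi by exact: cf.
have := @cvgr_dist_lt _ _ _ _ _ _ _ cf' _ eC; move=> /(_ _).
rewrite /at_left near_withinE => /nbhs_ballP[d /= d0 Hd]; exists d => // r r1 r2.
have br : ball (1 : R) d r by rewrite /ball/= gtr0_norm ?subr_gt0//; lra.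
have := Hd r br r2; rewrite normCE ltcR => h.
by rewrite -cabsN opprB.
Qed.

(** A sequence tending to 1 that starts at 1 - r, so that every term satisfies the restriction 1 - s
    <= r of [core_estimate]. *)
Definition approach (r : R) (j : nat) : R := 1 - r / j.+1%:R.

Lemma approach_range (r : R) j : 0 < r <= 1 ->
  0 <= approach r j < 1 /\ 1 - approach r j <= r.
Proof.
move=> /andP[r0 r1]; have j0 : 0 < j.+1%:R :> R by rewrite ltr0n.
have j1 : 1 <= j.+1%:R :> R by rewrite ler1n.
have a : r / j.+1%:R <= r by rewrite ler_pdivrMr// ler_peMr// ltW.
have b : 0 < r / j.+1%:R by rewrite divr_gt0.
rewrite /approach; move: (r / _) a b => t a b.
by split; [apply/andP; split|]; lra.
Qed.

Lemma approach_cvg (r e : R) : 0 < r -> 0 < e ->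
  exists k, forall j, (k <= j)%N -> 1 - approach r j < e.
Proof.
move=> r0 e0; exists (Num.bound (r / e)) => j kj.
have : r / e < j.+1%:R.
  apply: (lt_le_trans (archi_boundP _)); first by rewrite divr_ge0 ?ltW.
  by rewrite ler_nat; exact: leq_trans kj (leqnSn _).
rewrite ltr_pdivrMr// => h; rewrite /approach opprB addrCA subrr addr0.
by rewrite ltr_pdivrMr ?ltr0n// mulrC.
Qed.

(** The passage to the boundary at one point: [w j] is the logarithm at radius [s j], [l] the value
    of the form, [g] that of [G], and [L] stands for the lower limit of the errors. Re (w j) tends
    to g because the moduli have a nonzero limit; Im (w j) need not converge, so the exponentials
    are compared at a single late j where the error is nearly [L]. *)
Lemma limit_bounds (w E : nat -> C) (s : nat -> R) (l c b : C) (m g L : R) :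
  (forall j, E j = w j - c - (s j)%:C * l) ->
  (forall j, 0 <= s j <= 1) ->
  (forall e : R, 0 < e -> exists k, forall j, (k <= j)%N -> 1 - s j < e) ->
  (forall e : R, 0 < e -> exists k, forall j, (k <= j)%N -> cabs (cexp (m%:C + w j) - b) < e) ->
  cabs b = expR (m + g) ->
  (forall y k, L < y -> exists2 j, (k <= j)%N & cabs (E j) < y) ->
  `|complex.Re l + complex.Re c - g| <= L /\
  (expR g <= 3 / 2 ->
   cabs (b - cexp (m +i* complex.Im c)%C) <= 6 * expR m * (L + `|complex.Re c| + cabs l)).
Proof.
move=> HE s01 Hs Hw Hb HL.
have em := expR_gt0 m.
have b0 : 0 < cabs b by rewrite Hb expR_gt0.
have Re_cexp j : complex.Re (m%:C + w j) = m + complex.Re (w j) by rewrite cReD.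
have lnb : ln (cabs b) = m + g by rewrite Hb expRK.
(* Continuity of the logarithm at |b| > 0. *)
have Hg (e : R) : 0 < e -> exists k, forall j, (k <= j)%N -> `|complex.Re (w j) - g| < e.
  move=> e0; have /cvgrPdist_lt/(_ e e0)/nbhs_ballP[d /= d0 Hd] := continuous_ln b0.
  have [k Hk] := Hw d d0; exists k => j kj.
  have := ler_dist_cabs (cexp (m%:C + w j)) b; move=> /le_lt_trans/(_ (Hk j kj)) h.
  rewrite distrC in h; have {}h : `|ln (cabs b) - ln (cabs (cexp (m%:C + w j)))| < e := Hd _ h.
  move: h.
  rewrite cabs_cexp expRK lnb Re_cexp distrC.
  by have -> : m + complex.Re (w j) - (m + g) = complex.Re (w j) - g by ring.
have l0 := cabs_ge0 l.
have near_l (e : R) : 0 < e -> exists k, forall j, (k <= j)%N -> (1 - s j) * cabs l < e.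
  move=> e0; have p : 0 < cabs l + 1 by lra.
  have [k Hk] := Hs (e / (cabs l + 1)) (divr_gt0 e0 p); exists k => j kj.
  have := Hk j kj; rewrite ltr_pdivlMr// => h; have /andP[_ s1] := s01 j.
  by apply: le_lt_trans h; rewrite ler_wpM2l//; lra.
split.
  apply/ler_addgt0Pr => e e0; have e3 : 0 < e / 3 by lra.
  have [k1 H1] := Hg _ e3; have [k2 H2] := near_l _ e3.
  have Le : L < L + e / 3 by lra.
  have [j kj Ej] := HL _ (maxn k1 k2) Le.
  have {}H1 := H1 j (leq_trans (leq_maxl _ _) kj).
  have {}H2 := H2 j (leq_trans (leq_maxr _ _) kj).
  have sj1 : `|1 - s j| = 1 - s j by rewrite ger0_norm// subr_ge0; case/andP: (s01 j).
  have R1 : complex.Re l + complex.Re c - g =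
      - complex.Re (E j) + (complex.Re (w j) - g) + complex.Re ((1 - s j)%:C * l).
    by rewrite HE !(cReD, cReN) !cReM !cReR !cImR; ring.
  have n1 : `|complex.Re (E j)| <= cabs (E j) by exact: Re_le_cabs.
  have n2 : `|complex.Re ((1 - s j)%:C * l)| <= (1 - s j) * cabs l.
    by rewrite (le_trans (Re_le_cabs _))// cabsM cabs_real sj1.
  rewrite R1 (le_trans (ler_normD _ _))// (le_trans (lerD (ler_normD _ _) (lexx _)))//.
  by rewrite normrN; lra.
move=> eg.
have S0 : 0 <= `|complex.Re c| + cabs l by rewrite addr_ge0.
apply/ler_addgt0Pr => e e0.
pose d := e / (6 * expR m + 1).
have dm : d * (6 * expR m + 1) = e by rewrite /d divfK// gt_eqF//; lra.
have d0 : 0 < d by rewrite divr_gt0//; lra.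
(* Since |b| <= (3/2) expR m, being within expR m / 2 of b gives modulus at most 2 expR m. With |a|
   = expR m, [cabs_cexpB] then has the factor 2 (2 + 1) = 6. *)
pose d' := Num.min d (expR m / 2).
have d'0 : 0 < d' by rewrite lt_min d0/= divr_gt0.
have [k1 H1] := Hw _ d'0.
have Le : L < L + d by lra.
have [j kj Ej] := HL _ k1 Le.
have {}H1 := H1 j kj.
have [h1 h2] : cabs (cexp (m%:C + w j) - b) < d /\ cabs (cexp (m%:C + w j) - b) < expR m / 2.
  by move: H1; rewrite lt_min => /andP[].
pose a := cexp (m +i* complex.Im c)%C.
have wj : expR (complex.Re (m%:C + w j)) <= 2 * expR m.
  rewrite -cabs_cexp; have := ler_dist_cabs (cexp (m%:C + w j)) b.
  have : cabs b <= expR m * (3 / 2) by rewrite Hb expRD ler_pM2l.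
  by rewrite ler_norml => h3 /andP[_ h4]; lra.
have dif : cabs (m%:C + w j - (m +i* complex.Im c)%C) <= L + d + `|complex.Re c| + cabs l.
  have -> : m%:C + w j - (m +i* complex.Im c)%C =
      E j + (complex.Re c)%:C + (s j)%:C * l.
    rewrite HE; apply: Cext; rewrite !(cReD, cReN, cImD, cImN) ?cReR ?cImR /=; ring.
  rewrite (le_trans (cabsD _ _))// (le_trans (lerD (cabsD _ _) (lexx _)))//.
  rewrite cabs_real; have /andP[s0 s1] := s01 j.
  have : cabs ((s j)%:C * l) <= cabs l by rewrite cabsM cabs_real ger0_norm// ler_piMl.
  lra.
have D := cabs_cexpB (m%:C + w j) (m +i* complex.Im c)%C.
have tri : cabs (b - a) <= cabs (cexp (m%:C + w j) - b) + cabs (cexp (m%:C + w j) - a).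
  have -> : b - a = - (cexp (m%:C + w j) - b) + (cexp (m%:C + w j) - a) by ring.
  by rewrite (le_trans (cabsD _ _))// cabsN.
have D2 : cabs (cexp (m%:C + w j) - a) <= 6 * expR m * (L + d + `|complex.Re c| + cabs l).
  apply: (le_trans D); apply: ler_pM => //; rewrite ?cabs_ge0// ?mulr_ge0// ?addr_ge0 ?expR_ge0//.
  by rewrite [X in _ + expR X]/=; lra.
apply: (le_trans tri).
have -> : 6 * expR m * (L + `|complex.Re c| + cabs l) + e =
   6 * expR m * (L + d + `|complex.Re c| + cabs l) + d by rewrite -dm; ring.
by rewrite addrC lerD// ltW.
Qed.

End RadialLimits.

Lemma eq0_of_odd (R : realType) (x y : R) : y = x -> y = -1 * x -> x = 0.
Proof. lra. Qed.

Lemma sum_le_scaled (R : realType) (K1 K2 K3 W X Y Z : R) :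
  0 <= K1 -> 0 <= K2 -> 0 <= K3 -> 0 <= W -> 0 <= X -> 0 <= Y -> 0 <= Z ->
  K1 * X + ((W + K3) * Y + K2 * Z) <= (1 + K1 + K2 + K3) * (X + (W + 1) * Y + Z).
Proof.
move=> a1 a2 a3 W0 X0 Y0 Z0.
have : 0 <= (1 + K2 + K3) * X by rewrite mulr_ge0// !addr_ge0.
have : 0 <= (1 + K1 + K3) * Z by rewrite mulr_ge0// !addr_ge0.
have : 0 <= (K1 + K2) * ((W + 1) * Y) by rewrite !mulr_ge0// addr_ge0.
have : 0 <= K3 * (W * Y) by rewrite !mulr_ge0.
lra.
Qed.

(** * Rotations fixing 1, and the far integral *)

Section PhaseSymmetry.
Context {R : realType} {n : nat}.
Local Notation C := (Cplx R).
Implicit Types (z w v x xi : Cn R n) (c : C).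
Hypothesis n0 : (0 < n)%N.
Variable sigma : probability (BorelCn R n) R.
Hypothesis hsigma : rotation_invariant_sphere_measure sigma.
Local Notation S := (@unit_sphere R n : set (BorelCn R n)).
Let mS : measurable S := @measurable_sphere R n.

(** Identity on the line of [e1], multiplication by [c] on its complement. It preserves <z, 1>,
    hence all balls centred at 1 when |c| = 1. *)
Definition phase c : Cn R n -> Cn R n := rank1_map c (1 - c) e1 e1.

Lemma hdot_phase_e1 c z : hdot (phase c z) e1 = hdot z e1.
Proof. by rewrite /phase /rank1_map hdotDl !hdotZl hdot_e1// mulr1; ring. Qed.

Lemma tang_phase c z : tang (phase c z) = c *: tang z.
Proof.
rewrite /tang hdot_phase_e1 /phase /rank1_map scalerBr -addrA -scalerBl scalerA -scaleNr.
by congr (_ + _ *: _); ring.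
Qed.

Lemma enorm_phase c z : cabs c = 1 -> enorm (phase c z) = enorm z.
Proof.
move=> c1; apply: enormE_le; first exact: enorm_ge0.
apply: (@complexI R); rewrite -!hdotzz.
have cc := unit_conj c1.
rewrite /phase /rank1_map hdotDl !hdotDr !hdotZl !hdotZr hdot_e1// -[hdot e1 z]hdotC.
rewrite !conjM conjD conjN conj1; set h := hdot z e1; set k := h^*.
set d := c^* in cc *.
transitivity (c * d * hdot z z + h * k * (1 - c * d)); first by ring.
by rewrite cc; ring.
Qed.

Lemma rotation_phase c : cabs c = 1 -> rotation (phase c).
Proof. by move=> c1; apply: rank1_map_rotation => z; exact: enorm_phase. Qed.

Lemma phase_ball1 c r : cabs c = 1 ->
  (phase c : BorelCn R n -> BorelCn R n) @^-1` (ball1 r) = ball1 r.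
Proof.
move=> c1; have [_ _ e] := rotation_phase c1.
by apply/seteqP; split => z; rewrite /ball1 /nball /unit_sphere /ndist /= e hdot_phase_e1.
Qed.

Lemma bdm_tang v : bdm S (fun z : BorelCn R n => hdot (tang z) v).
Proof.
have -> : (fun z : BorelCn R n => hdot (tang z) v) =
    (fun z : BorelCn R n => hdot z v + - (hdot z e1 * hdot e1 v)).
  by apply/funext => z; rewrite hdot_tang.
apply: bdmD; first exact: bdm_hdotl.
apply: bdmN; apply: (@bdmM _ _ _ _ (fun z : BorelCn R n => hdot z e1)); first exact: bdm_hdotl.
exact: bdm_cst.
Qed.

(* [phase (-1)] cancels the mean of the real part of the form, and [phase 'i]
   exchanges real and imaginary parts. *)
Lemma phase_balance (r H k : R) v :
  \int[sigma]_(z in ball1 r) `|complex.Re (hdot (tang z) v) + k| <= H ->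
  `|k| * vol sigma e1 r <= H /\
  \int[sigma]_(z in ball1 r) cabs (hdot (tang z) v) <= 4 * H.
Proof.
move=> HH.
pose l (z : BorelCn R n) : C := hdot (tang z) v.
pose B := @ball1 R n r.
have mB : measurable B by exact: measurable_ball1.
have BS : B `<=` S by move=> x [].
have Il : Cintable sigma B l.
  exact: (CintableS mB mS BS (Cintable_S sigma (bdm_tang v))).
have [IRe IIm] := Il.
have Ik : Rintegrable sigma B (fun=> k).
  exact: integrable_sphere_cst.
have IRk : Rintegrable sigma B (fun z => complex.Re (l z) + k).
  by apply: eq_integrable (integrableD mB IRe Ik).
have pres c (h : BorelCn R n -> R) : cabs c = 1 -> Rintegrable sigma B h ->
    \int[sigma]_(x in B) h (phase c x) = \int[sigma]_(x in B) h x.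
  move=> c1 Ih; have rc := rotation_phase c1.
  apply: (@Rintegral_preserving _ _ _ sigma (phase c : BorelCn R n -> BorelCn R n) B h) => //.
  - exact: measurable_rank1_map.
  - by move=> A mA; exact: hsigma.2.
  - exact: phase_ball1.
have lphase c z : l (phase c z) = c * l z by rewrite /l tang_phase hdotZl.
have n1 : cabs (-1 : C) = 1 by rewrite cabsN cabs1.
have Re0 : \int[sigma]_(z in B) complex.Re (l z) = 0.
  have E1 := pres (-1) (fun z => complex.Re (l z)) n1 IRe.
  have E2 : \int[sigma]_(x in B) complex.Re (l (phase (-1) x)) =
      \int[sigma]_(x in B) (-1 * complex.Re (l x)).
    by apply: eq_Rintegral => z _; rewrite lphase (mulN1r (l z)) cReN mulN1r.
  have E3 := RintegralZl (-1) mB IRe.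
  exact: (eq0_of_odd E1 (etrans E2 E3)).
have kB : `|k| * vol sigma e1 r <= H.
  have E : \int[sigma]_(z in B) (complex.Re (l z) + k) = k * vol sigma e1 r.
    by rewrite RintegralD// Re0 add0r Rintegral_cst.
  have -> : `|k| * vol sigma e1 r = `|k * vol sigma e1 r|.
    by rewrite normrM [`|vol _ _ _|]ger0_norm// vol_ge0.
  by rewrite -E (le_trans (le_normr_Rintegral mB IRk)).
split => //.
have ReH : \int[sigma]_(z in B) `|complex.Re (l z)| <= 2 * H.
  have -> : 2 * H = H + H by ring.
  apply: le_trans (lerD HH kB); rewrite -[X in _ <= _ + X](Rintegral_cst sigma mB).
  have Ink := integrable_norm Ik; have InR := integrable_norm IRk.
  rewrite -(RintegralD mB InR Ink); apply: le_Rintegral => //.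
  - exact: integrable_norm.
  - by apply: eq_integrable (integrableD mB InR Ink).
  move=> z _; rewrite -/(l z).
  have := ler_normB (complex.Re (l z) + k) k; by rewrite addrK.
have i1 : cabs ('i : C) = 1 by rewrite /cabs/= expr0n add0r expr1n sqrtr1.
have ImH : \int[sigma]_(z in B) `|complex.Im (l z)| <= 2 * H.
  apply: le_trans ReH; rewrite -(pres 'i (fun z => `|complex.Re (l z)|) i1 (integrable_norm IRe)).
  rewrite le_eqVlt; apply/orP; left; apply/eqP; apply: eq_Rintegral => z _.
  by rewrite lphase cReM /= mul0r sub0r mul1r normrN.
have -> : 4 * H = 2 * H + 2 * H by ring.
apply: le_trans (lerD ReH ImH).
rewrite -(RintegralD mB (integrable_norm IRe) (integrable_norm IIm)); apply: le_Rintegral => //.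
- exact: Cintable_cabs.
- by apply: eq_integrable (integrableD mB (integrable_norm IRe) (integrable_norm IIm)).
by move=> z _; exact: cabs_le_ReIm.
Qed.

(** The region splits at rho: below it G is controlled by the Hoelder bound, beyond it only by |g| +
    |m|. The powers n + 1 - alpha, n + 1 and (n + 1) q of 1/d all exceed n, so each integral is
    governed by its inner radius. *)
Lemma far_integral_bound (alpha p q : R) : 0 < alpha < 1 -> 1 < p -> p^-1 + q^-1 = 1 ->
  exists K : R, 0 < K /\ forall (G g : BorelCn R n -> R) (m rho r W : R),
  0 < rho -> 0 < r <= rho -> 0 <= W ->
  Rintegrable sigma S G -> Rintegrable sigma S (fun x => `|g x| `^ p) ->
  \int[sigma]_(x in S) `|g x| `^ p <= W ->
  (forall x, S x -> `|G x| <= `|g x| + `|m|) ->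
  (forall x, ball1 rho x -> `|G x| <= (ndist x e1 / rho) `^ alpha) ->
  \int[sigma]_(x in far1 r) (ndist x e1 ^- n.+1 * `|G x|) <=
  K * (rho `^ (- alpha) * r `^ (alpha - 1) + (W + 1) * rho `^ (- (1 + n%:R / p)) + `|m| / rho).
Proof.
move=> /andP[a0 a1] p1 pq.
have p0 : 0 < p by lra.
have pV : p^-1 < 1 by rewrite invf_lt1.
have pV0 : 0 < p^-1 by rewrite invr_gt0.
have q0 : 0 < q by rewrite -invr_gt0; lra.
have qV1 : q^-1 < 1 by lra.
have q1 : 1 < q by rewrite -invf_lt1.
have nR : 0 < n%:R :> R by rewrite ltr0n.
have b1 : n%:R < n%:R + 1 - alpha by lra.
have b2 : n%:R < n%:R + 1 :> R by lra.
have b3 : n%:R < (n%:R + 1) * q by nra.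
have [K1 [K10 H1]] := nfar_power_integral n0 hsigma b1.
have [K2 [K20 H2]] := nfar_power_integral n0 hsigma b2.
have [K3 [K30 H3]] := nfar_power_integral n0 hsigma b3.
exists (1 + K1 + K2 + K3); split; first by rewrite !addr_gt0.
move=> G g m rho r W rho0 /andP[r0 rr] W0 IG Ig gW Gg Ga.
set B := \int[sigma]_(x in far1 r) _.
have S1 : unit_sphere (e1 : Cn R n) := enorm_e1 n0.
pose d (x : BorelCn R n) := ndist x e1.
pose Fr := @far1 R n r; pose Fp := @far1 R n rho.
pose A := Fr `&` ball1 rho.
have mFr : measurable Fr by exact: measurable_far1.
have mFp : measurable Fp by exact: measurable_far1.
have mA : measurable A by apply: measurableI => //; exact: measurable_ball1.
have FrS : Fr `<=` S by move=> x [].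
have FpS : Fp `<=` S by move=> x [].
have dpos x : Fr x -> 0 < d x by case=> _; exact: lt_trans.
have FpFr : Fp `<=` Fr by move=> x [Sx h]; split => //; exact: le_lt_trans h.
have powN x (k : nat) : Fr x -> d x ^- k = d x `^ (- k%:R).
  by move=> Fx; rewrite powRN powR_mulrn ?ltW ?dpos.
have Fr_split : Fr = A `|` Fp by exact: nfar_split.
have AFp : A `&` Fp = set0.
  by rewrite -subset0 => x [[_ [_ /= h1]] [_ h2]]; move: h1; rewrite leNgt h2.
have II : Rintegrable sigma Fr (fun x => d x ^- n.+1 * `|G x|).
  have IGr : Rintegrable sigma Fr (fun x => r ^- n.+1 * `|G x|).
    have I0 : Rintegrable sigma Fr (fun x => `|G x|).
      exact: integrableS (integrable_norm IG).
    by apply: eq_integrable (integrableZl mFr (r ^- n.+1) I0).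
  apply: le_integrable IGr => //.
    apply/measurable_EFinP; apply: measurable_funM.
      apply: (@eq_measurable_fun _ _ _ _ Fr (fun x => d x `^ (- n.+1%:R))).
        by move=> x /[!inE] Fx; rewrite powN.
      have := @integrable_nfar_power R n sigma e1 n.+1%:R r S1 r0 (ler0n _ _).
      by move=> /measurable_int /measurable_EFinP.
    apply: measurableT_comp => //; apply: (measurable_funS mS FrS).
    by apply/measurable_EFinP; have /measurable_int := IG.
  move=> x Fx /=; rewrite lee_fin !normrM normr_id ler_wpM2r//.
  have dx := dpos x Fx.
  rewrite !ger0_norm ?invr_ge0 ?exprn_ge0 ?(ltW r0) ?(ltW dx)//.
  rewrite lef_pV2 ?posrE ?exprn_gt0//; apply: lerXn2r; rewrite ?nnegrE ?(ltW r0) ?(ltW dx)//.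
  by case: Fx => _; exact: ltW.
have IIu := II; rewrite Fr_split in IIu.
have BE : B = \int[sigma]_(x in A) (d x ^- n.+1 * `|G x|) +
              \int[sigma]_(x in Fp) (d x ^- n.+1 * `|G x|).
  by rewrite /B -/Fr {1}Fr_split Rintegral_union.
(* Here d^(-n-1) (d / rho)^alpha = rho^(-alpha) d^-(n + 1 - alpha). *)
have Ab : \int[sigma]_(x in A) (d x ^- n.+1 * `|G x|) <=
    K1 * (rho `^ (- alpha) * r `^ (alpha - 1)).
  have c0 : 0 <= n%:R + 1 - alpha by lra.
  have I1 := @integrable_nfar_power R n sigma e1 (n%:R + 1 - alpha) r S1 r0 c0.
  have I1' : Rintegrable sigma Fr (fun x => rho `^ (- alpha) * d x `^ (- (n%:R + 1 - alpha))).
    by apply: eq_integrable (integrableZl mFr (rho `^ (- alpha)) I1).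
  apply: (@le_trans _ _ (\int[sigma]_(x in A) (rho `^ (- alpha) * d x `^ (- (n%:R + 1 - alpha))))).
    apply: le_Rintegral => //.
    - by apply: integrableS II => //; move=> x [].
    - by apply: integrableS I1' => //; move=> x [].
    move=> x [Fx Bx]; have dx := dpos x Fx.
    rewrite (powN _ _ Fx).
    have -> : rho `^ (- alpha) * d x `^ (- (n%:R + 1 - alpha)) =
        d x `^ (- n.+1%:R) * (d x / rho) `^ alpha.
      rewrite powRM ?invr_ge0 ?(ltW rho0) ?(ltW dx)// -powR_inv1 ?(ltW rho0)// -powRrM mulN1r.
      rewrite mulrA -powRD; last by apply/implyP => _; rewrite gt_eqF.
      rewrite mulrC; congr (_ `^ _ * _); rewrite -natr1; ring.
    by rewrite ler_wpM2l ?powR_ge0// Ga.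
  apply: (@le_trans _ _ (\int[sigma]_(x in Fr) (rho `^ (- alpha) * d x `^ (- (n%:R + 1 - alpha))))).
    apply: Rintegral_subset => //; first by move=> x [].
    by move=> x _; rewrite mulr_ge0// powR_ge0.
  rewrite RintegralZl// mulrCA ler_wpM2l ?powR_ge0//.
  have := H1 e1 r S1 r0; have -> : n%:R - (n%:R + 1 - alpha) = alpha - 1 by ring.
  done.
(* The constant |m| meets the weight d^-(n + 1) directly; |g| is separated from it by Young's
   inequality, leaving the p-th moment and the power (n + 1) q. *)
have Pb : \int[sigma]_(x in Fp) (d x ^- n.+1 * `|G x|) <=
    (W + K3) * rho `^ (- (1 + n%:R / p)) + K2 * (`|m| / rho).
  (* The weight of Young's inequality, chosen to balance its two terms. *)
  pose t := rho `^ ((1 + n%:R / p) / p).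
  have t0 : 0 < t by exact: powR_gt0.
  have c3 : 0 <= (n%:R + 1) * q by nra.
  have c2 : 0 <= n%:R + 1 :> R by lra.
  have I3 := @integrable_nfar_power R n sigma e1 ((n%:R + 1) * q) rho S1 rho0 c3.
  have I2 := @integrable_nfar_power R n sigma e1 (n%:R + 1) rho S1 rho0 c2.
  have Igp : Rintegrable sigma Fp (fun x => `|g x| `^ p) by exact: integrableS Ig.
  have J3 : Rintegrable sigma Fp (fun x => t `^ q * d x `^ (- ((n%:R + 1) * q))).
    by apply: eq_integrable (integrableZl mFp (t `^ q) I3).
  have J2 : Rintegrable sigma Fp (fun x => `|m| * d x `^ (- (n%:R + 1))).
    by apply: eq_integrable (integrableZl mFp `|m| I2).
  have Jp : Rintegrable sigma Fp (fun x => t `^ (- p) * `|g x| `^ p).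
    by apply: eq_integrable (integrableZl mFp (t `^ (- p)) Igp).
  have J13 : Rintegrable sigma Fp (fun x => t `^ q * d x `^ (- ((n%:R + 1) * q)) + t `^ (- p) * `|g x| `^ p).
    by apply: eq_integrable (integrableD mFp J3 Jp).
  apply: (@le_trans _ _ (\int[sigma]_(x in Fp) (t `^ q * d x `^ (- ((n%:R + 1) * q)) + t `^ (- p) * `|g x| `^ p + `|m| * d x `^ (- (n%:R + 1))))).
    apply: le_Rintegral => //.
    - by apply: integrableS II.
    - by apply: eq_integrable (integrableD mFp J13 J2).
    move=> x Fx; have Fx' := FpFr x Fx; have dx := dpos x Fx'.
    rewrite (powN _ _ Fx') -natr1.
    set D := d x `^ (- (n%:R + 1)).
    have D0 : 0 <= D by exact: powR_ge0.
    have := Gg x (FpS x Fx) => /(ler_wpM2l D0) /le_trans; apply.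
    rewrite mulrDr [D * `|m|]mulrC lerD2r.
    have gt : 0 <= `|g x| / t by rewrite divr_ge0// ltW.
    have tD : 0 <= t * D by rewrite mulr_ge0// ltW.
    have qp : q^-1 + p^-1 = 1 by rewrite addrC.
    have -> : D * `|g x| = t * D * (`|g x| / t) by field; rewrite gt_eqF.
    have yg := conjugate_powR tD gt q0 p0 qp; apply: (le_trans yg).
    rewrite (powRM _ (ltW t0) D0) (powRM _ (normr_ge0 _)) ?invr_ge0 ?(ltW t0)//.
    rewrite -[D `^ q]powRrM -powR_inv1 ?(ltW t0)// -[t `^ _ `^ p]powRrM !mulN1r mulNr.
    apply: lerD.
      by rewrite ler_piMr ?(ltW qV1)// mulr_ge0// powR_ge0.
    by rewrite mulrC [_ `^ p * _]mulrC ler_piMl ?(ltW pV)// mulr_ge0// powR_ge0.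
  rewrite (RintegralD mFp J13 J2) (RintegralD mFp J3 Jp).
  rewrite (RintegralZl _ mFp I3) (RintegralZl _ mFp Igp) (RintegralZl _ mFp I2).
  have tp : t `^ (- p) = rho `^ (- (1 + n%:R / p)).
    by rewrite /t -powRrM; congr (_ `^ _); field; rewrite gt_eqF.
  have tq : t `^ q * rho `^ (n%:R - (n%:R + 1) * q) = rho `^ (- (1 + n%:R / p)).
    rewrite /t -powRrM -powRD; last by apply/implyP => _; rewrite gt_eqF.
    congr (_ `^ _).
    have -> : p^-1 = 1 - q^-1 by rewrite -pq addrK.
    by field; rewrite gt_eqF.
  have X3 := H3 e1 rho S1 rho0; have X2 := H2 e1 rho S1 rho0.
  have e2 : n%:R - (n%:R + 1) = -1 :> R by ring.
  rewrite e2 powR_inv1 ?(ltW rho0)// in X2.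
  have W1 : \int[sigma]_(x in Fp) `|g x| `^ p <= W.
    by apply: le_trans gW; apply: Rintegral_subset => // x _; exact: powR_ge0.
  have Z3 := ler_wpM2l (powR_ge0 t q) X3.
  have Z2 := ler_wpM2l (normr_ge0 m) X2.
  have Z1 := ler_wpM2l (powR_ge0 t (- p)) W1.
  rewrite mulrCA tq in Z3; rewrite tp in Z1.
  rewrite tp [K2 * (_ / _)]mulrCA; apply: lerD => //.
  rewrite [leRHS]mulrDl [X in _ <= X]addrC [W * _]mulrC; exact: lerD.
rewrite BE (le_trans (lerD Ab Pb))//.
by apply: sum_le_scaled (ltW K10) (ltW K20) (ltW K30) W0 _ (powR_ge0 _ _) _;
  [rewrite mulr_ge0 ?powR_ge0|rewrite divr_ge0 ?(ltW rho0)].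
Qed.

End PhaseSymmetry.

Section OffNull.
Context d (T : measurableType d) (R : realType).
Variable mu : {measure set T -> \bar R}.

Lemma ge0_lower_integral_subset (A B : set T) (f : T -> \bar R) :
  A `<=` B -> (forall x, B x -> (0 <= f x)%E) ->
  (\int[mu]_(x in A) f x <= \int[mu]_(x in B) f x)%E.
Proof.
move=> AB f0; rewrite integral_mkcond [leRHS]integral_mkcond.
apply: ge0_le_lower_integral => x _; rewrite !patchE.
  by case: ifPn => // /[!inE] /AB; exact: f0.
case: ifPn => [/[!inE] Ax|_]; first by rewrite mem_set//; exact: AB.
by case: ifPn => // /[!inE]; exact: f0.
Qed.

(** The counterpart of [ge0_le_integral_off_null] with an arbitrary larger function: the smaller,
    measurable one is lowered to 0 on [N]. *)
Lemma ge0_le_integral_off_null_minorant (D N : set T) (g : T -> R) (h : T -> \bar R) :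
  measurable D -> measurable N -> mu N = 0%E -> measurable_fun D g ->
  (forall x, D x -> 0 <= g x) -> (forall x, D x -> (0 <= h x)%E) ->
  (forall x, D x -> ~ N x -> ((g x)%:E <= h x)%E) ->
  (\int[mu]_(x in D) (g x)%:E <= \int[mu]_(x in D) h x)%E.
Proof.
move=> mD mN N0 mg g0 h0 gh.
pose g' x := if x \in N then 0 else g x.
have mg' : measurable_fun D g' by exact: measurable_off_null.
have g'0 x : D x -> 0 <= g' x by move=> Dx; rewrite /g'; case: ifP => // _; exact: g0.
apply: (@le_trans _ _ (\int[mu]_(x in D) (g' x)%:E)%E).
  rewrite (@ge0_ae_eq_integral _ _ _ mu D (EFin \o g) (EFin \o g'))//.
  - exact/measurable_EFinP.
  - exact/measurable_EFinP.
  exists N; split => // x /= nx; apply: contrapT => Nx; apply: nx => _.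
  by rewrite /g' memNset.
apply: ge0_le_lower_integral => x Dx; rewrite ?lee_fin ?g'0// /g'.
case: ifPn => [_|nN]; first exact: h0.
by apply: gh => // Nx; rewrite mem_set in nN.
Qed.

Lemma Cint_off_null (D N : set T) (f h : T -> Cplx R) :
  measurable D -> measurable N -> mu N = 0%E -> Cmeas D f -> Cmeas D h ->
  (forall x, D x -> ~ N x -> f x = h x) -> Cint mu D f = Cint mu D h.
Proof.
move=> mD mN N0 [f1 f2] [h1 h2] fh.
have main (u : Cplx R -> R) : measurable_fun D (fun x => u (f x)) ->
    measurable_fun D (fun x => u (h x)) ->
    \int[mu]_(x in D) u (f x) = \int[mu]_(x in D) u (h x).
  move=> mf mh; rewrite /Rintegral; congr fine.
  apply: ae_eq_integral => //; try exact/measurable_EFinP.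
  exists N; split => // x /= nx; apply: contrapT => Nx; apply: nx => Dx.
  by rewrite fh.
by apply: Cext => /=; apply: main.
Qed.

End OffNull.

(** * Proof of the theorem *)

Section RealEstimates.
Variable R : realType.
Implicit Types x y r rho : R.

Lemma ln_le_sub1 x : 0 < x -> ln x <= x - 1.
Proof. by move=> x0; have := @le_ln1Dx R (x - 1); rewrite [1 + _]addrC subrK; apply; lra. Qed.

(** The inequality ln u <= u - 1 at u = x / y and at u = y / x; the hypothesis gives y <= 2 x, which
    accounts for the factor 2. *)
Lemma dist_ln_le x y : 0 < x -> 0 < y -> `|x - y| <= y / 2 ->
  `|ln x - ln y| <= 2 * `|x - y| / y.
Proof.
move=> x0 y0 xy.
have lxy : ln x - ln y <= (x - y) / y.
  rewrite -ln_div ?posrE// mulrBl divff ?gt_eqF//.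
  by apply: ln_le_sub1; exact: divr_gt0.
have lyx : ln y - ln x <= (y - x) / x.
  rewrite -ln_div ?posrE// mulrBl divff ?gt_eqF//.
  by apply: ln_le_sub1; exact: divr_gt0.
have y2x : y <= 2 * x by move: xy; rewrite ler_norml => /andP[]; lra.
have [h|h] := leP y x.
  have e : `|x - y| = x - y by rewrite ger0_norm// subr_ge0.
  have p : 0 <= (x - y) / y by rewrite divr_ge0 ?subr_ge0// ltW.
  have q : (y - x) / x <= 0 by rewrite ler_pdivrMr// mul0r subr_le0.
  by rewrite e -mulrA ler_norml; apply/andP; split; lra.
have e : `|x - y| = y - x by rewrite distrC ger0_norm// subr_ge0 ltW.
have p : (x - y) / y <= 0 by rewrite ler_pdivrMr// mul0r subr_le0 ltW.
have p' : 0 <= (y - x) / y by rewrite divr_ge0 ?subr_ge0// ltW.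
have q : (y - x) / x <= 2 * ((y - x) / y).
  rewrite mulrCA ler_pM2l ?subr_gt0// ler_pdivlMr// mulrC ler_pdivrMr//.
by rewrite e -mulrA ler_norml; apply/andP; split; lra.
Qed.

(** Applied to x = phi(1), it bounds |m| by a negative power of rho. The inequality ln u <= u - 1 is
    taken at x^d and at x^(-d); the positive power is absorbed through x <= M. *)
Lemma norm_ln_le (d M x : R) : 0 < d -> 0 < x <= M ->
  `|ln x| <= (M `^ (2 * d) + 1) / d * x `^ (- d).
Proof.
move=> d0 /andP[x0 xM].
have p0 : 0 < x `^ d by exact: powR_gt0.
have q0 : 0 < x `^ (- d) by exact: powR_gt0.
have l1 : d * ln x <= x `^ d - 1 by rewrite -ln_powR; exact: ln_le_sub1.
have l2 : - (d * ln x) <= x `^ (- d) - 1 by rewrite -mulNr -ln_powR; exact: ln_le_sub1.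
have pM : x `^ d <= M `^ (2 * d) * x `^ (- d).
  have -> : x `^ d = x `^ (2 * d) * x `^ (- d).
    rewrite -powRD; last by apply/implyP => _; rewrite gt_eqF.
    by congr (_ `^ _); ring.
  by rewrite ler_pM2r// powR_mono ?(ltW x0)// mulr_ge0// ltW.
have -> : (M `^ (2 * d) + 1) / d * x `^ (- d) = (M `^ (2 * d) + 1) * x `^ (- d) / d.
  by rewrite mulrAC.
rewrite ler_pdivlMr// mulrC -{1}(ger0_norm (ltW d0)) -normrM ler_norml mulrDl mul1r.
by apply/andP; split; lra.
Qed.

(** The computation that fixes the exponent, with de = n / p. The hypothesis on r and rho says r <=
    rho^(1 + de); after multiplication by rho^alpha, which stands for phi(1), every term is at most
    a constant times r^gamma. *)
Lemma scale_bound (alpha de K W Cm : R) : 0 < alpha < 1 -> 0 < de ->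
  0 <= K -> 0 <= W -> 0 <= Cm ->
  forall r rho mm, 0 < r <= 1 -> 0 < rho -> 0 <= mm ->
  r `^ (alpha / (1 + de)) <= rho `^ alpha -> mm <= Cm * rho `^ (- de) ->
  rho `^ alpha * ((320 * r / rho) `^ alpha +
     r * (K * (rho `^ (- alpha) * (320 * r) `^ (alpha - 1) +
        (W + 1) * rho `^ (- (1 + de)) + mm / rho))) <=
  (320 `^ alpha + K * (320 `^ (alpha - 1) + (W + 1) + Cm)) * r `^ (alpha / (1 + de)).
Proof.
move=> /andP[a0 a1] de0 K0 W0 Cm0 r rho mm /andP[r0 r1] rho0 mm0 rg mC.
set ga := alpha / (1 + de).
have d1 : 0 < 1 + de by lra.
have ga0 : 0 < ga by exact: divr_gt0.
have gaa : ga <= alpha by rewrite /ga ler_pdivrMr// ler_peMr ?(ltW a0)//; lra.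
have gad : (1 + de) * ga = alpha by rewrite /ga mulrC divfK// gt_eqF.
have p320 : 0 < 320 :> R by rewrite ltr0n.
have P (x u v : R) : 0 < x -> x `^ u * x `^ v = x `^ (u + v).
  by move=> x0; rewrite -powRD//; apply/implyP => _; rewrite gt_eqF.
have ra : r `^ alpha <= r `^ ga by apply: ger_powR => //; rewrite r0 r1.
(* The factor u = r rho^-(1 + de) is at most 1 and gamma <= 1, so u <= u^gamma = r^gamma
   rho^(-alpha). *)
have key : rho `^ alpha * (r * rho `^ (- (1 + de))) <= r `^ ga.
  have t0 : 0 < r * rho `^ (- (1 + de)) by rewrite mulr_gt0// powR_gt0.
  have t1 : r * rho `^ (- (1 + de)) <= 1.
    rewrite powRN ler_pdivrMr ?powR_gt0// mul1r.
    have g1 : 0 <= ga^-1 by rewrite invr_ge0 ltW.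
    have := powR_mono (powR_ge0 r ga) rg g1.
    rewrite -!powRrM divff ?gt_eqF// powRr1 ?(ltW r0)//.
    by rewrite -{1}gad mulfK// gt_eqF.
  have t2 : r * rho `^ (- (1 + de)) <= (r * rho `^ (- (1 + de))) `^ ga.
    rewrite -{1}[_ * _]powRr1 ?(ltW t0)//; apply: ger_powR; first by rewrite t0 t1.
    lra.
  have t3 : (r * rho `^ (- (1 + de))) `^ ga = r `^ ga * rho `^ (- alpha).
    by rewrite powRM ?powR_ge0 ?(ltW r0)// -powRrM mulNr gad.
  apply: (le_trans (ler_wpM2l (powR_ge0 _ _) t2)).
  by rewrite t3 mulrCA P// subrr powRr0 mulr1.
have T1 : rho `^ alpha * (320 * r / rho) `^ alpha = 320 `^ alpha * r `^ alpha.
  have e320 : 0 <= 320 * r by rewrite mulr_ge0 ?(ltW p320) ?(ltW r0).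
  rewrite powRM ?invr_ge0 ?(ltW rho0)// -powR_inv1 ?(ltW rho0)// -powRrM mulN1r mulrCA P//.
  by rewrite subrr powRr0 mulr1 powRM ?(ltW p320) ?(ltW r0).
have T2 : rho `^ alpha * (r * (rho `^ (- alpha) * (320 * r) `^ (alpha - 1))) =
    320 `^ (alpha - 1) * r `^ alpha.
  rewrite powRM ?(ltW p320) ?(ltW r0)//.
  have -> : r `^ alpha = r * r `^ (alpha - 1).
    by rewrite -{2}[r]powRr1 ?(ltW r0)// P// addrC subrK.
  have : rho `^ alpha * rho `^ (- alpha) = 1 by rewrite P// subrr powRr0.
  move: (rho `^ alpha) (rho `^ (- alpha)) (320 `^ (alpha - 1)) (r `^ (alpha - 1)) => A B C D AB.
  transitivity ((A * B) * (C * (r * D))); first by ring.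
  by rewrite AB mul1r.
have T3 : rho `^ alpha * (r * (mm / rho)) <= Cm * r `^ ga.
  have h : mm / rho <= Cm * rho `^ (- (1 + de)).
    have -> : rho `^ (- (1 + de)) = rho `^ (- de) / rho.
      rewrite -powR_inv1 ?(ltW rho0)// P//; congr (_ `^ _); ring.
    by rewrite mulrA ler_pM2r ?invr_gt0.
  have A0 := powR_ge0 rho alpha.
  apply: (le_trans (ler_wpM2l A0 (ler_wpM2l (ltW r0) h))).
  have -> : rho `^ alpha * (r * (Cm * rho `^ (- (1 + de)))) =
    Cm * (rho `^ alpha * (r * rho `^ (- (1 + de)))) by ring.
  by rewrite ler_wpM2l.
have c1 : 0 <= 320 `^ alpha :> R by exact: powR_ge0.
have c2 : 0 <= 320 `^ (alpha - 1) :> R by exact: powR_ge0.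
have U1 := ler_wpM2l c1 ra; have U2 := ler_wpM2l (mulr_ge0 K0 c2) ra.
have W1 : 0 <= K * (W + 1) by rewrite mulr_ge0//; lra.
have U3 := ler_wpM2l W1 key; have U4 := ler_wpM2l K0 T3.
have -> : rho `^ alpha * ((320 * r / rho) `^ alpha +
     r * (K * (rho `^ (- alpha) * (320 * r) `^ (alpha - 1) +
        (W + 1) * rho `^ (- (1 + de)) + mm / rho))) =
   320 `^ alpha * r `^ alpha + K * (320 `^ (alpha - 1)) * r `^ alpha +
   K * (W + 1) * (rho `^ alpha * (r * rho `^ (- (1 + de)))) +
   K * (rho `^ alpha * (r * (mm / rho))).
  by rewrite -T1 -[K * _ * _]mulrA -T2; ring.
have -> : (320 `^ alpha + K * (320 `^ (alpha - 1) + (W + 1) + Cm)) * r `^ ga =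
  320 `^ alpha * r `^ ga + K * 320 `^ (alpha - 1) * r `^ ga + K * (W + 1) * r `^ ga +
  K * (Cm * r `^ ga) by ring.
by rewrite !lerD.
Qed.

End RealEstimates.

(** * Oscillation of f from bounds on G *)

Section OscillationIntegral.
Context {R : realType} {n : nat}.
Local Notation C := (Cplx R).
Implicit Types (z w v x xi : Cn R n) (c : C).
Hypothesis n0 : (0 < n)%N.
Variable sigma : probability (BorelCn R n) R.
Hypothesis hsigma : rotation_invariant_sphere_measure sigma.
Local Notation S := (@unit_sphere R n : set (BorelCn R n)).
Let mS : measurable S := @measurable_sphere R n.

(** Cauchy's formula at w = 0, where the second kernel is 1, gives mean 1 to the Cauchy kernel. *)
Lemma Cint_outer_kernel (s : R) z : 0 <= s < 1 -> unit_sphere z ->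
  Cint sigma S (fun x => 2 * cauchy_kernel (rscale s z) x - 1) = 1.
Proof.
move=> s01 Sz; have bk := bdm_cauchy_kernel s01 Sz.
have [s0 s1] := andP s01.
have k1 : Cint sigma S (fun x => cauchy_kernel (rscale s z) x) = 1.
  have es : enorm (rscale s z) < 1 by rewrite enorm_rscale Sz mulr1 ger0_norm.
  have e0 : enorm (0 : Cn R n) < 1 by rewrite /enorm hdot0l sqrtr0.
  have := @cauchy_formula R n n0 sigma hsigma (rscale s z) 0 es e0.
  rewrite hdot0r subr0 expr1n invr1 => H; apply: (etrans _ H).
  by apply: eq_Cint => x _; rewrite hdot0r subr0 expr1n divr1.
have I2 := CintableZl (2 : C) mS (Cintable_S sigma bk).
have I1 := Cintable_S sigma (bdm_cst S (1 : C)).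
have E1 := CintB mS I2 I1; apply: (etrans E1).
have E2 := CintZl 2 mS (Cintable_S sigma bk).
rewrite E2 k1 Cint_S_cst//; ring.
Qed.

(** The kernel 2 C - 1 has mean 1, so a constant in the density comes out of the exponent
    unchanged. *)
Lemma outer_log_shift (N : set (BorelCn R n)) (g G : BorelCn R n -> R) (m s : R) z :
  measurable N -> sigma N = 0%E ->
  Rintegrable sigma S g -> Rintegrable sigma S G ->
  (forall x, S x -> ~ N x -> g x = m + G x) -> 0 <= s < 1 -> unit_sphere z ->
  outer_log sigma g (rscale s z) = m%:C + outer_log sigma G (rscale s z).
Proof.
move=> mN N0 Ig IG gG s01 Sz.
pose k (x : BorelCn R n) : C := 2 * cauchy_kernel (rscale s z) x - 1.
have bk : bdm S k.
  apply: bdmD; last exact: bdm_cst.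
  by apply: bdmM; [exact: bdm_cst|exact: bdm_cauchy_kernel].
have [mk [K HK]] := bk.
have IkG : Cintable sigma S (fun x => k x * (G x)%:C) := Cintable_realM mS IG mk HK.
have Ikg : Cintable sigma S (fun x => k x * (g x)%:C) := Cintable_realM mS Ig mk HK.
have Ikm : Cintable sigma S (fun x => m%:C * k x) := CintableZl _ mS (Cintable_S sigma bk).
have E1 : Cint sigma S (fun x => m%:C * k x + k x * (G x)%:C) =
    m%:C + outer_log sigma G (rscale s z).
  apply: (etrans (CintD mS Ikm IkG)); congr (_ + _).
  apply: (etrans (CintZl _ mS (Cintable_S sigma bk))).
  by rewrite [X in _ * X](Cint_outer_kernel s01 Sz) mulr1.
apply: (etrans _ E1); apply: (Cint_off_null mS mN N0).
- exact: (Cintable_meas Ikg).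
- exact: (Cintable_meas (CintableD mS Ikm IkG)).
by move=> x Sx Nx; rewrite gG// real_complexD mulrDr [_ * m%:C]mulrC.
Qed.

(** [core_estimate] along the radii [approach r j], Fatou, then [limit_bounds] at almost every
    point. Its first conclusion feeds [phase_balance], which bounds Re c and the form; its second
    then controls f. *)
Lemma oscillation_integral : exists K : R, 0 < K /\
  forall (f : Cn R n -> C) (N : set (BorelCn R n)) (G : BorelCn R n -> R) (m r e J : R),
  measurable N -> sigma N = 0%E -> Rintegrable sigma S G ->
  (forall s z, 0 <= s < 1 -> unit_sphere z ->
     f (rscale s z) = cexp (m%:C + outer_log sigma G (rscale s z))) ->
  (forall x, S x -> ~ N x -> cvg (radial f x t @[t --> (1 : R)^'-]) /\
     cabs (boundary_value f x) = expR (m + G x)) ->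
  0 < r <= 1 -> 0 < e ->
  (forall x, ball1 (320 * r) x -> `|G x| <= e /\ expR (G x) <= 3 / 2) ->
  \int[sigma]_(x in far1 (320 * r)) (ndist x e1 ^- n.+1 * `|G x|) <= J ->
  exists a : C, (\int[sigma]_(z in ball1 (4 * r)) (cabs (boundary_value f z - a))%:E <=
    (K * expR m * r ^+ n * (e + r * J))%:E)%E.
Proof.
have [C1 [C10 core]] := core_estimate n0 hsigma.
pose A : R := 4 ^+ n * 4 ^+ n.
have A0 : 0 < A by rewrite mulr_gt0 ?exprn_gt0.
(* 6 times 6: the factor of [limit_bounds], and the sum of L, |Re c| and |l|, whose integrals are at
   most H, H and 4 H. *)
exists (36 * (C1 + A)); split; first by rewrite mulr_gt0// addr_gt0.
move=> f N G m r e J mN N0 IG fG bN r01 e0 Ge HJ.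
have [r0 r1] := andP r01.
have Ge1 x : ball1 (320 * r) x -> `|G x| <= e by case/Ge.
have [c [v Hcv]] := core G r e J r0 e0 IG Ge1 HJ.
have J0 : 0 <= J.
  apply: le_trans HJ; apply: Rintegral_ge0 => x _.
  by rewrite mulr_ge0// invr_ge0 exprn_ge0// ndist_ge0.
pose B := @ball1 R n (4 * r).
have mB : measurable B by exact: measurable_ball1.
have BS : B `<=` S by move=> x [].
have BB x : B x -> ball1 (320 * r) x.
  by move=> [Sx h]; split => //; apply: (le_trans h); rewrite ler_pM2r// ler_nat.
pose s j := approach r j.
have s01 j : 0 <= s j < 1 by have [] := approach_range j r01.
have sr j : 1 - s j <= r by have [] := approach_range j r01.
pose l (z : BorelCn R n) : C := hdot (tang z) v.
pose w j z := outer_log sigma G (rscale (s j) z).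
pose E j (z : BorelCn R n) : C := w j z - c - (s j)%:C * l z.
have HE j := Hcv (s j) (s01 j) (sr j).
pose H0 := C1 * r ^+ n * (e + r * J).
have IE j : Rintegrable sigma B (fun z => cabs (E j z)) by have [_ []] := HE j.
have [L [mL L0 LH Lfreq]] : exists L : BorelCn R n -> \bar R,
    [/\ measurable_fun B L, forall x, B x -> (0 <= L x)%E,
    (\int[sigma]_(x in B) L x <= H0%:E)%E &
    forall x y k, (L x < y%:E)%E -> exists2 j, (k <= j)%N & cabs (E j x) < y].
  apply: fatou_frequently => //.
  - by move=> j; apply/measurable_EFinP; have /measurable_int := IE j.
  - by move=> j x _; exact: cabs_ge0.
  - by move=> j; rewrite (EFin_Rintegral mB (IE j)) lee_fin; have [_ []] := HE j.
(* Re c is left out: it is not known in advance to be small, but [phase_balance] bounds it, and it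
   is then counted as an error. *)
pose a := cexp (m +i* complex.Im c)%C.
pose k := complex.Re c.
have pw x : B x -> ~ N x -> L x \is a fin_num ->
    `|complex.Re (l x) + k - G x| <= fine (L x) /\
    cabs (boundary_value f x - a) <= 6 * expR m * (fine (L x) + `|k| + cabs (l x)).
  move=> Bx Nx Lfin; have Sx := BS x Bx; have [cv bx] := bN x Sx Nx.
  have [||||||H1 H2] := @limit_bounds R (fun j => w j x) (fun j => E j x) s (l x) c
    (boundary_value f x) m (G x) (fine (L x)).
  - by [].
  - by move=> j; have /andP[-> /ltW] := s01 j.
  - by move=> e' e'0; exact: approach_cvg.
  - move=> e' e'0; have [d d0 Hd] := radial_limit cv e'0.
    have [k' Hk] := approach_cvg r0 d0; exists k' => j kj.
    rewrite -(fG (s j) x (s01 j) Sx); apply: Hd; have := Hk j kj.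
      rewrite -/(s j); lra.
    by have /andP[_] := s01 j.
  - exact: bx.
  - by move=> y k' Ly; apply: Lfreq; rewrite -(fineK Lfin) lte_fin.
  split; first exact: H1.
  by apply: H2; have [] := Ge x (BB x Bx).
pose V := vol sigma e1 (4 * r).
have Il : Cintable sigma B l by exact: (CintableS mB mS BS (Cintable_S sigma (bdm_tang v))).
have Icl := Cintable_cabs mB Il.
pose H := H0 + e * V.
(* Pointwise |Re l + k| <= L + |G| off [N], and there is nothing to check where L is infinite. *)
have Hk : \int[sigma]_(z in B) `|complex.Re (l z) + k| <= H.
  have Ik : Rintegrable sigma B (fun=> k).
    exact: integrable_sphere_cst.
  have [IRe _] := Il.
  have IRk : Rintegrable sigma B (fun z => complex.Re (l z) + k).
    by apply: eq_integrable (integrableD mB IRe Ik).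
  have InR : Rintegrable sigma B (fun z => `|complex.Re (l z) + k|).
    exact: integrable_norm.
  rewrite -lee_fin -(EFin_Rintegral mB InR).
  have Ve : (\int[sigma]_(x in B) e%:E = (e * V)%:E)%E.
    rewrite integral_cst// EFinM; congr (_ * _)%E.
    by rewrite /V /vol fineK//; apply: fin_num_measure.
  rewrite /H EFinD; apply: (le_trans _ (leeD2r _ LH)); rewrite -Ve.
  rewrite -ge0_integralD//; last by move=> x _; rewrite lee_fin ltW.
  apply: (ge0_le_integral_off_null mB mN N0) => //.
  - by move=> x Bx; rewrite adde_ge0 ?L0// lee_fin ltW.
  - by apply: emeasurable_funD => //; exact: measurable_cst.
  move=> x Bx Nx; have := L0 x Bx; case LE: (L x) => [y| |] // _; last by rewrite leey.
  have Lfin : L x \is a fin_num by rewrite LE.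
  have [H1 _] := pw x Bx Nx Lfin; rewrite LE /= in H1.
  rewrite -EFinD lee_fin.
  have h := Ge1 x (BB x Bx).
  have -> : complex.Re (l x) + k = (complex.Re (l x) + k - G x) + G x by rewrite subrK.
  by rewrite (le_trans (ler_normD _ _))// lerD.
have [kV lH] := phase_balance n0 hsigma Hk.
exists a.
have e6 : 0 <= 6 * expR m by rewrite mulr_ge0// expR_ge0.
apply: (@le_trans _ _ (\int[sigma]_(x in B) ((6 * expR m)%:E * (L x + (`|k| + cabs (l x))%:E)))%E).
  apply: (ge0_le_integral_off_null mB mN N0).
  - by move=> x _; rewrite lee_fin cabs_ge0.
  - by move=> x Bx; rewrite mule_ge0 ?lee_fin// adde_ge0 ?L0// lee_fin addr_ge0// cabs_ge0.
  - apply: emeasurable_funM; first exact: measurable_cst.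
    apply: emeasurable_funD => //; apply/measurable_EFinP; apply: measurable_funD.
      exact: measurable_cst.
    by apply/measurable_EFinP; have /measurable_int := Icl.
  move=> x Bx Nx; have := L0 x Bx; case LE: (L x) => [y| |] // _; last first.
    by rewrite addye// gt0_muley ?leey// lte_fin mulr_gt0// expR_gt0.
  have Lfin : L x \is a fin_num by rewrite LE.
  have [_ H2] := pw x Bx Nx Lfin; rewrite LE /= in H2.
  by rewrite -EFinD -EFinM lee_fin addrA.
have mkl : measurable_fun B (fun x => (`|k| + cabs (l x))%:E).
  apply/measurable_EFinP; apply: measurable_funD; first exact: measurable_cst.
  by apply/measurable_EFinP; have /measurable_int := Icl.
have kl0 x : B x -> (0 <= (`|k| + cabs (l x))%:E)%E by rewrite lee_fin addr_ge0// cabs_ge0.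
rewrite ge0_integralZl//; last 2 first.
- by apply: emeasurable_funD.
- by move=> x Bx; rewrite adde_ge0 ?L0// kl0.
rewrite ge0_integralD//.
have Ikl : (\int[sigma]_(x in B) (`|k| + cabs (l x))%:E <= (5 * H)%:E)%E.
  have Ink : Rintegrable sigma B (fun=> `|k|).
    exact: integrable_sphere_cst.
  have Is : Rintegrable sigma B (fun x => `|k| + cabs (l x)).
    by apply: eq_integrable (integrableD mB Ink Icl).
  rewrite (EFin_Rintegral mB Is) lee_fin (RintegralD mB Ink Icl) (Rintegral_cst sigma mB).
  have -> : 5 * H = H + 4 * H by ring.
  exact: lerD kV lH.
have step := lee_wpmul2l (x := (6 * expR m)%:E) _ (leeD LH Ikl).
apply: (le_trans (step _)); first by rewrite lee_fin.
rewrite -EFinD -EFinM lee_fin.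
have VA : V <= A * r ^+ n.
  have r4 : 0 < 4 * r by rewrite mulr_gt0.
  have := vol_upper n0 hsigma (enorm_e1 n0) r4.
  by rewrite exprMn mulrA.
have rn0 : 0 <= r ^+ n by rewrite exprn_ge0 ?(ltW r0).
have rJ : 0 <= r * J by rewrite mulr_ge0// ltW.
have HH : H <= (C1 + A) * r ^+ n * (e + r * J).
  rewrite /H /H0 [in leRHS]mulrDl mulrDl lerD2l.
  apply: (@le_trans _ _ (e * (A * r ^+ n))); first by rewrite ler_pM2l.
  by rewrite mulrC ler_wpM2l ?lerDl// mulr_ge0// ltW.
have H0H : H0 <= H by rewrite /H lerDl mulr_ge0 ?vol_ge0 ?(ltW e0).
have -> : 36 * (C1 + A) * expR m * r ^+ n * (e + r * J) =
   6 * expR m * (6 * ((C1 + A) * r ^+ n * (e + r * J))) by ring.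
rewrite ler_wpM2l//; have E6 : 6 * H = H + 5 * H by ring.
apply: (@le_trans _ _ (6 * H)); first by rewrite E6 lerD2r.
by rewrite ler_pM2l.
Qed.

End OscillationIntegral.

(** * Boundary data of an outer function *)

Section BoundaryData.
Context {R : realType} {n : nat}.
Local Notation C := (Cplx R).
Hypothesis n0 : (0 < n)%N.
Variable sigma : probability (BorelCn R n) R.
Hypothesis hsigma : rotation_invariant_sphere_measure sigma.
Local Notation S := (@unit_sphere R n : set (BorelCn R n)).
Let mS : measurable S := @measurable_sphere R n.
Variables (f : Cn R n -> C) (phi : Cn R n -> R).
Hypothesis fO : outer sigma f.
Hypothesis phiE :
  {ae sigma, forall t, unit_sphere t -> phi t = cabs (boundary_value f t)}.
Local Notation b := (boundary_value f).
Local Notation g := (fun x : BorelCn R n => ln (cabs (b x))).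

(** At 0 the conventions agree: [lne] gives -oo, whose [fine] is 0, and [ln] gives 0. *)
Lemma fine_lne (x : R) : 0 <= x -> fine (lne x%:E) = ln x.
Proof.
rewrite le_eqVlt => /orP[/eqP <-|x0]; last by rewrite lne_EFin.
by rewrite /lne lexx /= ln0.
Qed.

(** The nonvanishing comes from integrability of the extended logarithm, which is therefore finite
    almost everywhere. *)
Lemma exceptional_set : exists N : set (BorelCn R n),
  [/\ measurable N, sigma N = 0%E & forall x : Cn R n, S x -> ~ N x ->
    [/\ cvg (radial f x t @[t --> (1 : R)^'-]), phi x = cabs (b x) & 0 < cabs (b x)]].
Proof.
have [f1 f2 _] := fO.
have f3 := integrable_ae mS f2.
have [N [mN N0 HN]] := negligibleU (negligibleU f1 phiE) f3.
exists N; split => // x Sx Nx.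
have out (P : Prop) : (~ P -> N x) -> P by move=> h; apply: contrapT => /h.
split.
- by apply: out => h; apply: HN; left; left => /(_ Sx).
- by apply: out => h; apply: HN; left; right => /(_ Sx).
apply: out => h; apply: HN; right => /(_ Sx); apply/negP.
move: h => /negP; rewrite lt_neqAle cabs_ge0 andbT negbK => /eqP <-.
by rewrite /lne lexx.
Qed.

Lemma measurable_log_boundary : measurable_fun S g.
Proof.
have [_ f2 _] := fO.
have -> : g = fine \o (fun x : BorelCn R n => lne (cabs (b x))%:E).
  by apply/funext => x /=; rewrite fine_lne// cabs_ge0.
by apply: measurableT_comp => //; have /measurable_int := f2.
Qed.

Lemma integrable_log_boundary : Rintegrable sigma S g.
Proof.
have [_ f2 _] := fO.
apply: le_integrable f2 => //; first by apply/measurable_EFinP; exact: measurable_log_boundary.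
by move=> x _ /=; case: ifP => // _; rewrite leey.
Qed.

(** [phi] need not be measurable, so the given moment is a lower integral; the measurable function
    built from the boundary values is a minorant off a null set. *)
Lemma log_moment (p Bp : R) : 0 < p ->
  (\int[sigma]_(t in S) (`|lne (phi (t : Cn R n))%:E| `^ p) = Bp%:E)%E ->
  Rintegrable sigma S (fun x => `|g x| `^ p) /\
  \int[sigma]_(x in S) `|g x| `^ p <= Bp.
Proof.
move=> p0 HB; have [N [mN N0 HN]] := exceptional_set.
have mg : measurable_fun S (fun x => `|g x| `^ p).
  apply: (@measurableT_comp _ _ _ _ _ _ (@powR R ^~ p)); first exact: measurable_powR.
  by apply: measurableT_comp => //; exact: measurable_log_boundary.
have le : (\int[sigma]_(x in S) (`|g x| `^ p)%:E <= Bp%:E)%E.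
  rewrite -HB; apply: (ge0_le_integral_off_null_minorant mS mN N0 mg).
  - by move=> x _; exact: powR_ge0.
  - by move=> x _; exact: poweR_ge0.
  by move=> x Sx Nx; have [_ E b0] := HN x Sx Nx; rewrite E lne_EFin.
have I : Rintegrable sigma S (fun x => `|g x| `^ p).
  apply/integrableP; split; first exact/measurable_EFinP.
  apply: le_lt_trans (ltry Bp); apply: le_trans le.
  by apply: ge0_le_lower_integral => x _ //=; rewrite lee_fin ger0_norm// powR_ge0.
by split => //; rewrite -lee_fin -EFin_Rintegral.
Qed.

(** Distances are at most 2, so a larger phi(1) would force phi >= exp X on the whole sphere with X
    = |Bp| + 1 >= 1; then |log phi|^p >= X everywhere, and its integral would exceed Bp. *)
Lemma phi_e1_le (alpha C0 p Bp : R) : 0 < alpha -> 0 < C0 -> 1 < p ->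
  (forall t, unit_sphere t -> `|phi t - phi e1| <= C0 * ndist t e1 `^ alpha) ->
  (\int[sigma]_(t in S) (`|lne (phi (t : Cn R n))%:E| `^ p) = Bp%:E)%E ->
  phi e1 <= C0 * 2 `^ alpha + expR (`|Bp| + 1).
Proof.
move=> a0 C00 p1 Hphi HB; rewrite leNgt; apply/negP => h.
set X := `|Bp| + 1 in h.
have X1 : 1 <= X by rewrite lerDr.
have S1 : unit_sphere (e1 : Cn R n) := enorm_e1 n0.
have big t : unit_sphere t -> expR X <= phi t.
  move=> St; have := Hphi t St; rewrite ler_norml => /andP[h1 _].
  have : C0 * ndist t e1 `^ alpha <= C0 * 2 `^ alpha.
    by rewrite ler_pM2l// powR_mono ?ndist_ge0 ?ndist_le2// ltW.
  lra.
have : (X%:E <= Bp%:E)%E.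
  rewrite -HB; apply: (@le_trans _ _ (\int[sigma]_(t in S) X%:E)%E).
    rewrite integral_cst//; rewrite [X in (_ <= _ * X)%E](_ : _ = 1%E) ?mule1//.
    exact: hsigma.1.
  apply: ge0_le_lower_integral => t St; first by rewrite lee_fin; lra.
  have bt := big t St; have pt : 0 < phi t by exact: lt_le_trans (expR_gt0 _) bt.
  rewrite lne_EFin// /= lee_fin.
  have lX : X <= ln (phi t) by rewrite -[X]expRK ler_ln ?posrE ?expR_gt0.
  have l1 : 1 <= `|ln (phi t)| by rewrite (le_trans _ (ler_norm _))// (le_trans X1).
  rewrite (le_trans lX)// (le_trans (ler_norm _))// -{1}[`|ln _|]powRr1//.
  by apply: ler_powR => //; exact: ltW.
by rewrite lee_fin /X; have := ler_norm Bp; lra.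
Qed.

Lemma outer_radial (s : R) (z : Cn R n) : 0 <= s < 1 -> unit_sphere z ->
  f (rscale s z) = cexp (outer_log sigma g (rscale s z)).
Proof.
move=> /andP[s0 s1] Sz; have [_ _ H] := fO; apply: H.
by rewrite /unit_ball /= enorm_rscale Sz mulr1 ger0_norm.
Qed.

Lemma mean_oscillation_le (Q : set (BorelCn R n)) (a : C) (I Y : R) :
  measurable Q -> (\int[sigma]_(z in Q) (cabs (b z - a))%:E <= I%:E)%E ->
  0 <= Y -> I <= Y * fine (sigma Q) ->
  (mean_oscillation sigma b Q <= Y%:E)%E.
Proof.
move=> mQ HI Y0 IY.
have v0 : 0 <= (fine (sigma Q))^-1 by rewrite invr_ge0 fine_ge0.
apply: (@le_trans _ _ ((fine (sigma Q))^-1%:E * \int[sigma]_(z in Q) (cabs (b z - a))%:E)%E).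
  by apply: ereal_inf_lbound; exists a.
apply: (le_trans (lee_wpmul2l _ HI)); first by rewrite lee_fin.
rewrite -EFinM lee_fin; apply: (le_trans (ler_wpM2l v0 IY)).
(* For a null ball the inverse of the volume is 0 by convention. *)
have [->|V0] := eqVneq (fine (sigma Q)) 0; first by rewrite mulr0 mulr0.
by rewrite mulrCA mulVf// mulr1.
Qed.

Lemma mean_oscillation_le_sup (xi : Cn R n) (r Y : R) : 0 <= Y ->
  (forall x, nball xi r x -> phi x <= Y) ->
  (mean_oscillation sigma b (nball xi r) <= Y%:E)%E.
Proof.
move=> Y0 HY; have [N [mN N0 HN]] := exceptional_set.
have mQ : measurable (nball xi r : set (BorelCn R n)) by exact: measurable_nball.
(* The comparison constant is 0: f itself is small. *)
apply: (@mean_oscillation_le _ 0 (Y * fine (sigma (nball xi r : set (BorelCn R n))))) => //.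
have -> : (Y * fine (sigma (nball xi r : set (BorelCn R n))))%:E =
    (\int[sigma]_(z in (nball xi r : set (BorelCn R n))) Y%:E)%E.
  by rewrite integral_cst// EFinM fineK//; exact: fin_num_measure.
apply: (ge0_le_integral_off_null mQ mN N0) => //.
- by move=> x _; rewrite lee_fin cabs_ge0.
move=> x Qx Nx; have [Sx _] := Qx; have [_ E _] := HN x Sx Nx.
by rewrite subr0 lee_fin -E; exact: HY.
Qed.

(** The quasi-triangle constant 2 times the sum of two radii. *)
Lemma nball_sub_ball1 (xi : Cn R n) (r : R) : unit_sphere xi -> nball xi r e1 ->
  (nball xi r : set (BorelCn R n)) `<=` ball1 (4 * r).
Proof.
move=> Sxi [S1 h1] x [Sx hx]; split => //=.
have := ndist_quasi Sx Sxi S1; rewrite [ndist xi e1]ndistC; lra.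
Qed.

End BoundaryData.

(** [rho] is the distance at which the Hoelder bound reaches y / 2, y being the value at 1; up to it
    x / y stays within 1/2 of 1 and [dist_ln_le] applies. *)
Lemma log_holder (R : realType) (alpha C0 x y d rho : R) :
  0 < alpha -> 0 < C0 -> 0 < x -> 0 < y -> 0 < rho -> y = 2 * C0 * rho `^ alpha ->
  0 <= d <= rho -> `|x - y| <= C0 * d `^ alpha ->
  `|ln x - ln y| <= (d / rho) `^ alpha /\ expR (ln x - ln y) <= 3 / 2.
Proof.
move=> a0 C00 x0 y0 rho0 yE /andP[d0 dr] xy.
have ra := powR_gt0 alpha rho0.
have da : d `^ alpha <= rho `^ alpha by apply: powR_mono => //; exact: ltW.
have xy2 : `|x - y| <= y / 2.
  apply: (le_trans xy); have -> : y / 2 = C0 * rho `^ alpha by rewrite yE; field.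
  by rewrite ler_pM2l.
split.
  apply: (le_trans (dist_ln_le x0 y0 xy2)).
  have -> : (d / rho) `^ alpha = d `^ alpha / rho `^ alpha.
    by rewrite powRM ?invr_ge0 ?(ltW rho0)// -powR_inv1 ?(ltW rho0)// -powRrM mulN1r powRN.
  have -> : d `^ alpha / rho `^ alpha = 2 * (C0 * d `^ alpha) / y.
    by rewrite yE; field; rewrite !gt_eqF.
  by rewrite ler_pM2r ?invr_gt0// ler_pM2l.
rewrite expRD expRN !lnK// ler_pdivrMr//.
by move: xy2; rewrite ler_norml => /andP[_]; lra.
Qed.

Section LargeBoundaryValue.
Context {R : realType} {n : nat}.
Local Notation C := (Cplx R).
Hypothesis n0 : (0 < n)%N.
Variable sigma : probability (BorelCn R n) R.
Hypothesis hsigma : rotation_invariant_sphere_measure sigma.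
Local Notation S := (@unit_sphere R n : set (BorelCn R n)).
Let mS : measurable S := @measurable_sphere R n.

(** The first lower bound on phi(1) means r^gamma <= rho^alpha; the second, with r^alpha <= r^gamma,
    gives 320 r <= rho, so that the cut lies in the region where G is Hoelder. *)
Lemma oscillation_large (alpha p q C0 W M0 : R) :
  0 < alpha < 1 -> 1 < p -> p^-1 + q^-1 = 1 -> 0 < C0 -> 0 <= W ->
  exists K : R, 0 <= K /\ forall (f : Cn R n -> C) (phi : Cn R n -> R),
  outer sigma f ->
  {ae sigma, forall t, unit_sphere t -> phi t = cabs (boundary_value f t)} ->
  (forall t, unit_sphere t -> `|phi t - phi e1| <= C0 * ndist t e1 `^ alpha) ->
  Rintegrable sigma S
    (fun x : BorelCn R n => `|ln (cabs (boundary_value f (x : Cn R n)))| `^ p) ->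
  \int[sigma]_(x in S) `|ln (cabs (boundary_value f (x : Cn R n)))| `^ p <= W ->
  0 < phi e1 <= M0 ->
  forall r, 0 < r <= 1 ->
  2 * C0 * r `^ (alpha / (1 + n%:R / p)) <= phi e1 ->
  2 * C0 * 320 `^ alpha * r `^ (alpha / (1 + n%:R / p)) <= phi e1 ->
  exists a : C, (\int[sigma]_(z in ball1 (4 * r)) (cabs (boundary_value f z - a))%:E <=
    (K * r ^+ n * r `^ (alpha / (1 + n%:R / p)))%:E)%E.
Proof.
move=> a01 p1 pq C00 W0.
have [K1 [K10 far]] := far_integral_bound n0 hsigma a01 p1 pq.
have [K2 [K20 osc]] := oscillation_integral n0 hsigma.
have [a0 a1] := andP a01.
have p0 : 0 < p by lra.
pose de : R := n%:R / p.
have de0 : 0 < de by rewrite divr_gt0 ?ltr0n.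
(* With this exponent phi(1)^(-d') is a constant times rho^(-de), the size allowed for |m| in
   [scale_bound]. *)
pose d' := de / alpha.
have d'0 : 0 < d' by rewrite divr_gt0.
have c2 : 0 < 2 * C0 by rewrite mulr_gt0.
pose Cm := (M0 `^ (2 * d') + 1) / d' * (2 * C0) `^ (- d').
have Cm0 : 0 <= Cm.
  by rewrite mulr_ge0 ?powR_ge0// divr_ge0 ?(ltW d'0)// addr_ge0 ?powR_ge0.
pose C3 := 320 `^ alpha + K1 * (320 `^ (alpha - 1) + (W + 1) + Cm).
have C30 : 0 <= C3.
  apply: addr_ge0; first exact: powR_ge0.
  apply: (mulr_ge0 (ltW K10)); apply: (addr_ge0 _ Cm0).
  exact: (addr_ge0 (powR_ge0 _ _) (addr_ge0 W0 ler01)).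
exists (K2 * (2 * C0 * C3)); split.
  by rewrite !mulr_ge0 ?(ltW K20) ?(ltW C00).
move=> f phi fO phiE Hphi Ig gW /andP[f10 f1M] r r01 hr1 hr2.
have [r0 r1] := andP r01.
have p320 : 0 < 320 :> R by rewrite ltr0n.
have h32 : 1 <= 3 / 2 :> R by rewrite ler_pdivlMr// mul1r ler_nat.
set ga := alpha / (1 + de).
set f1 := phi e1 in f10 f1M Hphi hr1 hr2.
pose rho := (f1 / (2 * C0)) `^ alpha^-1.
have q0 : 0 < f1 / (2 * C0) by rewrite divr_gt0.
have rho0 : 0 < rho by exact: powR_gt0.
have rhoa : rho `^ alpha = f1 / (2 * C0).
  by rewrite /rho -powRrM mulVf ?gt_eqF// powRr1 ?(ltW q0).
have f1E : f1 = 2 * C0 * rho `^ alpha by rewrite rhoa mulrC divfK// gt_eqF.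
clearbody rho f1.
have rg : r `^ ga <= rho `^ alpha by rewrite rhoa ler_pdivlMr// mulrC.
have d1 : 1 <= 1 + de by rewrite lerDl ltW.
have gaa : ga <= alpha.
  by rewrite /ga ler_pdivrMr ?(lt_le_trans ltr01 d1)// (ler_peMr (ltW a0)).
have ra : r `^ alpha <= r `^ ga by apply: ger_powR; rewrite ?r0 ?r1.
have r320 : 0 < 320 * r by rewrite mulr_gt0.
have rrho : 320 * r <= rho.
  have : (320 * r) `^ alpha <= rho `^ alpha.
    rewrite powRM ?(ltW p320) ?(ltW r0)// rhoa ler_pdivlMr// mulrC mulrA.
    apply: le_trans hr2; exact: (ler_wpM2l (mulr_ge0 (ltW c2) (powR_ge0 _ _)) ra).
  have ai : 0 <= alpha^-1 by rewrite invr_ge0 ltW.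
  move=> h; have := powR_mono (powR_ge0 _ _) h ai.
  rewrite -(powRrM (320 * r)) -(powRrM rho) divff ?gt_eqF//.
  by rewrite (powRr1 (ltW r320)) (powRr1 (ltW rho0)).
have [N [mN N0 HN]] := exceptional_set fO phiE.
pose b := boundary_value f.
pose g (x : BorelCn R n) := ln (cabs (b x)).
pose m := ln f1.
have em : expR m = f1 by rewrite /m lnK.
have Igg : Rintegrable sigma S g by exact: (integrable_log_boundary fO).
(* On [N] the boundary values are not tied to [phi]; the value 0 makes the two bounds on [G] hold at
   every point of the ball, as [oscillation_integral] asks. *)
pose G (x : BorelCn R n) := if x \in N then 0 else g x - m.
have mG : measurable_fun S G.
  apply: measurable_off_null => //; apply: measurable_funB; first exact: (measurable_log_boundary fO).
  exact: measurable_cst.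
have Gg x : S x -> `|G x| <= `|g x| + `|m|.
  move=> _; rewrite /G; case: ifP => _; last exact: ler_normB.
  by rewrite normr0 addr_ge0.
have gG x : S x -> ~ N x -> g x = m + G x.
  by move=> _ Nx; rewrite /G memNset// addrC subrK.
have IG : Rintegrable sigma S G.
  have Im : Rintegrable sigma S (fun=> `|m|).
    exact: integrable_sphere_cst.
  have Igm : Rintegrable sigma S (fun x => `|g x| + `|m|).
    by apply: eq_integrable (integrableD mS (integrable_norm Igg) Im).
  apply: le_integrable Igm => //; first exact/measurable_EFinP.
  by move=> x Sx /=; rewrite lee_fin (le_trans (Gg x Sx))// ler_norm.
have Grho x : ball1 rho x -> `|G x| <= (ndist x e1 / rho) `^ alpha /\
    expR (G x) <= 3 / 2.
  move=> [Sx dx]; rewrite /G; case: ifPn => [_|nN].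
    by rewrite normr0 powR_ge0 expR0; split.
  have Nx : ~ N x by move=> Nx; rewrite mem_set in nN.
  have [_ E b0] := HN x Sx Nx; rewrite /g /m /b -E.
  rewrite -E in b0.
  by apply: (log_holder a0 C00 b0 f10 rho0 f1E _ (Hphi x Sx)); rewrite ndist_ge0.
have Ga x : ball1 rho x -> `|G x| <= (ndist x e1 / rho) `^ alpha by case/Grho.
have rr : 0 < 320 * r <= rho by rewrite r320.
have HJ := far G g m rho (320 * r) W rho0 rr W0 IG Ig gW Gg Ga.
set J := K1 * _ in HJ.
pose e := (320 * r / rho) `^ alpha.
have e0 : 0 < e by exact: (powR_gt0 _ (divr_gt0 r320 rho0)).
have Ge x : ball1 (320 * r) x -> `|G x| <= e /\ expR (G x) <= 3 / 2.
  move=> [Sx dx]; have Bx : ball1 rho x by split => //; exact: le_trans rrho.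
  have [h1 h2] := Grho x Bx; split => //; apply: (le_trans h1).
  apply: powR_mono; [|by rewrite ler_pM2r ?invr_gt0|exact: ltW].
  by rewrite divr_ge0 ?ndist_ge0// ltW.
have fG s z : 0 <= s < 1 -> unit_sphere z ->
    f (rscale s z) = cexp (m%:C + outer_log sigma G (rscale s z)).
  move=> s01 Sz; rewrite (outer_radial fO s01 Sz); congr cexp.
  exact: (outer_log_shift n0 hsigma mN N0 Igg IG gG s01 Sz).
have bN x : S x -> ~ N x -> cvg (radial f x t @[t --> (1 : R)^'-]) /\
     cabs (boundary_value f x) = expR (m + G x).
  move=> Sx Nx; have [cv E b0] := HN x Sx Nx; split => //.
  by rewrite -(gG x Sx Nx) /g lnK.
have [a Ha] := osc f N G m r e J mN N0 IG fG bN r01 e0 Ge HJ.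
exists a; apply: (le_trans Ha); rewrite lee_fin.
have mm : `|m| <= Cm * rho `^ (- de).
  have fM : 0 < f1 <= M0 by rewrite f10.
  have fp : f1 `^ (- d') = (2 * C0) `^ (- d') * rho `^ (- de).
    rewrite [in LHS]f1E (powRM _ (ltW c2) (powR_ge0 _ _)) -(powRrM rho); congr (_ * _ `^ _).
    by rewrite /d'; field; rewrite gt_eqF.
  by have := norm_ln_le d'0 fM; rewrite fp mulrA.
have SB := scale_bound a01 de0 (ltW K10) W0 Cm0 r01 rho0 (normr_ge0 m) rg mm.
rewrite -/e -/J -/C3 -/ga in SB.
rewrite em {1}f1E.
have c3 : 0 <= K2 * (2 * C0) * r ^+ n by rewrite !mulr_ge0 ?exprn_ge0 ?(ltW K20) ?(ltW C00) ?(ltW r0).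
have := ler_wpM2l c3 SB; move: (rho `^ alpha) (r `^ ga) => X Y.
have -> : K2 * (2 * C0) * r ^+ n * (X * (e + r * J)) =
  K2 * (2 * C0 * X) * r ^+ n * (e + r * J) by ring.
by have -> : K2 * (2 * C0) * r ^+ n * (C3 * Y) = K2 * (2 * C0 * C3) * r ^+ n * Y by ring.
Qed.

End LargeBoundaryValue.

Theorem theorem1 (R : realType) (n : nat) (hn : (2 <= n)%N)
    (sigma : probability (BorelCn R n) R)
    (hsigma : rotation_invariant_sphere_measure sigma)
    (alpha p q : R) (halpha : 0 < alpha < 1) (hp : 1 < p)
    (hpq : p^-1 + q^-1 = 1) (C0 Bp : R) (hC0 : 0 < C0) :
  exists C : R,
    forall (f : Cn R n -> Cplx R) (phi : Cn R n -> R),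
      outer sigma f ->
      (forall t, unit_sphere t -> 0 <= phi t) ->
      {ae sigma, forall t, unit_sphere t -> phi t = cabs (boundary_value f t)} ->
      (forall t, unit_sphere t ->
         `|phi t - phi e1| <= C0 * ndist t e1 `^ alpha) ->
      (\int[sigma]_(t in unit_sphere) (`|lne (phi t)%:E| `^ p) = Bp%:E)%E ->
      forall (xi : Cn R n) (r : R),
        unit_sphere xi -> 0 < r -> nball xi r e1 ->
        (mean_oscillation sigma (boundary_value f) (nball xi r)
          <= (C * r `^ (alpha / (n%:R + 1 - n%:R / q)))%:E)%E.
Proof.
have n0 : (0 < n)%N by exact: ltn_trans hn.
have [a0 a1] := andP halpha.
have p0 : 0 < p by lra.
(* In terms of p the exponent shows the decay rate 1 + n/p of the far integral. *)
have -> : n%:R + 1 - n%:R / q = 1 + n%:R / p.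
  have -> : q^-1 = 1 - p^-1 by rewrite -hpq [p^-1 + _]addrC addrK.
  by ring.
set ga := alpha / (1 + n%:R / p).
have de0 : 0 <= n%:R / p by rewrite divr_ge0 ?ler0n ?(ltW p0).
have ga0 : 0 <= ga by rewrite divr_ge0 ?(ltW a0)//; lra.
have gaa : ga <= alpha by rewrite /ga ler_pdivrMr ?ler_peMr ?(ltW a0)//; lra.
pose M0 : R := C0 * 2 `^ alpha + expR (`|Bp| + 1).
have M00 : 0 <= M0 by rewrite addr_ge0 ?expR_ge0// mulr_ge0 ?powR_ge0// ltW.
have [K [K0 large]] := oscillation_large n0 hsigma M0 halpha hp hpq hC0 (normr_ge0 Bp).
have [c [c0 Hc]] := vol_lower n0 hsigma.
(* [M0], an upper bound of phi(1), confines the large case to r <= 1; the other two summands provide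
   the two lower bounds required by [oscillation_large]. *)
pose M := M0 + 2 * C0 + 2 * C0 * 320 `^ alpha.
have c320 : 0 <= 2 * C0 * 320 `^ alpha by rewrite !mulr_ge0 ?powR_ge0 ?(ltW hC0).
have MM : M0 <= M by rewrite /M -addrA lerDl addr_ge0// mulr_ge0// ltW.
have M0' : 0 <= M by exact: le_trans MM.
(* M + 4 C0 serves a small phi(1), and K / c a large one, where c is the constant of the lower
   volume bound. *)
exists (M + 4 * C0 + K / c) => f phi fO _ phiE Hphi HB xi r Sxi r0 Qe.
have g0 : 0 <= r `^ ga by exact: powR_ge0.
have Kc : 0 <= K / c by rewrite divr_ge0// ltW.
have C04 : 0 <= M + 4 * C0 by rewrite addr_ge0// mulr_ge0// ltW.
have [small|big] := leP (phi e1) (M * r `^ ga).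
  have Y0 : 0 <= (M + 4 * C0) * r `^ ga by rewrite mulr_ge0.
  apply: (le_trans (@mean_oscillation_le_sup R n sigma f phi fO phiE xi r _ Y0 _)).
    move=> x Qx; have [Sx dx] := nball_sub_ball1 Sxi Qe Qx.
    have := Hphi x Sx; rewrite ler_norml => /andP[_ h].
    suff : ndist x e1 `^ alpha <= 4 * r `^ ga.
      by rewrite -(ler_pM2l hC0); lra.
    have four : 4 `^ alpha <= 4 :> R.
      by rewrite -{2}[4]powRr1//; apply: ler_powR; rewrite ?ler1n// ltW.
    (* For r <= 1 the exponent alpha may be lowered to gamma; for r > 1 the distance is at most 2,
       and r^gamma >= 1. *)
    have [r1|r1] := leP r 1.
      apply: (@le_trans _ _ ((4 * r) `^ alpha)).
        by apply: powR_mono; rewrite ?ndist_ge0 ?(ltW a0).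
      rewrite powRM ?(ltW r0)//; apply: ler_pM => //; try exact: powR_ge0.
      by apply: ger_powR; rewrite ?r0 ?r1.
    apply: (@le_trans _ _ (4 `^ alpha)).
      apply: powR_mono; rewrite ?ndist_ge0 ?(ltW a0)//.
      by apply: (le_trans (ndist_le2 Sx (enorm_e1 n0))); lra.
    apply: (le_trans four); rewrite ler_peMr//.
    by rewrite -(powRr0 r); apply: ler_powR => //; exact: ltW.
  by rewrite lee_fin ler_wpM2r// lerDl.
have f10 : 0 < phi e1 by apply: le_lt_trans big; exact: mulr_ge0.
have f1M := phi_e1_le n0 hsigma a0 hC0 hp Hphi HB.
(* For r > 1, M r^gamma would be at least M >= M0 >= phi(1). *)
have r1 : r <= 1.
  rewrite leNgt; apply/negP => r1.
  have : 1 <= r `^ ga by rewrite -(powRr0 r); apply: ler_powR => //; exact: ltW.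
  move=> /(ler_wpM2l M0'); rewrite mulr1 => h.
  by have := lt_le_trans big (le_trans f1M (le_trans MM h)); rewrite ltxx.
have r01 : 0 < r <= 1 by rewrite r0.
have [Ig gW] := log_moment fO phiE p0 HB.
have gW' := le_trans gW (ler_norm Bp).
have f1M0 : 0 < phi e1 <= M0 by rewrite f10.
have h1 : 2 * C0 * r `^ ga <= phi e1.
  by apply: le_trans (ltW big); rewrite ler_wpM2r// /M addrAC lerDr addr_ge0.
have h2 : 2 * C0 * 320 `^ alpha * r `^ ga <= phi e1.
  by apply: le_trans (ltW big); rewrite ler_wpM2r// /M lerDr addr_ge0// mulr_ge0// ltW.
have [a Ha] := large f phi fO phiE Hphi Ig gW' f1M0 r r01 h1 h2.
have Y0 : 0 <= (M + 4 * C0 + K / c) * r `^ ga by rewrite mulr_ge0// addr_ge0.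
have mQ : measurable (nball xi r : set (BorelCn R n)) by exact: measurable_nball.
apply: (mean_oscillation_le (a := a) (I := K * r ^+ n * r `^ ga) mQ _ Y0).
  apply: le_trans Ha; apply: ge0_lower_integral_subset; first exact: nball_sub_ball1.
  by move=> x _; rewrite lee_fin cabs_ge0.
have vQ := Hc xi r Sxi r01; rewrite /vol in vQ.
apply: (@le_trans _ _ (K / c * r `^ ga * (c * r ^+ n))).
  rewrite le_eqVlt; apply/orP; left; apply/eqP.
  by field; rewrite gt_eqF.
apply: ler_pM => //; first by rewrite mulr_ge0.
  by rewrite mulr_ge0 ?exprn_ge0 ?(ltW c0) ?(ltW r0).
by rewrite ler_wpM2r// lerDr.
Qed.
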